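(* Graph Isomorphism is polynomial-time solvable on $(\overline{2P_1+P_3},P_2+P_3)$-free graphs.
   Context: Graph Isomorphism is the problem of deciding, given two graphs $G$ and $H$, whether there is an isomorphism from $G$ to $H$. A graph is $(H_1,H_2)$-free if it contains no induced subgraph isomorphic to $H_1$ or $H_2$. $P_r$ denotes the path on $r$ vertices, $G+H$ denotes disjoint union, $tG$ denotes $t$ disjoint copies of $G$, and $\overline{G}$ denotes the complement of $G$. *)

(* Defs.v *)
From mathcomp Require Import all_boot.
Set Implicit Arguments. Unset Strict Implicit. Unset Printing Implicit Defensive.

Definition simple_graph (V : finType) (e : rel V) : Prop :=
  symmetric e /\ irreflexive e.

Definition induced_sub (k : nat) (H : rel 'I_k) (V : finType) (G : rel V) : Prop :=
  exists f : 'I_k -> V, injective f /\ forall x y, H x y = G (f x) (f y).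

Definition H_free (k : nat) (H : rel 'I_k) (V : finType) (G : rel V) : Prop :=
  ~ induced_sub H G.

Definition compl_graph (V : finType) (G : rel V) : rel V :=
  fun x y => (x != y) && ~~ G x y.

Definition g2P1_P3 : rel 'I_5 := fun x y =>
  let a := nat_of_ord x in let b := nat_of_ord y in
  ((a == 2) && (b == 3)) || ((a == 3) && (b == 2)) ||
  ((a == 3) && (b == 4)) || ((a == 4) && (b == 3)).

Definition gP2_P3 : rel 'I_5 := fun x y =>
  let a := nat_of_ord x in let b := nat_of_ord y in
  ((a == 0) && (b == 1)) || ((a == 1) && (b == 0)) ||
  ((a == 2) && (b == 3)) || ((a == 3) && (b == 2)) ||
  ((a == 3) && (b == 4)) || ((a == 4) && (b == 3)).

Definition co_2P1_P3 : rel 'I_5 := compl_graph g2P1_P3.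

Definition isomorphic (n m : nat) (G1 : rel 'I_n) (G2 : rel 'I_m) : Prop :=
  exists f : 'I_n -> 'I_m, bijective f /\ forall x y, G1 x y = G2 (f x) (f y).

Definition sym := 'I_3.
Definition s0 : sym := @Ordinal 3 0 isT.
Definition s1 : sym := @Ordinal 3 1 isT.
Definition ssep : sym := @Ordinal 3 2 isT.

Definition encode_graph (n : nat) (G : rel 'I_n) : seq sym :=
  [seq (if G i j then s1 else s0) | i <- enum 'I_n, j <- enum 'I_n] ++ [:: ssep].

Definition encode_pair (n m : nat) (G1 : rel 'I_n) (G2 : rel 'I_m) : seq sym :=
  encode_graph G1 ++ encode_graph G2.

Record TM := {
  tm_state : finType;
  tm_gamma : finType;
  tm_blank : tm_gamma;
  tm_inp : sym -> tm_gamma;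
  tm_start : tm_state;
  tm_accept : tm_state;
  tm_reject : tm_state;
  (* transition: new state, written symbol, move right (true) / left (false) *)
  tm_delta : tm_state -> tm_gamma -> tm_state * tm_gamma * bool
}.

(* configuration: state, tape left of head (reversed), tape from head on *)
Definition config (M : TM) : Type :=
  (tm_state M * seq (tm_gamma M) * seq (tm_gamma M))%type.

Definition init_config (M : TM) (w : seq sym) : config M :=
  (tm_start M, [::], map (tm_inp M) w).

Definition tm_step (M : TM) (c : config M) : config M :=
  let: (q, L, R) := c in
  if (q == tm_accept M) || (q == tm_reject M) then c else
  let a := head (tm_blank M) R in
  let R' := behead R in
  let: (q', b, mvr) := @tm_delta M q a in
  if mvr then (q', b :: L, R')
  else match L with
       | [::] => (q', [::], b :: R')
       | x :: L' => (q', L', x :: b :: R')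
       end.

Definition run (M : TM) (t : nat) (w : seq sym) : config M :=
  iter t (@tm_step M) (init_config M w).

Definition final_state (M : TM) (t : nat) (w : seq sym) : tm_state M :=
  (run M t w).1.1.

(* The class is given as a predicate on graphs on 'I_n; the problem is the
   promise problem whose instances are pairs of simple graphs in the class. *)
Definition GI_poly_time_on (C : forall n : nat, rel 'I_n -> Prop) : Prop :=
  exists (M : TM) (c k : nat),
    tm_accept M != tm_reject M /\
    forall (n m : nat) (G1 : rel 'I_n) (G2 : rel 'I_m),
      simple_graph G1 -> simple_graph G2 -> C n G1 -> C m G2 ->
      let w := encode_pair G1 G2 in
      (isomorphic G1 G2 -> final_state M (c * (size w) ^ k + c) w = tm_accept M) /\
      (~ isomorphic G1 G2 -> final_state M (c * (size w) ^ k + c) w = tm_reject M).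

(* Main.v *)
Require Import Defs.
From mathcomp Require Import all_boot perm zify.
Set Implicit Arguments. Unset Strict Implicit. Unset Printing Implicit Defensive.

(* For a suitable constant [k], the [k]-dimensional Weisfeiler-Leman algorithm identifies every
   graph of the class. The algorithm is run by a Turing machine through a small register
   machine; equality of stable colours is equivalence in the bijective [k]-pebble game.

   It remains to pebble boundedly many vertices so that the colours over the pebbles determine
   the graph. This holds as soon as no two vertices [x], [x'] of one colour have two
   neighbours [y], [y'] of one other colour with [x y], [x y'] edges and [x' y], [x' y']
   non-edges: between two colour classes one then sees, up to complement, a matching or
   nothing. If the graph has a [K5], the vertices with at least four neighbours in it induce a
   complete multipartite graph, and the others a disjoint union of cliques, each vertex of which
   touches at most one part. If it has no [K5], it is covered by boundedly many graphs without
   induced [P3], or complements of such, with small cliques. The pebbles resolve these pieces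
   unless three independent edges occur whose common attachment [W] is independent; the rest is
   then a disjoint union of cliques, and pebbling a vertex of [W] of minimal degree together
   with boundedly many small cliques isolates all irregularities. The remaining cliques and,
   in the multipartite case, the parts with their attached vertices are blocks on which the
   isomorphism is found separately. *)

(** * Register machines and their simulation by Turing machines *)

(** The structure is analysed on the side [false] and carried to the other graph by the game alone;
    this analysis sees colours only as an equitable partition. Why matchings appear: if [x] has two
    neighbours missed by [x'] inside one colour class, equal degrees give [x'] two neighbours missed
    by [x], and the resulting six-vertex configuration is what the forbidden subgraphs have to
    exclude. The clique has five vertices because three vertices that spoil at most one of them each
    still leave two. There are three independent edges because a vertex that misses one and hits the
    other two creates P2 + P3. The recurring bound 62 is 2 + 4 + 12 + 22 + 22, the cost of the case
    without [K5] and the largest of all; 8 spare pebbles for comparing short tuples give [N] at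
    least 70, and [k] is at least 2N because a subtuple is copied before the original is erased. *)

(* Read-only input and two bit tables. *)
Definition static : Type := (seq sym * (seq bool * seq bool))%type.
Definition memory : Type := (static * (nat -> nat))%type.

Definition sinp (st : static) : seq sym := st.1.
Definition stab (st : static) (t : bool) : seq bool := if t then st.2.2 else st.2.1.
Definition sset (st : static) (t : bool) (i : nat) : static :=
  if t then (st.1, (st.2.1, set_nth false st.2.2 i true))
  else (st.1, (set_nth false st.2.1 i true, st.2.2)).

Definition setr (f : nat -> nat) (r v : nat) : nat -> nat :=
  fun x => if x == r then v else f x.

Inductive instr : Type :=
  | IInc of nat & nat
  | IZero of nat & nat
  | ISet of bool & nat & nat
  | IEq of nat & nat & nat & nat
  | ITab of bool & nat & nat & nat
  | ISym of option sym & nat & nat & nat.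

Definition mstep (code : seq instr) (c : nat * memory) : nat * memory :=
  let: (pc, (st, f)) := c in
  match onth code pc with
  | None => c
  | Some (IInc r nx) => (nx, (st, setr f r (f r).+1))
  | Some (IZero r nx) => (nx, (st, setr f r 0))
  | Some (ISet t r nx) => (nx, (sset st t (f r), f))
  | Some (IEq r q j1 j2) => (if f r == f q then j1 else j2, c.2)
  | Some (ITab t r j1 j2) => (if nth false (stab st t) (f r) then j1 else j2, c.2)
  | Some (ISym o r j1 j2) => (if onth (sinp st) (f r) == o then j1 else j2, c.2)
  end.

Definition init_memory (w : seq sym) : memory := ((w, ([::], [::])), fun=> 0).

Definition ireg (i : instr) : nat :=
  match i with
  | IInc r _ | IZero r _ | ISet _ r _ | IEq r _ _ _ | ITab _ r _ _ | ISym _ r _ _ => r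
  end.

Definition imax (i : instr) : nat :=
  match i with IEq r q _ _ => maxn r q | _ => ireg i end.

Definition code_regs (code : seq instr) : nat := foldr (fun i m => maxn (imax i) m) 0 code.

Lemma imax_code_regs (code : seq instr) (p : nat) (i : instr) :
  onth code p = Some i -> imax i <= code_regs code.
Proof.
elim: code p => [|j code IH] [|p] //= => [[->]|/IH le_i]; first exact: leq_maxl.
exact: leq_trans le_i (leq_maxr _ _).
Qed.

(** Growth by at most one per step bounds how far the head has to travel to reach a register, hence
    the cost of simulating an instruction. *)
Lemma mstep_regs (code : seq instr) (c : nat * memory) (b : nat) :
  (forall r, c.2.2 r <= b) -> forall r, (mstep code c).2.2 r <= b.+1.
Proof.
case: c => pc [st f] /= le_b r.
by case: (onth code pc) => [[]|] * /=; rewrite /setr;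
  try case: eqP => // _; rewrite ?ltnS // leqW.
Qed.

Section Simulation.

Variable code : seq instr.

Local Notation V := (code_regs code).+1.
Local Notation K := (size code).+2.

(** Jump targets become machine states and must be finite in number. Beyond the code two values
    survive: [size code], the accepting exit, and one more, which stands for every larger target and
    rejects. *)
Definition clip (j : nat) : 'I_K := inord (minn j (size code).+1).

Lemma onth_clip (j : nat) : onth code (clip j) = onth code j.
Proof.
rewrite /clip inordK; last by rewrite ltnS geq_minr.
case: (leqP j (size code).+1) => // gt_j.
by rewrite !onth_default // ltnW // ltnW.
Qed.

(* First cell?, input symbol, registers pointing at this cell, the two tables. *)
Definition gamma : finType :=
  (bool * option sym * {ffun 'I_V -> bool} * (bool * bool))%type.

Definition gmark (r : nat) (b : bool) (g : gamma) : gamma :=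
  let: (fst_, o, m, t) := g in
  (fst_, o, [ffun x => if x == inord r then b else m x], t).
Definition ghas (r : nat) (g : gamma) : bool := let: (_, _, m, _) := g in m (inord r).
Definition gset (t : bool) (g : gamma) : gamma :=
  let: (fst_, o, m, (t0, t1)) := g in
  (fst_, o, m, if t then (t0, true) else (true, t1)).
Definition gtab (t : bool) (g : gamma) : bool :=
  let: (_, _, _, (t0, t1)) := g in if t then t1 else t0.
Definition gsym (g : gamma) : option sym := g.1.1.2.
Definition gfst (g : gamma) : bool := g.1.1.1.

(* [inl true] searches the register of the current instruction, [inl false] drops
   its mark after an increment, [inr o] returns to the first cell, where it drops
   the mark of [o]. *)
Definition phase : finType := (bool + option 'I_V)%type.
Definition tstate : finType := option (bool + 'I_K * phase)%type.

Definition SGo (p : 'I_K) : tstate := Some (inr (p, inl true)).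
Definition SAdd (p : 'I_K) : tstate := Some (inr (p, inl false)).
Definition SRet (p : 'I_K) (o : option 'I_V) : tstate := Some (inr (p, inr o)).
Definition SHalt (b : bool) : tstate := Some (inl b).

(** A register is stored in unary, as a mark in the cell numbered by its value; all registers at 0
    means all marks in the first cell. *)
Definition gfirst (g : gamma) : gamma := (true, gsym g, [ffun=> true], (false, false)).
Definition gback (o : option 'I_V) (g : gamma) : gamma :=
  if o is Some r then gmark r true g else g.

Definition act (p : 'I_K) (i : instr) (g : gamma) : tstate * gamma * bool :=
  match i with
  | IInc r nx => (SAdd p, gmark r false g, true)
  | IZero r nx => (SRet (clip nx) (Some (inord r)), gmark r false g, false)
  | ISet t r nx => (SRet (clip nx) None, gset t g, false)
  | IEq r q j1 j2 => (SRet (clip (if ghas q g then j1 else j2)) None, g, false)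
  | ITab t r j1 j2 => (SRet (clip (if gtab t g then j1 else j2)) None, g, false)
  | ISym o r j1 j2 => (SRet (clip (if gsym g == o then j1 else j2)) None, g, false)
  end.

Definition delta (q : tstate) (g : gamma) : tstate * gamma * bool :=
  match q with
  | None => (SGo (clip 0), gfirst g, false)
  | Some (inl b) => (q, g, false)
  | Some (inr (p, inl true)) =>
      match onth code p with
      | None => (SHalt (p == size code :> nat), g, false)
      | Some i => if ghas (ireg i) g then act p i g else (q, g, true)
      end
  | Some (inr (p, inl false)) =>
      match onth code p with
      | Some (IInc r nx) => (SRet (clip nx) None, gmark r true g, false)
      | _ => (q, g, false)
      end
  | Some (inr (p, inr o)) => if gfst g then (SGo p, gback o g, false) else (q, g, false)
  end.

Definition machine : TM :=
  {| tm_state := tstate; tm_gamma := gamma;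
     tm_blank := (false, None, [ffun=> false], (false, false));
     tm_inp := fun s => (false, Some s, [ffun=> false], (false, false));
     tm_start := None; tm_accept := SHalt true; tm_reject := SHalt false;
     tm_delta := delta |}.

(** Reading the tape as a function on cells hides how many blanks are written explicitly; [catrev]
    undoes the reversal of the left part. *)
Definition conf_is (c : config machine) (q : tstate) (pos : nat) (T : nat -> gamma) : Prop :=
  [/\ c.1.1 = q, size c.1.2 = pos
    & forall j, nth (tm_blank machine) (catrev c.1.2 c.2) j = T j].

(** A left move in the first cell stays there, which [pos.-1] expresses at 0. *)
Lemma conf_is_step (c : config machine) (q q' : tstate) (pos : nat) (T T' : nat -> gamma)
    (b : gamma) (mv : bool) :
  conf_is c q pos T -> (forall h, q != SHalt h) ->
  delta q (T pos) = (q', b, mv) ->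
  (forall j, T' j = if j == pos then b else T j) ->
  conf_is (tm_step c) q' (if mv then pos.+1 else pos.-1) T'.
Proof.
case: c => [[q0 L] R] [/= -> <- defT] nh dq defT'.
rewrite /conf_is /tm_step (negPf (nh true)) (negPf (nh false)) /=.
have hdR : head (tm_blank machine) R = T (size L).
  by rewrite -defT catrevE nth_cat size_rev ltnn subnn nth0.
have wr j : nth (tm_blank machine) (catrev L (b :: behead R)) j = T' j.
  rewrite defT' -defT !catrevE !nth_cat !size_rev; case: ltngtP => // [lt|->].
    case: R {defT hdR} => [|a R] /=; last by case: (j - size L) (subn_gt0 (size L) j) => //=; rewrite lt.
    case e: (j - size L) => [|i]; first by move/eqP: e; rewrite subn_eq0 leqNgt lt.
    by rewrite /= !nth_nil.
  by rewrite subnn.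
rewrite -hdR in dq; rewrite dq.
by case: mv {dq}; [|case: L {defT hdR} wr defT' => [|x L] wr defT'] => /=; split.
Qed.

Lemma conf_isE (c : config machine) (q : tstate) (pos : nat) (T T' : nat -> gamma) :
  conf_is c q pos T -> T =1 T' -> conf_is c q pos T'.
Proof. by case=> ? ? e1 e2; split=> // j; rewrite e1 e2. Qed.

Lemma search_run (c : config machine) (p : 'I_K) (i : instr) (pos d : nat) (T : nat -> gamma) :
  onth code p = Some i -> conf_is c (SGo p) pos T ->
  (forall j, j < pos + d -> ~~ ghas (ireg i) (T j)) ->
  conf_is (iter d (@tm_step machine) c) (SGo p) (pos + d) T.
Proof.
move=> ip; elim: d c pos => [|d IH] c pos cT noT; first by rewrite addn0.
rewrite addnS -addSn iterSr; apply: IH; last by move=> j; rewrite addSnnS; apply: noT.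
apply: (@conf_is_step c (SGo p) (SGo p) pos T T (T pos) true) => //; last first.
  by move=> j; case: eqP => [->|].
by rewrite /= ip (negPf (noT _ _)) // -{1}[pos]addn0 ltn_add2l.
Qed.

Lemma return_run (c : config machine) (p : 'I_K) (o : option 'I_V) (pos : nat)
    (T : nat -> gamma) :
  (forall j, gfst (T j) = (j == 0)) -> conf_is c (SRet p o) pos T ->
  conf_is (iter pos.+1 (@tm_step machine) c) (SGo p) 0
    (fun j => if j == 0 then gback o (T 0) else T j).
Proof.
move=> fT; elim: pos c => [|pos IH] c cT.
  by apply: (@conf_is_step c _ (SGo p) 0 T _ (gback o (T 0)) false cT) => //=; rewrite fT.
rewrite iterSr; apply: IH.
apply: (@conf_is_step c _ (SRet p o) pos.+1 T T (T pos.+1) false cT) => //=.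
  by rewrite fT.
by move=> j; case: eqP => [->|].
Qed.

Definition cell (s : memory) (j : nat) : gamma :=
  (j == 0, onth (sinp s.1) j, [ffun r : 'I_V => s.2 r == j],
    (nth false (stab s.1 false) j, nth false (stab s.1 true) j)).

Lemma ghas_cell (s : memory) (r j : nat) : r < V -> ghas r (cell s j) = (s.2 r == j).
Proof. by move=> ltr; rewrite /= ffunE inordK. Qed.

Lemma inord_neq (r : nat) (x : 'I_V) : r < V -> (x == inord r) = (x == r :> nat).
Proof. by move=> ltr; rewrite -val_eqE /= inordK. Qed.

(** The head walks to the marked cell, acts and walks back: twice the value of the register, up to a
    constant. *)
Lemma sim_step (c : config machine) (p : nat) (s : memory) (i : instr) :
  onth code p = Some i -> conf_is c (SGo (clip p)) 0 (cell s) ->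
  exists2 t, t <= 2 * s.2 (ireg i) + 4 &
    conf_is (iter t (@tm_step machine) c) (SGo (clip (mstep code (p, s)).1)) 0
      (cell (mstep code (p, s)).2).
Proof.
move=> ip cT; have ip' : onth code (clip p) = Some i by rewrite onth_clip.
have le_i := imax_code_regs ip.
have ltr : ireg i < V.
  by apply: leq_trans le_i; case: i {ip ip'} => *; rewrite /= ?leqnn // leq_maxl.
set d := s.2 (ireg i).
have cd := search_run (d := d) ip' cT.
have {}cd : conf_is (iter d (@tm_step machine) c) (SGo (clip p)) d (cell s).
  apply: cd => j; rewrite add0n => ltj; rewrite ghas_cell // -/d.
  by rewrite gtn_eqF.
have hd : ghas (ireg i) (cell s d) by rewrite ghas_cell // eqxx.
have fin (c1 : config machine) nx o T : (forall j, gfst (T j) = (j == 0)) ->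
    c1 = iter d.+1 (@tm_step machine) c -> conf_is c1 (SRet (clip nx) o) d.-1 T ->
    forall s', (forall j, (if j == 0 then gback o (T 0) else T j) = cell s' j) ->
    exists2 t, t <= 2 * d + 4 &
      conf_is (iter t (@tm_step machine) c) (SGo (clip nx)) 0 (cell s').
  move=> fT -> c1T s' es'; exists (d.-1.+1 + d.+1); first by lia.
  by rewrite iterD; apply: conf_isE (return_run fT c1T) _.
case: s => st f in cT d cd hd fin *.
have same nx : delta (SGo (clip p)) (cell (st, f) d) = (SRet (clip nx) None, cell (st, f) d, false) ->
    exists2 t, t <= 2 * d + 4 &
      conf_is (iter t (@tm_step machine) c) (SGo (clip nx)) 0 (cell (st, f)).
  move=> e; apply: (fin _ _ None (cell (st, f)) _ erefl) => //=.
    apply: (conf_is_step cd _ e) => // j; by case: eqP => [->|].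
  by move=> j; case: eqP => [->|].
rewrite {}/d in cd hd fin same *; case: i ip ip' le_i ltr cd hd fin same => /=.
- move=> r nx ip ip' le_i ltr cd hd fin same; rewrite ip; set d := f r in cd hd fin same *; rewrite /=.
  pose T1 j := if j == d then gmark r false (cell (st, f) d) else cell (st, f) j.
  have c1 : conf_is (iter d.+1 (@tm_step machine) c) (SAdd (clip p)) d.+1 T1.
    by apply: (conf_is_step cd (mv := true)) => //; rewrite /= ip' hd.
  pose T2 j := if j == d.+1 then gmark r true (cell (st, f) d.+1) else T1 j.
  have c2 : conf_is (iter d.+2 (@tm_step machine) c) (SRet (clip nx) None) d T2.
    apply: (conf_is_step c1 (mv := false) (b := gmark r true (T1 d.+1))) => //=.
      by rewrite ip'.
    by move=> j; rewrite /T2 /T1 [d.+1 == d]gtn_eqF.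
  exists (d.+1 + d.+2); first by lia.
  rewrite iterD; apply: conf_isE (return_run _ c2) _.
    by move=> j; rewrite /T2 /T1; do 2![case: (j =P _) => [->|_] //].
  move=> j; rewrite -[LHS]/(if j == 0 then T2 0 else T2 j).
  transitivity (T2 j); first by case: eqP => [->|].
  rewrite /T2 /T1; case: (j =P d.+1) => [->|nj1]; last case: (j =P d) => [->|nj2].
  + congr (_, _, _, _); apply/ffunP => x; rewrite !ffunE inord_neq // /setr /=.
    by case: (x =P r :> nat) => [|//]; rewrite eqxx.
  + congr (_, _, _, _); apply/ffunP => x; rewrite !ffunE inord_neq // /setr /=.
    by case: (x =P r :> nat) => [|//]; rewrite -/d gtn_eqF.
  + congr (_, _, _, _); apply/ffunP => x; rewrite !ffunE /setr /=.
    case: (x =P r :> nat) => [->|//]; rewrite -/d.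
    by transitivity false; [apply/eqP => e; case: nj2|symmetry; apply/eqP => e; case: nj1].
- move=> r nx ip ip' le_i ltr cd hd fin same; rewrite ip; set d := f r in cd hd fin same *; rewrite /=.
  pose T1 j := if j == d then gmark r false (cell (st, f) d) else cell (st, f) j.
  apply: (fin _ _ (Some (inord r)) T1 _ erefl).
  + by move=> j; rewrite /T1; case: eqP => [->|].
  + by apply: (conf_is_step cd (mv := false)) => //; rewrite /= ip' hd.
  + move=> j; have eT1 (b : bool) : (if b then gmark r true (T1 j) else T1 j) =
        ((j == 0), onth (sinp st) j, [ffun x : 'I_V => if x == r :> nat then b else f x == j],
         (nth false (stab st false) j, nth false (stab st true) j)).
      rewrite /T1; case: (j =P d) => [->|nj]; case: b => //;
        congr (_, _, _, _); apply/ffunP => x; rewrite !ffunE ?inord_neq //=;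
        case: (x =P r :> nat) => [ex|//] //.
      by rewrite ex; apply/eqP => e; case: nj.
    rewrite (_ : (if _ then _ else _) = if j == 0 then gmark r true (T1 j) else T1 j).
      rewrite eT1; congr (_, _, _, _); apply/ffunP => x; rewrite !ffunE /setr /=.
      by case: (x =P r :> nat) => //; rewrite eq_sym.
    case: eqP => [->|//]; rewrite /gback /=; case: (T1 0) => [[[? ?] ?] ?] /=.
    congr (_, _, _, _); apply/ffunP => x; rewrite !ffunE.
    by rewrite inordK.
- move=> t r nx ip ip' le_i ltr cd hd fin same; rewrite ip; set d := f r in cd hd fin same *; rewrite /=.
  pose T1 j := if j == d then gset t (cell (st, f) d) else cell (st, f) j.
  have fT j : gfst (T1 j) = (j == 0) by rewrite /T1; case: eqP => [->|].
  apply: (fin _ _ None T1 fT erefl).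
    by apply: (conf_is_step cd (mv := false)) => //; rewrite /= ip' hd.
  move=> j; transitivity (T1 j); first by case: eqP => [->|].
  rewrite /T1 /cell /sset; case: t {ip ip' fT T1}; rewrite /= nth_set_nth /=;
    by rewrite -/d; case: eqP => [->|].
- move=> r q j1 j2 ip ip' le_i ltr cd hd fin same; rewrite ip; set d := f r in cd hd fin same *; rewrite /=.
  have ltq : q < V by rewrite ltnS; apply: leq_trans le_i; apply: leq_maxr.
  apply: same; rewrite /= ip' hd /=; congr (SRet (clip _) _, _, _).
  by rewrite -[X in if X then _ else _]/(ghas q (cell (st, f) d)) ghas_cell //= eq_sym.
- move=> t r j1 j2 ip ip' le_i ltr cd hd fin same; rewrite ip; set d := f r in cd hd fin same *; rewrite /=.
  apply: same; rewrite /= ip' hd /=; congr (SRet (clip _) _, _, _).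
  by case: t {ip ip'}.
- move=> o r j1 j2 ip ip' le_i ltr cd hd fin same; rewrite ip; set d := f r in cd hd fin same *; rewrite /=.
  by apply: same; rewrite /= ip' hd.
Qed.

Lemma iter_halt (c : config machine) (b : bool) (t : nat) :
  c.1.1 = SHalt b -> (iter t (@tm_step machine) c).1.1 = SHalt b.
Proof.
move=> e; suff -> : iter t (@tm_step machine) c = c by [].
elim: t => //= t ->; case: c e => [[q L] R] /= ->.
by case: b; rewrite /tm_step /= ?eqxx ?orbT.
Qed.

Lemma sim_run (c : config machine) (p : nat) (s : memory) (n b : nat) :
  conf_is c (SGo (clip p)) 0 (cell s) -> (forall r, s.2 r <= b) ->
  size code <= (iter n (mstep code) (p, s)).1 ->
  exists2 t, t <= n * (2 * (b + n) + 4) + 1 &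
    (iter t (@tm_step machine) c).1.1 =
      SHalt ((iter n (mstep code) (p, s)).1 == size code).
Proof.
have halt c1 p1 s1 : size code <= p1 -> conf_is c1 (SGo (clip p1)) 0 (cell s1) ->
    (tm_step c1).1.1 = SHalt (p1 == size code).
  move=> le_p cT; have [-> _ _] // : conf_is (tm_step c1) (SHalt (p1 == size code)) 0 (cell s1).
  apply: (conf_is_step cT (mv := false) (b := cell s1 0)) => //; last first.
    by move=> j; case: eqP => [->|].
  rewrite /delta /SGo onth_clip onth_default //; congr (SHalt _, _, _).
  rewrite /clip inordK ?ltnS ?geq_minr //; case: leqP => //; lia.
elim: n c p s b => [|n IH] c p s b cT le_b.
  by move=> /= le_p; exists 1 => //=; apply: halt cT.
rewrite iterSr; case ip: (onth code p) => [i|].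
  have [t1 le_t1 cT1] := sim_step ip cT.
  case em: (mstep code (p, s)) => [p' s'] in cT1 *.
  move=> le_p; have [|t2 le_t2 e2] := IH _ _ _ b.+1 cT1 _ le_p.
    by move=> r; have := @mstep_regs code (p, s) b le_b r; rewrite em.
  exists (t2 + t1); last by rewrite iterD.
  have := le_b (ireg i); nia.
have -> : mstep code (p, s) = (p, s) by case: s {cT le_b} => st f; rewrite /= ip.
have -> : iter n (mstep code) (p, s) = (p, s).
  by elim: n {IH} => //= n ->; case: s {cT le_b} => st f; rewrite /= ip.
by move=> le_p; exists 1; [lia|apply: halt cT].
Qed.

Lemma machine_correct (w : seq sym) (n N : nat) :
  size code <= (iter n (mstep code) (0, init_memory w)).1 ->
  n * (2 * n + 4) + 2 <= N ->
  final_state machine N w = SHalt ((iter n (mstep code) (0, init_memory w)).1 == size code).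
Proof.
move=> le_p le_N; pose c0 : config machine := init_config machine w.
have c1 : conf_is (tm_step c0) (SGo (clip 0)) 0 (cell (init_memory w)).
  pose T0 j := nth (tm_blank machine) (map (tm_inp machine) w) j.
  have eT0 j : T0 j = (false, onth w j, [ffun=> false], (false, false)).
    rewrite /T0; case: (ltnP j (size w)) => [lt|ge].
      rewrite (nth_map s0) //=.
      by have := onthTE w j; rewrite lt; case e: (onth w j) => [x|] // _; rewrite (@onth_nth _ _ _ _ _ e).
    by rewrite nth_default ?size_map // onth_default.
  apply: (@conf_is_step c0 None _ 0 T0 _ (gfirst (T0 0)) false) => // j.
  rewrite eT0 /cell /gfirst /=; case: eqP => [->|/eqP nj].
    by congr (_, _, _, _); apply/ffunP => x; rewrite !ffunE.
  rewrite eT0 !nth_nil; congr (_, _, _, _).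
  by apply/ffunP => x; rewrite !ffunE eq_sym (negPf nj).
have [t le_t e] := sim_run c1 (b := 0) (fun=> leqnn _) le_p.
(* Halted configurations are fixed points, so any time past the halting step shows the same
   state. *)
rewrite /final_state /run -/c0 -(subnK (_ : t.+1 <= N)); last by lia.
by rewrite iterD iterSr (iter_halt _ e).
Qed.

End Simulation.

(** * A polynomial-time program logic *)

Definition code_at (code : seq instr) (o : nat) (fr : seq instr) : Prop :=
  exists pre post, code = pre ++ fr ++ post /\ size pre = o.

Lemma code_at_catl (code : seq instr) (o : nat) (f1 f2 : seq instr) :
  code_at code o (f1 ++ f2) -> code_at code o f1.
Proof. by case=> pre [post [-> szp]]; exists pre, (f2 ++ post); rewrite -!catA. Qed.

Lemma code_at_catr (code : seq instr) (o : nat) (f1 f2 : seq instr) :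
  code_at code o (f1 ++ f2) -> code_at code (o + size f1) f2.
Proof.
by case=> pre [post [-> szp]]; exists (pre ++ f1), post; rewrite size_cat szp -!catA.
Qed.

Lemma code_at_onth (code : seq instr) (o i : nat) (fr : seq instr) :
  code_at code o fr -> i < size fr -> onth code (o + i) = onth fr i.
Proof.
case=> pre [post [-> <-]] lti; rewrite onth_cat ltnNge leq_addr /= addKn.
by rewrite onth_cat lti.
Qed.

Definition inp_size (s : memory) : nat := size (sinp s.1).

(* Programs have two exits, [e1] for the outcome [true] and [e2] for [false]. *)
Definition prog (Q : memory -> bool -> memory -> Prop) : Prop :=
  exists (F : nat -> nat -> nat -> seq instr) (len c d : nat),
    (forall o e1 e2, size (F o e1 e2) = len) /\
    forall code o e1 e2, code_at code o (F o e1 e2) ->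
    forall s, exists t b s',
      [/\ t <= c * (inp_size s).+1 ^ d,
          iter t (mstep code) (o, s) = (if b then e1 else e2, s'),
          sinp s'.1 = sinp s.1 & Q s b s'].

Lemma prog_conseq (Q Q' : memory -> bool -> memory -> Prop) :
  prog Q -> (forall s b s', sinp s'.1 = sinp s.1 -> Q s b s' -> Q' s b s') -> prog Q'.
Proof.
move=> [F [len [c [d [szF PF]]]]] QQ'; exists F, len, c, d; split=> // code o e1 e2 ca s.
have [t [b [s' [? ? e q]]]] := PF code o e1 e2 ca s.
by exists t, b, s'; split=> //; apply: QQ'.
Qed.

Lemma prog_not (Q : memory -> bool -> memory -> Prop) :
  prog Q -> prog (fun s b s' => Q s (~~ b) s').
Proof.
move=> [F [len [c [d [szF PF]]]]]; exists (fun o e1 e2 => F o e2 e1), len, c, d.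
split=> // code o e1 e2 ca s; have [t [b [s' [? e ? ?]]]] := PF code o e2 e1 ca s.
by exists t, (~~ b), s'; rewrite negbK; split=> //; rewrite e if_neg.
Qed.

Lemma prog_act (i : nat -> instr) (f : memory -> memory) :
  (forall code nx o s, onth code o = Some (i nx) -> mstep code (o, s) = (nx, f s)) ->
  (forall s, sinp (f s).1 = sinp s.1) ->
  prog (fun s b s' => b = false /\ s' = f s).
Proof.
move=> step inpf; exists (fun _ _ e2 => [:: i e2]), 1, 1, 0; split=> // code o e1 e2 ca s.
exists 1, false, (f s); split=> //; rewrite /= -[o]addn0.
by apply: step; rewrite (code_at_onth ca).
Qed.

Lemma prog_test (i : nat -> nat -> instr) (p : memory -> bool) :
  (forall code j1 j2 o s, onth code o = Some (i j1 j2) ->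
    mstep code (o, s) = (if p s then j1 else j2, s)) ->
  prog (fun s b s' => b = p s /\ s' = s).
Proof.
move=> step; exists (fun _ e1 e2 => [:: i e1 e2]), 1, 1, 0; split=> // code o e1 e2 ca s.
exists 1, (p s), s; split=> //=; rewrite -[o]addn0.
by apply: step; rewrite (code_at_onth ca).
Qed.

Lemma prog_inc (r : nat) :
  prog (fun s b s' => b = false /\ s' = (s.1, setr s.2 r (s.2 r).+1)).
Proof. by apply: (@prog_act (IInc r)) => // code nx o [st f] /= ->. Qed.

Lemma prog_zero (r : nat) : prog (fun s b s' => b = false /\ s' = (s.1, setr s.2 r 0)).
Proof. by apply: (@prog_act (IZero r)) => // code nx o [st f] /= ->. Qed.

Lemma prog_set (t : bool) (r : nat) :
  prog (fun s b s' => b = false /\ s' = (sset s.1 t (s.2 r), s.2)).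
Proof.
apply: (@prog_act (ISet t r)) => [code nx o [st f] /= -> //|].
by case: t => -[[]].
Qed.

Lemma prog_eq (r q : nat) : prog (fun s b s' => b = (s.2 r == s.2 q) /\ s' = s).
Proof. by apply: (@prog_test (IEq r q)) => code j1 j2 o [st f] /= ->. Qed.

Lemma prog_tab (t : bool) (r : nat) :
  prog (fun s b s' => b = nth false (stab s.1 t) (s.2 r) /\ s' = s).
Proof. by apply: (@prog_test (ITab t r)) => code j1 j2 o [st f] /= ->. Qed.

Lemma prog_sym (o : option sym) (r : nat) :
  prog (fun s b s' => b = (onth (sinp s.1) (s.2 r) == o) /\ s' = s).
Proof. by apply: (@prog_test (ISym o r)) => code j1 j2 pc [st f] /= ->. Qed.

Lemma poly_bound (x c1 d1 c2 d2 : nat) :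
  c1 * x.+1 ^ d1 + c2 * x.+1 ^ d2 <= (c1 + c2) * x.+1 ^ (maxn d1 d2).
Proof.
by rewrite mulnDl leq_add // leq_mul2l leq_pexp2l ?leq_maxl ?leq_maxr ?orbT.
Qed.

Lemma prog_if (Q Q1 Q2 : memory -> bool -> memory -> Prop) :
  prog Q -> prog Q1 -> prog Q2 ->
  prog (fun s b s' => exists b0 s0, [/\ sinp s0.1 = sinp s.1, Q s b0 s0 &
    if b0 then Q1 s0 b s' else Q2 s0 b s']).
Proof.
move=> [F [len [c [d [szF PF]]]]] [F1 [len1 [c1 [d1 [szF1 PF1]]]]].
move=> [F2 [len2 [c2 [d2 [szF2 PF2]]]]].
exists (fun o e1 e2 => F o (o + len) (o + len + len1) ++
  (F1 (o + len) e1 e2 ++ F2 (o + len + len1) e1 e2)), (len + (len1 + len2)).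
exists (c + (c1 + c2)), (maxn d (maxn d1 d2)).
split=> [o e1 e2|code o e1 e2 ca s]; first by rewrite !size_cat szF szF1 szF2.
have ca0 := code_at_catl ca; have := code_at_catr ca; rewrite szF => {}ca.
have ca1 := code_at_catl ca; have := code_at_catr ca; rewrite szF1 => {ca} ca2.
have [t [b0 [s0 [le_t run inp q]]]] := PF _ _ _ _ ca0 s.
have [t1 [b1 [s1 [le_t1 run1 inp1 q1]]]] := PF1 _ _ _ _ ca1 s0.
have [t2 [b2 [s2 [le_t2 run2 inp2 q2]]]] := PF2 _ _ _ _ ca2 s0.
rewrite /inp_size inp -/(inp_size s) in le_t1 le_t2.
have := poly_bound (inp_size s) c1 d1 c2 d2.
have := poly_bound (inp_size s) c d (c1 + c2) (maxn d1 d2).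
move=> bd1 bd2; case: b0 q run => q run.
  exists (t1 + t), b1, s1; split; rewrite ?inp1 ?iterD ?run //; first by lia.
  by exists true, s0.
exists (t2 + t), b2, s2; split; rewrite ?inp2 ?iterD ?run //; first by lia.
by exists false, s0.
Qed.

Lemma prog_seq (Q Q1 : memory -> bool -> memory -> Prop) :
  prog Q -> prog Q1 ->
  prog (fun s b s' => exists b0 s0, [/\ sinp s0.1 = sinp s.1, Q s b0 s0 & Q1 s0 b s']).
Proof.
move=> PQ PQ1; apply: prog_conseq (prog_if PQ PQ1 PQ1) _ => s b s' _ [b0 [s0 [inp q0 q]]].
by exists b0, s0; split=> //; case: b0 q0 q.
Qed.

(** The counter doubles as a reading position: the loop ends when it points past the input, so no
    bound is stored. A body outcome [true] leaves the loop at once. The degree of the time bound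
    grows by one. *)
Lemma prog_loop (r : nat) (Q Out : memory -> bool -> memory -> Prop)
    (Inv : memory -> nat -> memory -> Prop) :
  prog Q ->
  (forall s b s', Q s b s' -> s'.2 r = s.2 r) ->
  (forall s, Inv s 0 (s.1, setr s.2 r 0)) ->
  (forall s x u u', x < inp_size s -> sinp u.1 = sinp s.1 -> u.2 r = x ->
     Inv s x u -> Q u false u' -> Inv s x.+1 (u'.1, setr u'.2 r x.+1)) ->
  (forall s x u u', x < inp_size s -> sinp u.1 = sinp s.1 -> u.2 r = x ->
     Inv s x u -> Q u true u' -> Out s true u') ->
  (forall s u, sinp u.1 = sinp s.1 -> u.2 r = inp_size s -> Inv s (inp_size s) u ->
     Out s false u) ->
  prog Out.
Proof.
move=> [F [len [c [d [szF PF]]]]] keep inv0 invS outT outF.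
exists (fun o e1 e2 => [:: IZero r (o + 1); ISym None r e2 (o + 3); IInc r (o + 1)] ++
  F (o + 3) e1 (o + 2)), (3 + len), (c + 4), d.+1.
split=> [o e1 e2|code o e1 e2 ca s]; first by rewrite size_cat szF.
have caF := code_at_catr ca; rewrite /= in caF.
have := code_at_onth (i := 0) (code_at_catl ca) isT; rewrite addn0 /= => i0.
have := code_at_onth (i := 1) (code_at_catl ca) isT; rewrite /= => i1.
have := code_at_onth (i := 2) (code_at_catl ca) isT; rewrite /= => i2.
set L := inp_size s; set X := L.+1 ^ d.
have X_gt0 : 0 < X by rewrite expn_gt0.
suff loop m x u : x + m = L -> sinp u.1 = sinp s.1 -> u.2 r = x -> Inv s x u ->
    exists t b s', [/\ t <= m * (c * X + 2) + 1,
      iter t (mstep code) (o + 1, u) = (if b then e1 else e2, s'),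
      sinp s'.1 = sinp s.1 & Out s b s'].
  have [||t [b [s' [le_t run inp out]]]] := loop L 0 (s.1, setr s.2 r 0) erefl erefl.
  - by rewrite /= /setr eqxx.
  - exact: inv0.
  exists (t + 1), b, s'; split=> //; last first.
    by rewrite iterD /= -run; case: s {L X X_gt0 loop run inp out le_t} => st f; rewrite /= i0.
  rewrite expnS -/L -/X; nia.
elim: m x u => [|m IH] x u em inp ur inv.
  exists 1, false, u; split=> //=; last by apply: outF => //; [lia|rewrite -/L -em addn0].
  case: u inp ur inv => st f /= inp ur inv; rewrite i1 ur inp.
  by rewrite onth_default ?eqxx // -/(inp_size s) -/L -em addn0.
have ltx : x < inp_size s by rewrite -/L; lia.
have test : mstep code (o + 1, u) = (o + 3, u).
  case: u inp ur inv => st f /= inp ur inv; rewrite i1 ur inp.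
  by have := onthTE (sinp s.1) x; rewrite ltx; case: (onth _ _).
have [t [b [u' [le_t run inp' q]]]] := PF _ _ _ _ caF u.
rewrite /inp_size inp -/(inp_size s) -/L -/X in le_t.
case: b run q => run q.
  exists (t + 1), true, u'; split; rewrite ?inp' // ?(addn1 t) ?iterSr ?test //; first by nia.
  exact: outT ltx inp ur inv q.
have [||||t2 [b2 [s2 [le_t2 run2 inp2 out2]]]] := IH x.+1 (u'.1, setr u'.2 r x.+1).
- by rewrite addSnnS.
- by rewrite /= inp'.
- by rewrite /= /setr eqxx.
- exact: invS ltx inp ur inv q.
exists (t2 + (1 + (t + 1))), b2, s2; split=> //; first by nia.
rewrite iterD add1n (addn1 t) iterS iterSr test run -run2; congr (iter _ _ _).
have := keep _ _ _ q; rewrite ur.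
by case: u' {run inp' q run2} => st f /= fr; rewrite i2 fr.
Qed.

Definition keeps (l : nat) (s s' : memory) : Prop := forall r, r < l -> s'.2 r = s.2 r.

Lemma keeps_map (l : nat) (s s' : memory) (rs : seq nat) :
  all (gtn l) rs -> keeps l s s' -> map s'.2 rs = map s.2 rs.
Proof. by move=> /allP ltrs ks; apply/eq_in_map => r /ltrs /ks. Qed.

Lemma keeps_setr (l : nat) (s : memory) (st : static) (v : nat) :
  keeps l s (st, setr s.2 l v).
Proof. by move=> r lt; rewrite /= /setr ltn_eqF. Qed.

Lemma all_gtnS (l : nat) (rs : seq nat) : all (gtn l) rs -> all (gtn l.+1) rs.
Proof. by apply: sub_all => r /= /leqW. Qed.

(* [phi], [v] and [g] range over predicates, numbers and updates that programs compute
   from the static memory and the values of [k] registers. *)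
Definition cpt (k : nat) (phi : static -> seq nat -> bool) : Prop :=
  forall l rs, size rs = k -> all (gtn l) rs ->
  prog (fun s b s' => [/\ b = phi s.1 (map s.2 rs), s'.1 = s.1 & keeps l s s']).

(** Adding to [c] instead of overwriting it lets nested loops and sums accumulate in one register.
    Registers from [l] on are scratch space. *)
Definition cval (k : nat) (v : static -> seq nat -> nat) : Prop :=
  forall l rs c, size rs = k -> all (gtn l) rs -> c < l -> c \notin rs ->
  prog (fun s b s' => [/\ b = false, s'.1 = s.1, s'.2 c = s.2 c + v s.1 (map s.2 rs)
    & forall r, r < l -> r <> c -> s'.2 r = s.2 r]).

Definition stp (k : nat) (g : seq nat -> static -> static) : Prop :=
  forall l rs, size rs = k -> all (gtn l) rs ->
  prog (fun s b s' => [/\ b = false, s'.1 = g (map s.2 rs) s.1 & keeps l s s']).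

(** The last coordinate varies slowest: it is the outermost loop, whose register is put in front of
    the parameters before the inner coordinates are treated. *)
Fixpoint tups (m L : nat) : seq (seq nat) :=
  if m is m'.+1 then [seq rcons t x | x <- iota 0 L, t <- tups m' L] else [:: [::]].

Lemma prog_skip : prog (fun s b s' => b = false /\ s' = s).
Proof.
apply: prog_conseq (prog_not (prog_eq 0 0)) _ => s b s' _ [e ->]; split=> //.
by move: e; rewrite eqxx; case: b.
Qed.

Lemma cpt_ext (k : nat) (phi psi : static -> seq nat -> bool) :
  (forall st xs, size xs = k -> phi st xs = psi st xs) -> cpt k phi -> cpt k psi.
Proof.
move=> e cp l rs szr ltr; apply: prog_conseq (cp l rs szr ltr) _ => s b s' _ [-> -> ks].
by split=> //; rewrite e // size_map.
Qed.

Lemma val_ext (k : nat) (v w : static -> seq nat -> nat) :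
  (forall st xs, size xs = k -> v st xs = w st xs) -> cval k v -> cval k w.
Proof.
move=> e cv l rs c szr ltr ltc nc.
apply: prog_conseq (cv l rs c szr ltr ltc nc) _ => s b s' _ [-> -> ev ks].
by split=> //; rewrite ev e // size_map.
Qed.

Lemma cpt_not (k : nat) (phi : static -> seq nat -> bool) :
  cpt k phi -> cpt k (fun st xs => ~~ phi st xs).
Proof.
move=> cp l rs szr ltr; apply: prog_conseq (prog_not (cp l rs szr ltr)) _ => s b s' _.
by case=> e1 e2 ks; split=> //; rewrite -e1 negbK.
Qed.

Lemma cpt_and (k : nat) (phi psi : static -> seq nat -> bool) :
  cpt k phi -> cpt k psi -> cpt k (fun st xs => phi st xs && psi st xs).
Proof.
move=> cp cq l rs szr ltr.
apply: prog_conseq (prog_if (cp l rs szr ltr) (cq l rs szr ltr) prog_skip) _.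
move=> s b s' _ [b0 [s0 [_ [e1 e2 ks]]]]; rewrite -e1.
case: b0 e1 => _; last by case=> -> ->.
by case=> -> -> ks'; split; rewrite ?e2 ?(keeps_map ltr ks) // => r lt; rewrite ks' ?ks.
Qed.

Lemma cpt_or (k : nat) (phi psi : static -> seq nat -> bool) :
  cpt k phi -> cpt k psi -> cpt k (fun st xs => phi st xs || psi st xs).
Proof.
move=> cp cq; apply: cpt_ext (cpt_not (cpt_and (cpt_not cp) (cpt_not cq))) => st xs _.
by rewrite negb_and !negbK.
Qed.

Lemma cpt_addb (k : nat) (phi psi : static -> seq nat -> bool) :
  cpt k phi -> cpt k psi -> cpt k (fun st xs => phi st xs != psi st xs).
Proof.
move=> cp cq.
apply: cpt_ext (cpt_or (cpt_and cp (cpt_not cq)) (cpt_and (cpt_not cp) cq)) => st xs _.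
by case: (phi st xs) (psi st xs) => -[].
Qed.

Lemma cpt_reindex (k k' : nat) (idx : seq nat) (phi : static -> seq nat -> bool) :
  cpt k phi -> size idx = k -> all (gtn k') idx ->
  cpt k' (fun st xs => phi st [seq nth 0 xs i | i <- idx]).
Proof.
move=> cp szi /allP lti l rs szr ltr.
have ltr' : all (gtn l) [seq nth 0 rs i | i <- idx].
  apply/allP => _ /mapP [i /lti lt ->]; apply: (allP ltr); apply: mem_nth.
  by rewrite szr.
apply: prog_conseq (cp l _ _ ltr') _; first by rewrite size_map.
move=> s b s' _ [-> -> ks]; split=> //; congr phi; rewrite -map_comp.
by apply/eq_in_map => i /lti lt /=; rewrite (nth_map 0) ?szr.
Qed.

Lemma cpt_eq : cpt 2 (fun st xs => nth 0 xs 0 == nth 0 xs 1).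
Proof.
move=> l [|r [|q []]] //= _ _; apply: prog_conseq (prog_eq r q) _.
by move=> s b s' _ [-> ->].
Qed.

Lemma cpt_sym (o : option sym) : cpt 1 (fun st xs => onth (sinp st) (nth 0 xs 0) == o).
Proof.
move=> l [|r []] //= _ _; apply: prog_conseq (prog_sym o r) _.
by move=> s b s' _ [-> ->].
Qed.

Lemma cpt_tab (t : bool) : cpt 1 (fun st xs => nth false (stab st t) (nth 0 xs 0)).
Proof.
move=> l [|r []] //= _ _; apply: prog_conseq (prog_tab t r) _.
by move=> s b s' _ [-> ->].
Qed.

(** No instruction compares sizes, so a counter rises until it meets one of the two registers, and
    it meets the smaller one first. Running off the input gives [false], whence the first
    conjunct. *)
Lemma cpt_lt :
  cpt 2 (fun st xs => (nth 0 xs 0 < size (sinp st)) && (nth 0 xs 0 < nth 0 xs 1)).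
Proof.
move=> l [|r [|q []]] //= _ /and3P [ltr ltq _].
have meet : prog (fun s b s' => b = ((s.2 l == s.2 r) || (s.2 l == s.2 q)) /\ s' = s).
  apply: prog_conseq (prog_if (prog_eq l r) (prog_eq l r) (prog_eq l q)) _.
  by move=> s b s' _ [b0 [s0 [_ [-> ->]]]]; case: eqP => [->|_] [-> ->]; rewrite ?eqxx.
pose Inv s x (u : memory) := [/\ u.1 = s.1, keeps l s u & x <= s.2 r /\ x <= s.2 q].
pose Out s (b : bool) (u : memory) := [/\ u.1 = s.1, keeps l s u &
  if b then [/\ u.2 l < inp_size s, u.2 l <= s.2 r, u.2 l <= s.2 q
             & (u.2 l == s.2 r) || (u.2 l == s.2 q)]
  else inp_size s <= s.2 r].
have loop : prog Out.
  apply: (prog_loop (r := l) (Inv := Inv) meet).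
  - by move=> s b s' [_ ->].
  - by move=> s; split=> //; apply: keeps_setr.
  - move=> s x u u' _ _ ux [e1 ks [le1 le2]] [e ->]; split=> //=.
      by move=> i lt; rewrite /= /setr ltn_eqF //; apply: ks.
    move/esym/negbT: e; rewrite negb_or ux (ks _ ltr) (ks _ ltq) => /andP [n1 n2].
    by rewrite !ltn_neqAle n1 n2.
  - move=> s x u u' lt _ ux [e1 ks [le1 le2]] [e ->]; split=> //.
    by rewrite ux; split=> //; move: e; rewrite ux (ks _ ltr) (ks _ ltq) => <-.
  - by move=> s u _ ul [e1 ks [le1 le2]]; split.
apply: prog_conseq (prog_if loop (prog_not (prog_eq l q)) prog_skip) _.
move=> s b s' _ [b0 [s0 [_ [e1 ks]]]]; case: b0; last first.
  by move=> le [-> ->]; split=> //; rewrite ltnNge le.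
case=> lt le1 le2 /orP eqs [e ->]; split=> //.
rewrite -[b]negbK e (ks _ ltq) -/(inp_size s); lia.
Qed.

Lemma val_count (m k : nat) (phi : static -> seq nat -> bool) :
  cpt (m + k) phi ->
  cval k (fun st xs => count (fun t => phi st (t ++ xs)) (tups m (size (sinp st)))).
Proof.
elim: m k phi => [|m IH] k phi cp l rs c szr ltr ltc nc.
  apply: prog_conseq (prog_if (cp l rs szr ltr) (prog_inc c) prog_skip) _.
  move=> s b s' _ [b0 [s0 [_ [e1 e2 ks]]]]; rewrite /= addn0 -e1.
  case: b0 e1 => _ [-> ->]; split=> //=.
  - by rewrite /setr eqxx ks // addn1.
  - by move=> r lt /eqP /negPf nr; rewrite /setr nr ks.
  - by rewrite ks // addn0.
  - by move=> r lt _; apply: ks.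
have {}cp : cpt (m + k.+1) phi by rewrite addnS.
pose cnt (s : memory) x := count (fun t => phi s.1 (t ++ (x :: map s.2 rs))) (tups m (inp_size s)).
pose Inv s x (u : memory) := [/\ u.1 = s.1, u.2 c = s.2 c + sumn (map (cnt s) (iota 0 x))
    & forall r, r < l -> r <> c -> u.2 r = s.2 r].
have nlc : l != c by rewrite gtn_eqF.
have body : prog (fun s b s' => [/\ b = false, s'.1 = s.1, s'.2 c = s.2 c + cnt s (s.2 l)
    & forall r, r < l.+1 -> r <> c -> s'.2 r = s.2 r]).
  apply: prog_conseq (IH _ _ cp l.+1 (l :: rs) c _ _ _ _) _ => //=.
  - by rewrite szr.
  - by rewrite ltnSn all_gtnS.
  - exact: leqW.
  - by rewrite inE eq_sym negb_or nlc.
apply: (prog_loop (r := l) (Inv := Inv) body).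
- by move=> s b s' [_ _ _ ks]; apply: ks => //; apply/eqP.
- move=> s; split=> //=; first by rewrite /setr eq_sym (negPf nlc) addn0.
  by move=> r lt _; rewrite /setr ltn_eqF.
- move=> s x u u' _ _ ux [e1 e2 ks] [_ e1' e2' ks']; split.
  + by rewrite /= e1'.
  + rewrite [LHS]/= /setr eq_sym (negPf nlc) e2' e2 ux -addnA; congr (_ + _).
    rewrite -[x.+1]addn1 iotaD map_cat sumn_cat /= add0n addn0; congr (_ + _).
    rewrite /cnt /inp_size e1; apply: eq_count => t; congr (phi _ (t ++ (x :: _))).
    apply/eq_in_map => r rr; apply: ks; first exact: (allP ltr).
    by move=> er; rewrite -er rr in nc.
  + by move=> r lt nr; rewrite /= /setr ltn_eqF // ks' ?ks // leqW.
- by move=> s x u u' _ _ _ _ [].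
- move=> s u _ _ [e1 e2 ks]; split=> //; rewrite e2 -/(inp_size s); congr (_ + _).
  rewrite /= count_flatten -map_comp; congr sumn; apply/eq_map => x /=.
  by rewrite count_map; apply: eq_count => t /=; rewrite cat_rcons.
Qed.

Lemma val_zero (k : nat) : cval k (fun _ _ => 0).
Proof.
move=> l rs c _ _ _ _; apply: prog_conseq prog_skip _ => s b s' _ [-> ->].
by split; rewrite ?addn0.
Qed.

Lemma val_add (k : nat) (v w : static -> seq nat -> nat) :
  cval k v -> cval k w -> cval k (fun st xs => v st xs + w st xs).
Proof.
move=> cv cw l rs c szr ltr ltc nc.
apply: prog_conseq (prog_seq (cv l rs c szr ltr ltc nc) (cw l rs c szr ltr ltc nc)) _.
move=> s b s' _ [b0 [s0 [_ [_ e1 e2 ks] [-> e1' e2' ks']]]]; split=> //.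
- by rewrite e1'.
- rewrite e2' e2 e1 addnA; congr (_ + w _ _).
  apply/eq_in_map => r rr; apply: ks; first exact: (allP ltr).
  by move=> er; rewrite -er rr in nc.
- by move=> r lt nr; rewrite ks' ?ks.
Qed.

Lemma val_sumn (k : nat) (v : nat -> static -> seq nat -> nat) (s : seq nat) :
  (forall i, i \in s -> cval k (v i)) -> cval k (fun st xs => sumn [seq v i st xs | i <- s]).
Proof.
elim: s => [|i s IH] cv; first exact: val_zero.
apply: val_add; first by apply: cv; rewrite mem_head.
by apply: IH => j js; apply: cv; rewrite inE js orbT.
Qed.

Lemma prog_let (k l : nat) (v : static -> seq nat -> nat) (rs : seq nat) :
  cval k v -> size rs = k -> all (gtn l) rs ->
  prog (fun s b s' => [/\ s'.1 = s.1, s'.2 l = v s.1 (map s.2 rs) & keeps l s s']).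
Proof.
move=> cv szr ltr; have nl : l \notin rs.
  by apply/negP => /(allP ltr) /=; rewrite ltnn.
apply: prog_conseq (prog_seq (prog_zero l) (cv l.+1 rs l szr (all_gtnS ltr) (ltnSn l) nl)) _.
move=> s b s' _ [b0 [s0 [_ [_ ->] [_ e1 e2 ks]]]].
rewrite /= /setr eqxx add0n in e2; split=> //.
  rewrite e2; congr (v _ _); apply/eq_in_map => r rr.
  by case: eqP => // er; rewrite -er rr in nl.
move=> r lt; rewrite ks ?leqW // /= /setr ?ltn_eqF //.
by move=> er; rewrite er ltnn in lt.
Qed.

Lemma cpt_let (k : nat) (v : static -> seq nat -> nat) (phi : static -> seq nat -> bool) :
  cval k v -> cpt k.+1 phi -> cpt k (fun st xs => phi st (v st xs :: xs)).
Proof.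
move=> cv cp l rs szr ltr.
have cp' := cp l.+1 (l :: rs) (congr1 S szr) _.
apply: prog_conseq (prog_seq (prog_let cv szr ltr) (cp' _)) _.
  by rewrite /= ltnSn all_gtnS.
move=> s b s' _ [b0 [s0 [_ [e1 e2 ks] [-> e1' ks']]]]; split.
- by rewrite /= e1 e2 (keeps_map ltr ks).
- by rewrite e1'.
- by move=> r lt; rewrite ks' ?ks // leqW.
Qed.

Lemma cpt_sym_at (o : option sym) (k : nat) (v : static -> seq nat -> nat) :
  cval k v -> cpt k (fun st xs => onth (sinp st) (v st xs) == o).
Proof.
move=> cv.
by have := cpt_let cv (cpt_reindex (k' := k.+1) (idx := [:: 0]) (cpt_sym o) erefl isT).
Qed.

Lemma cpt_tab_at (t : bool) (k : nat) (v : static -> seq nat -> nat) :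
  cval k v -> cpt k (fun st xs => nth false (stab st t) (v st xs)).
Proof.
move=> cv.
by have := cpt_let cv (cpt_reindex (k' := k.+1) (idx := [:: 0]) (cpt_tab t) erefl isT).
Qed.

Lemma val_weak (k : nat) (v : static -> seq nat -> nat) :
  cval k v -> cval k.+1 (fun st xs => v st (behead xs)).
Proof.
move=> cv l [|r rs] c //= [szr] /andP [_ ltr] ltc; rewrite inE negb_or => /andP [_ nc].
exact: cv.
Qed.

Lemma cpt_val_eq (k : nat) (v w : static -> seq nat -> nat) :
  cval k v -> cval k w -> cpt k (fun st xs => v st xs == w st xs).
Proof.
move=> cv cw; have := cpt_reindex (k' := k.+2) (idx := [:: 1; 0]) cpt_eq erefl isT.
by move/(cpt_let (val_weak cw))/(cpt_let cv).
Qed.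

Lemma cpt_has (m k : nat) (phi : static -> seq nat -> bool) :
  cpt (m + k) phi ->
  cpt k (fun st xs => has (fun t => phi st (t ++ xs)) (tups m (size (sinp st)))).
Proof.
move=> cp; apply: cpt_ext (cpt_not (cpt_val_eq (val_count cp) (@val_zero k))) => st xs _.
by rewrite has_count lt0n.
Qed.

Lemma cpt_has_const (k : nat) (phi : nat -> static -> seq nat -> bool) (s : seq nat) :
  (forall i, i \in s -> cpt k (phi i)) -> cpt k (fun st xs => has (fun i => phi i st xs) s).
Proof.
elim: s => [|i s IH] cp.
  by apply: cpt_ext (cpt_not (cpt_val_eq (@val_zero k) (@val_zero k))) => st xs _.
apply: cpt_or; first by apply: cp; rewrite mem_head.
by apply: IH => j js; apply: cp; rewrite inE js orbT.
Qed.

Lemma stp_seq (k : nat) (g h : seq nat -> static -> static) :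
  stp k g -> stp k h -> stp k (fun xs st => h xs (g xs st)).
Proof.
move=> cg ch l rs szr ltr.
apply: prog_conseq (prog_seq (cg l rs szr ltr) (ch l rs szr ltr)) _.
move=> s b s' _ [b0 [s0 [_ [_ e1 ks] [-> e1' ks']]]]; split=> //.
  by rewrite e1' e1 (keeps_map ltr ks).
by move=> r lt; rewrite ks' ?ks.
Qed.

Lemma stp_if (k : nat) (phi : static -> seq nat -> bool) (g : seq nat -> static -> static) :
  cpt k phi -> stp k g -> stp k (fun xs st => if phi st xs then g xs st else st).
Proof.
move=> cp cg l rs szr ltr.
apply: prog_conseq (prog_if (cp l rs szr ltr) (cg l rs szr ltr) prog_skip) _.
move=> s b s' _ [b0 [s0 [_ [e1 e2 ks]]]]; rewrite -e1.
case: b0 e1 => _; last by case=> -> ->.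
case=> -> e1' ks'; split=> //; first by rewrite e1' e2 (keeps_map ltr ks).
by move=> r lt; rewrite ks' ?ks.
Qed.

Lemma stp_set (k : nat) (t : bool) (v : static -> seq nat -> nat) :
  cval k v -> stp k (fun xs st => sset st t (v st xs)).
Proof.
move=> cv l rs szr ltr.
apply: prog_conseq (prog_seq (prog_let cv szr ltr) (prog_set t l)) _.
move=> s b s' _ [b0 [s0 [_ [e1 e2 ks] [-> ->]]]]; split=> //.
by rewrite /= e1 e2.
Qed.

Lemma stp_foreach (m k : nat) (g : seq nat -> static -> static) :
  (forall xs st, sinp (g xs st) = sinp st) -> stp (m + k) g ->
  stp k (fun xs st => foldl (fun st' t => g (t ++ xs) st') st (tups m (size (sinp st)))).
Proof.
move=> inpg; elim: m k => [|m IH] k cg; first exact: cg.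
have {}cg : stp (m + k.+1) g by rewrite addnS.
move=> l rs szr ltr.
pose h xs x st := foldl (fun st' t => g (t ++ (x :: xs)) st') st (tups m (size (sinp st))).
have inph xs x st : sinp (h xs x st) = sinp st.
  rewrite /h; move: (tups _ _) => ts; elim: ts st => //= t ts IHs st.
  by rewrite IHs inpg.
pose Inv s x (u : memory) :=
  u.1 = foldl (fun st y => h (map s.2 rs) y st) s.1 (iota 0 x) /\ keeps l s u.
have body : prog (fun s b s' =>
    [/\ b = false, s'.1 = h (map s.2 rs) (s.2 l) s.1 & keeps l.+1 s s']).
  apply: prog_conseq (IH _ cg l.+1 (l :: rs) _ _) _ => //=; first by rewrite szr.
  by rewrite ltnSn all_gtnS.
apply: (prog_loop (r := l) (Inv := Inv) body).
- by move=> s b s' [_ _ ks]; apply: ks.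
- by move=> s; split=> //; apply: keeps_setr.
- move=> s x u u' _ _ ux [e1 ks] [_ e1' ks']; split.
    by rewrite [LHS]/= e1' e1 ux -[x.+1]addn1 iotaD foldl_cat /= (keeps_map ltr ks).
  by move=> r lt; rewrite /= /setr ltn_eqF // ks' ?ks // leqW.
- by move=> s x u u' _ _ _ _ [].
- move=> s u _ _ [e1 ks]; split=> //; rewrite e1 /inp_size /=.
  set L := size _; have {e1} : size (sinp s.1) = L by [].
  elim: (iota 0 L) (s.1) => //= x xs IHx st szst.
  rewrite foldl_cat IHx ?inph //; congr (foldl _ _ _).
  rewrite /h szst; elim: (tups m L) (st) => //= t ts IHt st'.
  by rewrite cat_rcons IHt.
Qed.

Theorem prog_poly_time (g : seq nat -> static -> static) (psi : static -> seq nat -> bool) :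
  stp 0 g -> cpt 0 psi ->
  exists (M : TM) (c k : nat), tm_accept M != tm_reject M /\
    forall w, let v := psi (g [::] (w, ([::], [::]))) [::] in
      final_state M (c * size w ^ k + c) w = if v then tm_accept M else tm_reject M.
Proof.
move=> cg cp.
have [F [len [c [d [szF PF]]]]] := prog_seq (cg 0 [::] erefl isT) (cp 0 [::] erefl isT).
(* The outcome [true] exits exactly at the end of the code, which accepts; [false] exits one address
   further, which rejects. *)
pose code := F 0 len len.+1; have szc : size code = len by rewrite szF.
have time_bound n : (c * n.+1 ^ d) * (2 * (c * n.+1 ^ d) + 4) + 2 <=
    (2 ^ d.*2 * (c * (2 * c + 4) + 2)) * n ^ d.*2 + (2 ^ d.*2 * (c * (2 * c + 4) + 2)).
  set X := n.+1 ^ d; have X_gt0 : 0 < X by rewrite expn_gt0.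
  (* The second summand covers [n = 0]; otherwise [n.+1] is at most [2 * n]. *)
  have leX : X * X <= 2 ^ d.*2 * n ^ d.*2 + 2 ^ d.*2.
    rewrite /X -expnD addnn; case: n {X X_gt0} => [|n]; first by rewrite exp1n; lia.
    apply: (leq_trans _ (leq_addr _ _)); rewrite -expnMn.
    by case: d.*2 => // e; rewrite leq_exp2r //; lia.
  nia.
exists (machine code), (2 ^ d.*2 * (c * (2 * c + 4) + 2)), d.*2.
split=> [//|w v].
have [|t [b [s' [le_t run _ [_ [s0 [_ [_ e1 _] [eb _ _]]]]]]]] := PF code 0 len len.+1 _ (init_memory w).
  by exists [::], [::]; rewrite cats0.
rewrite e1 /= -/v in eb.
rewrite (@machine_correct code w t); rewrite ?run ?szc.
- by rewrite eb; case: v {eb e1}; rewrite /= ?eqxx // gtn_eqF.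
- by rewrite /=; case: b {run eb}.
- apply: leq_trans (time_bound _); rewrite leq_add2r leq_mul // leq_add2r leq_mul2l.
  by rewrite le_t.
Qed.

(** * Iterating a definable operator on relations *)

Lemma mem_tups (m L : nat) (t : seq nat) :
  (t \in tups m L) = (size t == m) && all (gtn L) t.
Proof.
elim: m t => [|m IH] t; first by rewrite inE; case: t.
apply/allpairsP/andP => [[[x s] /= [xL sm ->]]|[/eqP szt ltt]].
  move: sm; rewrite IH size_rcons all_rcons => /andP [/eqP -> ->].
  by move: xL; rewrite mem_iota /= => ->.
case: (lastP t) szt ltt => // s x; rewrite size_rcons all_rcons => -[szs] /andP [ltx lts].
by exists (x, s); rewrite mem_iota IH szs eqxx.
Qed.

Lemma size_tups (m L : nat) : size (tups m L) = L ^ m.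
Proof. by elim: m => //= m IH; rewrite size_allpairs size_iota IH expnS. Qed.

Lemma tups1 (L : nat) : tups 1 L = [seq [:: x] | x <- iota 0 L].
Proof. by rewrite /=; elim: (iota 0 L) => //= x s ->. Qed.

(** Multiplication is not an instruction; counting tuples with a condition on one coordinate
    supplies the factor [L ^ m]. *)
Lemma count_tups_last (m L : nat) (p : nat -> bool) :
  count (fun t => p (nth 0 t m)) (tups m.+1 L) = count p (iota 0 L) * L ^ m.
Proof.
rewrite /= -(size_tups m L); elim: (iota 0 L) => //= x s IH.
rewrite count_cat IH mulnDl count_map; congr (_ + _).
rewrite (@eq_in_count _ _ (fun=> p x)).
  by case: (p x); rewrite ?count_predT ?count_pred0 ?mul1n.
move=> t; rewrite mem_tups => /andP [/eqP szt _] /=.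
by rewrite nth_rcons szt ltnn eqxx.
Qed.

Lemma count_ltn_iota (x L : nat) : count (fun t => (t < L) && (t < x)) (iota 0 L) = minn L x.
Proof.
rewrite (@eq_in_count _ _ (fun t => t < x)); last by move=> t; rewrite mem_iota /= => ->.
elim: L => [|L IH]; first by rewrite min0n.
rewrite -[L.+1]addn1 iotaD count_cat IH /= add0n addn0; case: (ltnP L x) => ltLx /=; lia.
Qed.

Lemma val_minn (k i : nat) : i < k -> cval k (fun st xs => minn (size (sinp st)) (nth 0 xs i)).
Proof.
move=> lti.
have c2 := cpt_reindex (k' := 1 + k) (idx := [:: 0; i.+1]) cpt_lt erefl.
apply: val_ext (val_count (m := 1) (c2 _)) => [st xs _|]; last by rewrite /= add1n ltnS lti.
by rewrite tups1 count_map -[RHS]count_ltn_iota; apply: eq_count => t.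
Qed.

(** The number with base-[L] digits [xs]. Digits are cut at [L] because values are computed by
    counting below the input size. *)
Definition addr (m L : nat) (xs : seq nat) : nat :=
  sumn [seq minn L (nth 0 xs i) * L ^ i | i <- iota 0 m].

Lemma val_addr (m : nat) : cval m (fun st xs => addr m (size (sinp st)) xs).
Proof.
apply: val_sumn => i; rewrite mem_iota add0n => /andP [_ lti].
have c2 := cpt_reindex (k' := i.+1 + m) (idx := [:: i; i.+1 + i]) cpt_lt erefl.
apply: val_ext (val_count (c2 _)) => [st xs _|]; last by rewrite /=; lia.
rewrite -(count_ltn_iota (nth 0 xs i)) -count_tups_last.
apply: eq_in_count => t; rewrite mem_tups => /andP [/eqP szt _] /=.
by rewrite !nth_cat szt ltnSn [i.+1 + i < _]ltnNge leq_addr /= addKn.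
Qed.

Lemma addr_lt (m L : nat) (xs : seq nat) : all (gtn L) xs -> m <= size xs -> addr m L xs < L ^ m.
Proof.
move=> /(all_nthP 0) ltxs; elim: m => [|m IH] ltm //.
rewrite /addr -[m.+1]addn1 iotaD map_cat sumn_cat /= add0n addn0 -/(addr m L xs) addn1.
have := IH (ltnW ltm); have /= := ltxs _ ltm; rewrite expnS; nia.
Qed.

Lemma addr_inj (m L : nat) : {in tups m L &, injective (addr m L)}.
Proof.
move=> xs ys; rewrite !mem_tups => /andP [/eqP szx lx] /andP [/eqP szy ly] e.
suff eqn j : j <= m -> addr j L xs = addr j L ys ->
    forall i, i < j -> nth 0 xs i = nth 0 ys i.
  by apply: (@eq_from_nth _ 0); rewrite szx // => i; apply: (eqn m).
elim: j => [|j IH] // ltj; have := addr_lt (m := j) lx; have := addr_lt (m := j) ly.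
rewrite szx szy (ltnW ltj) => /(_ isT) lty /(_ isT) ltx.
rewrite /addr -[j.+1]addn1 iotaD !map_cat !sumn_cat /= add0n !addn0.
rewrite -/(addr j L xs) -/(addr j L ys).
have /= /ltnW/minn_idPr -> := all_nthP 0 lx j (leq_trans ltj (eq_leq (esym szx))).
have /= /ltnW/minn_idPr -> := all_nthP 0 ly j (leq_trans ltj (eq_leq (esym szy))).
move=> eqs; have eqj : nth 0 xs j = nth 0 ys j by nia.
move=> i; rewrite addn1 ltnS leq_eqVlt => /predU1P [-> //|lti].
by apply: IH lti; [exact: ltnW|move: eqs; rewrite eqj; lia].
Qed.

Lemma nth_set_true (s : seq bool) (i j : nat) :
  nth false (set_nth false s i true) j = (i == j) || nth false s j.
Proof. by rewrite nth_set_nth /= eq_sym; case: eqP. Qed.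

Lemma sinp_sset (st : static) (t : bool) (i : nat) : sinp (sset st t i) = sinp st.
Proof. by case: t. Qed.

Lemma stab_sset (st : static) (t : bool) (i : nat) :
  stab (sset st t i) t = set_nth false (stab st t) i true.
Proof. by case: t. Qed.

Section Iteration.

Variables (m : nat) (Phi : seq sym -> (seq nat -> bool) -> seq nat -> bool).

Definition table (st : static) (ys : seq nat) : bool :=
  nth false (stab st false) (addr m (size (sinp st)) ys).

Definition table_new (st : static) (ys : seq nat) : bool :=
  nth false (stab st true) (addr m (size (sinp st)) ys).

Hypothesis cptPhi : cpt m (fun st xs => Phi (sinp st) (table st) xs).
Hypothesis extPhi : forall w R R', {in tups m (size w), R =1 R'} ->
  {in tups m (size w), Phi w R =1 Phi w R'}.

Fixpoint stage (w : seq sym) (t : nat) (xs : seq nat) : bool :=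
  if t is t'.+1 then stage w t' xs || Phi w (stage w t') xs else false.

(** Bits are only ever set. The new relation is collected in the second table so that all
    evaluations of [Phi] in one round read the same old relation. *)
Definition upd1 (xs : seq nat) (st : static) : static :=
  if Phi (sinp st) (table st) xs then sset st true (addr m (size (sinp st)) xs) else st.

Definition upd2 (xs : seq nat) (st : static) : static :=
  if table_new st xs then sset st false (addr m (size (sinp st)) xs) else st.

Definition pass (upd : seq nat -> static -> static) (st : static) : static :=
  foldl (fun st' t => upd t st') st (tups m (size (sinp st))).

Lemma pass1E (st : static) : let st' := pass upd1 st in
  [/\ sinp st' = sinp st, stab st' false = stab st false &
    {in tups m (size (sinp st)), forall xs,
       table_new st' xs = table_new st xs || Phi (sinp st) (table st) xs}].
Proof.
suff gen ts : {subset ts <= tups m (size (sinp st))} ->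
    let st' := foldl (fun st' t => upd1 t st') st ts in
    [/\ sinp st' = sinp st, stab st' false = stab st false &
      {in tups m (size (sinp st)), forall xs, table_new st' xs =
         table_new st xs || ((xs \in ts) && Phi (sinp st) (table st) xs)}].
  have [//|e1 e2 e3] := gen (tups m (size (sinp st))).
  by split=> // xs xsL; rewrite e3 // xsL.
elim/last_ind: ts => [|ts t IH] sub; first by split=> // xs _; rewrite orbF.
have [x xts|] := IH _; first by apply: sub; rewrite mem_rcons inE xts orbT.
rewrite foldl_rcons; set st0 := foldl _ _ _ => /= e1 e2 e3.
have etab : table st0 =1 table st by move=> ys; rewrite /table e1 /= e2.
have tL : t \in tups m (size (sinp st)) by apply: sub; rewrite mem_rcons mem_head.
have ePhi : Phi (sinp st) (table st0) t = Phi (sinp st) (table st) t.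
  by apply: extPhi => // ys _; apply: etab.
split.
- by rewrite /upd1; case: ifP.
- by rewrite /upd1; case: ifP.
- move=> xs xsL; rewrite /upd1 e1 ePhi mem_rcons inE.
  case: (boolP (Phi _ _ t)) => Pt; last first.
    rewrite e3 //; case: (xs =P t) => [->|//].
    by rewrite (negPf Pt) !andbF.
  rewrite /table_new sinp_sset stab_sset e1 nth_set_true -{3}e1 -/(table_new st0 xs) e3 //.
  have -> : (addr m (size (sinp st)) t == addr m (size (sinp st)) xs) = (xs == t).
    by apply/eqP/eqP => [/addr_inj ->|->].
  by case: (xs =P t) => [->|]; rewrite ?Pt ?orbT.
Qed.

Lemma pass2E (st : static) : let st' := pass upd2 st in
  [/\ sinp st' = sinp st, stab st' true = stab st true &
    {in tups m (size (sinp st)), forall xs, table st' xs = table st xs || table_new st xs}].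
Proof.
suff gen ts : {subset ts <= tups m (size (sinp st))} ->
    let st' := foldl (fun st' t => upd2 t st') st ts in
    [/\ sinp st' = sinp st, stab st' true = stab st true &
      {in tups m (size (sinp st)), forall xs, table st' xs =
         table st xs || ((xs \in ts) && table_new st xs)}].
  have [//|e1 e2 e3] := gen (tups m (size (sinp st))).
  by split=> // xs xsL; rewrite e3 // xsL.
elim/last_ind: ts => [|ts t IH] sub; first by split=> // xs _; rewrite orbF.
have [x xts|] := IH _; first by apply: sub; rewrite mem_rcons inE xts orbT.
rewrite foldl_rcons; set st0 := foldl _ _ _ => /= e1 e2 e3.
have etab ys : table_new st0 ys = table_new st ys by rewrite /table_new e1 /= e2.
have tL : t \in tups m (size (sinp st)) by apply: sub; rewrite mem_rcons mem_head.
split.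
- by rewrite /upd2; case: ifP.
- by rewrite /upd2; case: ifP.
- move=> xs xsL; rewrite /upd2 e1 etab mem_rcons inE.
  case: (boolP (table_new st t)) => Pt; last first.
    rewrite e3 //; case: (xs =P t) => [->|//].
    by rewrite (negPf Pt) !andbF.
  rewrite /table sinp_sset stab_sset e1 nth_set_true -{3}e1 -/(table st0 xs) e3 //.
  have -> : (addr m (size (sinp st)) t == addr m (size (sinp st)) xs) = (xs == t).
    by apply/eqP/eqP => [/addr_inj ->|->].
  by case: (xs =P t) => [->|]; rewrite ?Pt ?orbT.
Qed.

Definition round (st : static) : static := pass upd2 (pass upd1 st).

Lemma roundE (w : seq sym) (t : nat) (st : static) :
  sinp st = w -> {in tups m (size w), table st =1 stage w t} ->
  {in tups m (size w), table_new st =1 stage w t} ->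
  [/\ sinp (round st) = w, {in tups m (size w), table (round st) =1 stage w t.+1}
    & {in tups m (size w), table_new (round st) =1 stage w t.+1}].
Proof.
move=> <- eR eS; have [a1 a2 a3] := pass1E st; have [b1 b2 b3] := pass2E (pass upd1 st).
have new : {in tups m (size (sinp st)), table_new (pass upd1 st) =1 stage (sinp st) t.+1}.
  by move=> xs xsL; rewrite a3 // eS //=; congr (_ || _); apply: extPhi.
split; first by rewrite b1.
  move=> xs xsL; rewrite b3 ?a1 // new // /table a1 a2 -/(table st xs) eR //=.
  by case: (stage _ _ _).
by move=> xs xsL; rewrite /table_new b1 b2 a1 -new // /table_new a1.
Qed.

Lemma stp_pass (upd : seq nat -> static -> static) :
  (forall xs st, sinp (upd xs st) = sinp st) -> stp m upd -> stp 0 (fun _ => pass upd).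
Proof.
move=> inpu cu l rs szr ltr; have {}cu : stp (m + 0) upd by rewrite addn0.
apply: prog_conseq (stp_foreach inpu cu szr ltr) _ => s b s' _ [-> e ks]; split=> //.
rewrite e; case: rs szr {ltr e} => // _; rewrite /pass.
by move: (tups _ _) => ts; elim: ts (s.1) => //= t ts IH st; rewrite cats0 IH.
Qed.

Lemma stp_round : stp 0 (fun _ => round).
Proof.
have i1 xs st : sinp (upd1 xs st) = sinp st by rewrite /upd1; case: ifP.
have i2 xs st : sinp (upd2 xs st) = sinp st by rewrite /upd2; case: ifP.
apply: (@stp_seq 0 (fun=> pass upd1) (fun=> pass upd2)); apply: stp_pass => //.
  exact: (stp_if cptPhi (stp_set true (@val_addr m))).
exact: (stp_if (cpt_tab_at true (@val_addr m)) (stp_set false (@val_addr m))).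
Qed.

(** The number of rounds is the number of [m]-tuples, enough for a growing relation to become
    stable; the loop over tuples serves merely as a clock. *)
Theorem iteration_poly_time (Psi : seq sym -> (seq nat -> bool) -> bool) :
  cpt 0 (fun st _ => Psi (sinp st) (table st)) ->
  exists (M : TM) (c k : nat), tm_accept M != tm_reject M /\
    forall w, (forall R R', {in tups m (size w), R =1 R'} -> Psi w R = Psi w R') ->
      final_state M (c * size w ^ k + c) w =
      if Psi w (stage w (size w ^ m)) then tm_accept M else tm_reject M.
Proof.
move=> cptPsi.
have inpr st : sinp (round st) = sinp st.
  by have [a1 _ _] := pass1E st; have [b1 _ _] := pass2E (pass upd1 st); rewrite b1.
have stp_rounds : stp 0 (fun _ st => iter (size (sinp st) ^ m) round st).
  have cr : stp (m + 0) (fun _ => round).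
    move=> l rs szr ltr.
    by apply: prog_conseq (stp_round (l := l) (rs := [::]) erefl isT) _ => s b s' _ [].
  move=> l rs szr ltr.
  apply: prog_conseq (stp_foreach (fun=> inpr) cr szr ltr) _ => s b s' _ [-> e ks].
  split=> //; rewrite e -size_tups; move: (tups _ _) => ts; elim: ts (s.1) => //= t ts IH st.
  by rewrite IH -iterSr.
have [M [c [k [neq correct]]]] := prog_poly_time stp_rounds cptPsi.
exists M, c, k; split=> // w extPsi; rewrite correct /=.
set st0 := (w, _); set T := _ ^ m.
suff [e1 e2 _] : [/\ sinp (iter T round st0) = w,
    {in tups m (size w), table (iter T round st0) =1 stage w T}
    & {in tups m (size w), table_new (iter T round st0) =1 stage w T}].
  by rewrite e1 (extPsi _ _ e2).
elim: T => [|T [IH1 IH2 IH3]].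
  by split=> // xs _; rewrite /table /table_new /= nth_nil.
exact: roundE.
Qed.

End Iteration.

(** * The Weisfeiler-Leman refinement as a definable operator *)

Lemma cpt_has1 (k : nat) (phi : static -> seq nat -> bool) :
  cpt k.+1 phi ->
  cpt k (fun st xs => has (fun x => phi st (x :: xs)) (iota 0 (size (sinp st)))).
Proof.
rewrite -add1n => /cpt_has; apply: cpt_ext => st xs _.
by rewrite tups1 has_map.
Qed.

Lemma val_count1 (k : nat) (phi : static -> seq nat -> bool) :
  cpt k.+1 phi ->
  cval k (fun st xs => count (fun x => phi st (x :: xs)) (iota 0 (size (sinp st)))).
Proof.
rewrite -add1n => /val_count; apply: val_ext => st xs _.
by rewrite tups1 count_map.
Qed.

Lemma count_tups2 (L : nat) (p q : nat -> bool) :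
  count (fun t => p (nth 0 t 0) && q (nth 0 t 1)) (tups 2 L) =
  count p (iota 0 L) * count q (iota 0 L).
Proof.
have e x : count (fun t => p (nth 0 t 0) && q (nth 0 t 1)) [seq rcons t x | t <- tups 1 L] =
    count p (iota 0 L) * q x.
  rewrite count_map tups1 count_map; case qx: (q x); rewrite ?muln1 ?muln0.
    by apply: eq_count => y /=; rewrite qx andbT.
  by rewrite (@eq_count _ _ pred0) ?count_pred0 // => y /=; rewrite qx andbF.
rewrite -[tups 2 L]/[seq rcons t x | x <- iota 0 L, t <- tups 1 L].
elim: {1 3}(iota 0 L) => [|x s IH] /=; first by rewrite muln0.
by rewrite count_cat IH e -mulnDr.
Qed.

Lemma val_mul_count (k : nat) (phi psi : static -> seq nat -> bool) :
  cpt k.+1 phi -> cpt k.+1 psi ->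
  cval k (fun st xs => count (fun x => phi st (x :: xs)) (iota 0 (size (sinp st))) *
                      count (fun x => psi st (x :: xs)) (iota 0 (size (sinp st)))).
Proof.
move=> cp cq.
have c1 := cpt_reindex (k' := 2 + k) (idx := 0 :: iota 2 k) cp.
have c2 := cpt_reindex (k' := 2 + k) (idx := 1 :: iota 2 k) cq.
have ltk : all (gtn (2 + k)) (iota 2 k) by apply/allP => i; rewrite mem_iota => /andP [].
apply: val_ext (val_count (m := 2) (cpt_and (c1 _ _) (c2 _ _))) => [st xs szx||||];
  rewrite /= ?size_iota //.
rewrite -(@count_tups2 _ (fun x => phi st (x :: xs)) (fun x => psi st (x :: xs))).
rewrite -[X in count _ X = _]/(tups 2 (size (sinp st))).
apply: eq_in_count => t; rewrite mem_tups => /andP [/eqP szt _].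
have -> : [seq nth 0 (t ++ xs) i | i <- iota 2 k] = xs.
  rewrite -(addn0 2) iotaDl -map_comp -[RHS](mkseq_nth 0) szx.
  by apply: eq_map => i; rewrite /comp nth_cat szt ltnNge leq_addr addKn.
by rewrite !nth_cat szt.
Qed.

Lemma cpt_if (k : nat) (phi psi chi : static -> seq nat -> bool) :
  cpt k phi -> cpt k psi -> cpt k chi ->
  cpt k (fun st xs => if phi st xs then psi st xs else chi st xs).
Proof.
move=> cp cq cr; apply: cpt_ext (cpt_or (cpt_and cp cq) (cpt_and (cpt_not cp) cr)) => st xs _.
by case: (phi st xs); rewrite //= orbF.
Qed.

Lemma val_const (k n : nat) : cval k (fun _ _ => n).
Proof.
elim: n => [|n IH]; first exact: val_zero.
have ct : cpt (0 + k) (fun _ _ => true).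
  by apply: cpt_ext (cpt_val_eq (@val_zero k) (@val_zero k)).
by apply: val_ext (val_add (val_count (m := 0) ct) IH).
Qed.

(** The first separator stands at the square of the number of vertices, which makes this number
    definable without division. *)
Definition firstsep (w : seq sym) (t : nat) : bool :=
  (onth w t == Some ssep) &&
  ~~ has (fun t' => (t' < t) && (onth w t' == Some ssep)) (iota 0 (size w)).

(* [x] is a vertex of the first graph, that is [x < n]. *)
Definition vert (w : seq sym) (x : nat) : bool :=
  has (fun n => (x < n) && firstsep w (n * n)) (iota 0 (size w)).

Definition nvert (w : seq sym) : nat := count (vert w) (iota 0 (size w)).

(* Adjacency in the first graph if [b = 0], in the second one otherwise. *)
Definition adj (w : seq sym) (b x y : nat) : bool :=
  let pos := minn (size w) x * nvert w + minn (size w) y in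
  [&& vert w x, vert w y &
    if minn (size w) b == 0 then onth w pos == Some s1
    else onth w (pos + (nvert w * nvert w + 1)) == Some s1].

Lemma cpt_ltn (k i j : nat) : i < k -> j < k ->
  cpt k (fun st xs => (nth 0 xs i < size (sinp st)) && (nth 0 xs i < nth 0 xs j)).
Proof.
move=> lti ltj; have := cpt_reindex (k' := k) (idx := [:: i; j]) cpt_lt erefl.
by rewrite /= lti ltj => /(_ isT).
Qed.

Lemma cpt_at1 (k i : nat) (phi : seq sym -> nat -> bool) :
  cpt 1 (fun st xs => phi (sinp st) (nth 0 xs 0)) -> i < k ->
  cpt k (fun st xs => phi (sinp st) (nth 0 xs i)).
Proof.
by move=> cp lti; apply: (cpt_reindex (idx := [:: i]) cp) => //=; rewrite lti.
Qed.

Lemma cpt_firstsep : cpt 1 (fun st xs => firstsep (sinp st) (nth 0 xs 0)).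
Proof.
apply: cpt_and; first exact: cpt_sym.
have cs := cpt_reindex (k' := 2) (idx := [:: 0]) (cpt_sym (Some ssep)) erefl isT.
apply: cpt_ext (cpt_not (cpt_has1 (cpt_and (@cpt_ltn 2 0 1 isT isT) cs))) => st xs _.
congr (~~ _); apply: eq_in_has => t'; rewrite mem_iota /= => lt.
by rewrite lt.
Qed.

Lemma cpt_vert : cpt 1 (fun st xs => vert (sinp st) (nth 0 xs 0)).
Proof.
have sq : cval 2 (fun st xs => count (fun t => (t < size (sinp st)) && (t < nth 0 xs 0))
      (iota 0 (size (sinp st))) * count (fun t => (t < size (sinp st)) && (t < nth 0 xs 0))
      (iota 0 (size (sinp st)))).
  exact: (val_mul_count (@cpt_ltn 3 0 1 isT isT) (@cpt_ltn 3 0 1 isT isT)).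
have cf := cpt_let sq (cpt_at1 (k := 3) (i := 0) cpt_firstsep isT).
apply: cpt_ext (cpt_has1 (cpt_and (@cpt_ltn 2 1 0 isT isT) cf)) => st xs _.
apply: eq_in_has => n; rewrite mem_iota /= add0n count_ltn_iota => ltn.
rewrite (minn_idPr (ltnW ltn)); case: (ltnP (nth 0 xs 0) n) => [lt|_]; last by rewrite andbF.
by rewrite (ltn_trans lt ltn).
Qed.

Lemma val_nvert2 (k : nat) : cval k (fun st _ => nvert (sinp st) * nvert (sinp st)).
Proof.
have cv := cpt_at1 (k := k.+1) (i := 0) cpt_vert isT.
exact: (val_mul_count cv cv).
Qed.

Lemma cpt_adj (k b x y : nat) : b < k -> x < k -> y < k ->
  cpt k (fun st xs => adj (sinp st) (nth 0 xs b) (nth 0 xs x) (nth 0 xs y)).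
Proof.
move=> ltb ltx lty.
have cpos : cval k (fun st xs => minn (size (sinp st)) (nth 0 xs x) * nvert (sinp st)
    + minn (size (sinp st)) (nth 0 xs y)).
  apply: val_add; last exact: val_minn.
  have ltx' : x.+1 < k.+1 by [].
  have cv := cpt_at1 (k := k.+1) (i := 0) cpt_vert isT.
  apply: val_ext (val_mul_count (cpt_ltn (ltn0Sn k) ltx') cv) => st xs _ /=.
  by rewrite count_ltn_iota.
apply: cpt_and; first exact: cpt_at1 cpt_vert ltx.
apply: cpt_and; first exact: cpt_at1 cpt_vert lty.
apply: cpt_if.
- exact: cpt_val_eq (val_minn ltb) (@val_zero k).
- exact: cpt_sym_at.
- apply: cpt_sym_at; apply: val_add => //.
  exact: val_add (@val_nvert2 k) (@val_const k 1).
Qed.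

Section Refinement.

Variable k : nat.

(* A point is a side [b] followed by a [k]-tuple of vertices. *)
Local Notation K := k.+1.
Local Notation m := (K + K).

Definition atomdiff (w : seq sym) (p q : seq nat) : bool :=
  has (fun i => has (fun j =>
    ((nth 0 p i == nth 0 p j) != (nth 0 q i == nth 0 q j)) ||
    (adj w (nth 0 p 0) (nth 0 p i) (nth 0 p j) != adj w (nth 0 q 0) (nth 0 q i) (nth 0 q j)))
    (iota 1 k)) (iota 1 k).

(** [R] means having different colours, so its negation counts the replacements that fall into the
    colour class of [r]. *)
Definition cntW (w : seq sym) (R : seq nat -> bool) (r p : seq nat) (i : nat) : nat :=
  count (fun y => vert w y && ~~ R (r ++ set_nth 0 p i y)) (iota 0 (size w)).

(** Inequivalence is what grows under refinement, which suits an iteration that only sets bits.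
    Colours are named by arbitrary tuples [r], so no list of colours is kept. *)
Definition wl_step (w : seq sym) (R : seq nat -> bool) (xs : seq nat) : bool :=
  let p := take K xs in let q := drop K xs in
  atomdiff w p q ||
  has (fun i => has (fun r => cntW w R r p i != cntW w R r q i) (tups K (size w))) (iota 1 k).

(** The first conjunct compares sizes: the separator closing the second matrix must stand where a
    matrix of the size of the first would end. *)
Definition wl_accept (w : seq sym) (R : seq nat -> bool) : bool :=
  (onth w (nvert w * nvert w + (1 + nvert w * nvert w)) == Some ssep) &&
  ~~ has (fun u => all (vert w) u &&
        ~~ has (fun v => all (vert w) v && ~~ R ((0 :: u) ++ (1 :: v))) (tups k (size w)))
     (tups k (size w)).

Lemma map_nth_iota (o n : nat) (s : seq nat) : o + n <= size s ->
  [seq nth 0 s (o + j) | j <- iota 0 n] = take n (drop o s).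
Proof.
move=> le; apply: (@eq_from_nth _ 0).
  by rewrite size_map size_iota size_take size_drop; case: ltnP => //; lia.
move=> i; rewrite size_map size_iota => lti.
by rewrite (nth_map 0) ?size_iota // nth_iota // nth_take // nth_drop.
Qed.

Lemma val_cntW (o i : nat) : o <= K -> i \in iota 1 k ->
  cval (K + m) (fun st ys =>
    cntW (sinp st) (table m st) (take K ys) (take K (drop (K + o) ys)) i).
Proof.
move=> leo; rewrite mem_iota => /andP [i_gt0 lti].
(* Index 0 is the counted vertex, which replaces entry [i] of the copied point; [o] selects which of
   the two points is copied. *)
pose idx := [seq 1 + j | j <- iota 0 K] ++
  [seq if j == i then 0 else 1 + (K + o) + j | j <- iota 0 K].
have ct := cpt_reindex (k' := (K + m).+1) (idx := idx) (cpt_tab_at false (@val_addr m)).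
have cv := cpt_at1 (k := (K + m).+1) (i := 0) cpt_vert isT.
apply: val_ext (val_count1 (cpt_and cv (cpt_not (ct _ _)))) => [st xs szx||].
- apply: eq_count => y /=; congr (_ && ~~ _).
  rewrite -[LHS]/(table m st [seq nth 0 (y :: xs) j | j <- idx]); congr (table m st _).
  rewrite /idx map_cat -!map_comp; congr (_ ++ _).
    by have := @map_nth_iota 0 K xs; rewrite drop0 => <-; [apply: eq_map|rewrite szx; lia].
  have szd : size (take K (drop (K + o) xs)) = K.
    by rewrite size_take size_drop szx; case: ltnP => //; lia.
  apply: (@eq_from_nth _ 0).
    by rewrite size_map size_set_nth size_iota szd; lia.
  move=> j; rewrite size_map size_iota => ltj.
  rewrite (nth_map 0) ?size_iota // nth_iota // add0n nth_set_nth /=.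
  case: eqP => // _; rewrite nth_take // nth_drop.
  by rewrite addSn.
- by rewrite size_cat !size_map !size_iota.
- rewrite all_cat !all_map; apply/andP; split; apply/allP => j; rewrite mem_iota /=; first by lia.
  by move=> ltj; case: eqP => _ //; lia.
Qed.

Lemma cpt_wl_step : cpt m (fun st xs => wl_step (sinp st) (table m st) xs).
Proof.
apply: cpt_or.
  have atom i j : i \in iota 1 k -> j \in iota 1 k -> cpt m (fun st xs =>
      ((nth 0 xs i == nth 0 xs j) != (nth 0 xs (K + i) == nth 0 xs (K + j))) ||
      (adj (sinp st) (nth 0 xs 0) (nth 0 xs i) (nth 0 xs j) !=
       adj (sinp st) (nth 0 xs (K + 0)) (nth 0 xs (K + i)) (nth 0 xs (K + j)))).
    rewrite !mem_iota => lti ltj; apply: cpt_or; apply: cpt_addb.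
    - by apply: (cpt_reindex (idx := [:: i; j]) cpt_eq) => //=; lia.
    - by apply: (cpt_reindex (idx := [:: K + i; K + j]) cpt_eq) => //=; lia.
    - by apply: cpt_adj; lia.
    - by apply: cpt_adj; lia.
  have := cpt_has_const (fun i ik => cpt_has_const (fun j jk => atom i j ik jk)).
  apply: cpt_ext => st xs szx.
  apply: eq_in_has => i; rewrite mem_iota => lti; apply: eq_in_has => j; rewrite mem_iota => ltj.
  by rewrite !nth_take ?nth_drop //; lia.
apply: cpt_ext (cpt_has_const (s := iota 1 k) (fun i ik => cpt_has (m := K)
  (cpt_not (cpt_val_eq (val_cntW (leq0n K) ik) (val_cntW (leqnn K) ik))))) => st xs szx.
apply: eq_has => i; apply: eq_in_has => r; rewrite mem_tups => /andP [/eqP szr _].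
have -> : drop m (r ++ xs) = drop K xs by rewrite drop_cat szr ltnNge leq_addr addKn.
rewrite take_size_cat // addn0 drop_size_cat // [take K (drop K xs)]take_oversize //.
by rewrite size_drop szx addKn.
Qed.

Lemma tups_cat (n1 n2 L : nat) (s t : seq nat) :
  s \in tups n1 L -> t \in tups n2 L -> s ++ t \in tups (n1 + n2) L.
Proof.
by rewrite !mem_tups size_cat all_cat => /andP [/eqP -> ->] /andP [/eqP -> ->]; rewrite eqxx.
Qed.

Lemma tups_set_nth (n L i y : nat) (p : seq nat) :
  p \in tups n L -> i < n -> y < L -> set_nth 0 p i y \in tups n L.
Proof.
rewrite !mem_tups size_set_nth => /andP [/eqP <- /(all_nthP 0) ltp] lti lty.
rewrite (maxn_idPr lti) eqxx /=; apply/(all_nthP 0) => j; rewrite size_set_nth (maxn_idPr lti).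
by move=> ltj; rewrite nth_set_nth /=; case: eqP => // _; apply: ltp.
Qed.

Lemma tups_split (n1 n2 L : nat) (xs : seq nat) : xs \in tups (n1 + n2) L ->
  take n1 xs \in tups n1 L /\ drop n1 xs \in tups n2 L.
Proof.
rewrite !mem_tups -{1 2}(cat_take_drop n1 xs) all_cat => /and3P [/eqP szx -> ->].
rewrite cat_take_drop in szx.
by rewrite size_takel ?size_drop szx ?leq_addr // addKn !eqxx.
Qed.

Lemma cntW_ext (w : seq sym) (R R' : seq nat -> bool) (r p : seq nat) (i : nat) :
  {in tups m (size w), R =1 R'} -> r \in tups K (size w) -> p \in tups K (size w) ->
  i \in iota 1 k -> cntW w R r p i = cntW w R' r p i.
Proof.
rewrite [i \in _]mem_iota => eR rL pL /andP [_ lti]; apply: eq_in_count => y.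
rewrite mem_iota => /andP [_ lty] /=; rewrite eR //.
by apply: tups_cat rL _; apply: tups_set_nth.
Qed.

Lemma wl_step_ext (w : seq sym) (R R' : seq nat -> bool) :
  {in tups m (size w), R =1 R'} -> {in tups m (size w), wl_step w R =1 wl_step w R'}.
Proof.
move=> eR xs /tups_split [pL qL]; congr (_ || _).
apply: eq_in_has => i ik; apply: eq_in_has => r rL.
by rewrite (cntW_ext eR rL pL ik) (cntW_ext eR rL qL ik).
Qed.

Lemma cpt_all_vert (n o : nat) : o + k <= n ->
  cpt n (fun st xs => all (vert (sinp st)) (take k (drop o xs))).
Proof.
move=> le.
apply: cpt_ext (cpt_not (cpt_has_const (s := iota 0 k)
  (phi := fun i st xs => ~~ vert (sinp st) (nth 0 xs (o + i))) _)) => [st xs szx|i].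
  rewrite -all_predC -map_nth_iota ?szx // all_map.
  by apply: eq_all => i /=; rewrite negbK.
rewrite mem_iota => lti; apply: cpt_not; apply: cpt_at1 cpt_vert _; lia.
Qed.

Lemma cpt_wl_accept : cpt 0 (fun st _ => wl_accept (sinp st) (table m st)).
Proof.
apply: cpt_and.
  exact: cpt_sym_at (val_add (@val_nvert2 0) (val_add (@val_const 0 1) (@val_nvert2 0))).
pose idx := 1 :: [seq 2 + k + j | j <- iota 0 k] ++ 0 :: [seq 2 + j | j <- iota 0 k].
have ct := cpt_reindex (k' := (k + k).+2) (idx := idx) (cpt_tab_at false (@val_addr m)).
have {}ct := cpt_let (@val_zero _) (cpt_let (@val_const _ 1) (ct _ _)).
apply: cpt_ext (cpt_not (cpt_has (m := k) (k := 0) (phi := fun st u =>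
  all (vert (sinp st)) (take k u) && ~~ has (fun v => all (vert (sinp st)) (take k (v ++ u)) &&
   ~~ table m st [seq nth 0 (1 :: 0 :: (v ++ u)) j | j <- idx]) (tups k (size (sinp st)))) _)).
- move=> st xs; case: xs => // _; congr (~~ _); apply: eq_in_has => u.
  rewrite mem_tups cats0 => /andP [/eqP szu _]; rewrite take_oversize ?szu //; congr (_ && ~~ _).
  apply: eq_in_has => v; rewrite mem_tups => /andP [/eqP szv _].
  rewrite take_size_cat //; congr (_ && ~~ table m st _).
  rewrite /= map_cat /= -!map_comp; congr (_ :: _ ++ _ :: _).
    rewrite -[RHS](mkseq_nth 0) szu; apply: eq_map => j /=.
    by rewrite nth_cat szv ltnNge leq_addr addKn.
  rewrite -[RHS](mkseq_nth 0) szv; apply/eq_in_map => j; rewrite mem_iota /= => ltj.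
  by rewrite nth_cat szv ltj.
- rewrite addn0; apply: cpt_and.
    by apply: cpt_ext (cpt_all_vert (n := k) (o := 0) (leqnn k)) => st xs _; rewrite drop0.
  apply: cpt_not; apply: (cpt_has (m := k) (k := k) (phi := fun st ys =>
    all (vert (sinp st)) (take k ys) && ~~ table m st [seq nth 0 [:: 1, 0 & ys] j | j <- idx])).
  apply: cpt_and.
    by apply: cpt_ext (cpt_all_vert (n := k + k) (o := 0) (leq_addr k k)) => st xs _; rewrite drop0.
  apply: cpt_not; apply: ct.
  + by rewrite /idx /= size_cat /= !size_map !size_iota.
  + apply/allP => j; rewrite inE mem_cat inE => /or4P [/eqP ->|/mapP [i]|/eqP ->|/mapP [i]] //.
      by rewrite mem_iota /= => lti ->; lia.
    by rewrite mem_iota /= => lti ->; lia.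
Qed.

Lemma wl_accept_ext (w : seq sym) (R R' : seq nat -> bool) :
  {in tups m (size w), R =1 R'} -> 1 < size w -> wl_accept w R = wl_accept w R'.
Proof.
move=> eR gt1; congr (_ && ~~ _); apply: eq_in_has => u uL; congr (_ && ~~ _).
apply: eq_in_has => v vL; congr (_ && ~~ _); apply: eR; apply: tups_cat.
  by move: uL; rewrite !mem_tups /= eqSS => /andP [-> ->]; rewrite (ltnW gt1).
by move: vL; rewrite !mem_tups /= eqSS => /andP [-> ->]; rewrite gt1.
Qed.

End Refinement.

(** * Reading the encoding *)

Lemma onth_allpairs (A B C : Type) (f : A -> B -> C) (s : seq A) (t : seq B) (a0 : A) (b0 : B)
    (i j : nat) : i < size s -> j < size t ->
  onth [seq f x y | x <- s, y <- t] (i * size t + j) = Some (f (nth a0 s i) (nth b0 t j)).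
Proof.
move=> + ltj; elim: s i => //= x s IH [|i] lti; rewrite onth_cat size_map.
  by rewrite mul0n add0n ltj onthE -map_comp (nth_map b0).
by rewrite mulSn -addnA ltnNge leq_addr addKn; apply: IH.
Qed.

Section Encoding.

Variables (n m : nat) (G1 : rel 'I_n) (G2 : rel 'I_m).

Local Notation w := (encode_pair G1 G2).

Lemma size_encode_graph (l : nat) (G : rel 'I_l) : size (encode_graph G) = l * l + 1.
Proof. by rewrite size_cat size_allpairs -!cardE card_ord. Qed.

Lemma size_encode : size w = n * n + 1 + (m * m + 1).
Proof. by rewrite size_cat !size_encode_graph. Qed.

Lemma onth_encode_graph (l : nat) (G : rel 'I_l) (i j : 'I_l) :
  onth (encode_graph G) (i * l + j) = Some (if G i j then s1 else s0).
Proof.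
have szl : size (enum 'I_l) = l by rewrite -cardE card_ord.
rewrite onth_cat size_allpairs szl ifT; last by have := ltn_ord i; have := ltn_ord j; nia.
have := @onth_allpairs _ _ _ (fun i j => if G i j then s1 else s0) (enum 'I_l) (enum 'I_l) i j i j.
by rewrite szl !ltn_ord !nth_ord_enum => ->.
Qed.

Lemma onth_encode_graph_sep (l : nat) (G : rel 'I_l) (p : nat) : p <= l * l ->
  (onth (encode_graph G) p == Some ssep) = (p == l * l).
Proof.
move=> lep; case: ltngtP lep => // [ltp _|-> _].
  have l_gt0 : 0 < l by case: (l) ltp => //; rewrite ltn0.
  have lti : p %/ l < l by rewrite ltn_divLR.
  have ltj : p %% l < l by rewrite ltn_mod.
  rewrite (divn_eq p l) (onth_encode_graph G (Ordinal lti) (Ordinal ltj)).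
  by case: (G _ _).
by rewrite onth_cat size_allpairs -!cardE card_ord ltnn subnn.
Qed.

Lemma onth_encode1 (p : nat) : p <= n * n -> onth w p = onth (encode_graph G1) p.
Proof. by move=> lep; rewrite onth_cat size_encode_graph addn1 ltnS lep. Qed.

Lemma onth_encode2 (p : nat) : onth w (p + (n * n + 1)) = onth (encode_graph G2) p.
Proof. by rewrite onth_cat size_encode_graph ltnNge leq_addl /= addnK. Qed.

Lemma firstsep_encode (t : nat) : firstsep w t = (t == n * n).
Proof.
apply/andP/eqP => [[sept /hasPn nosep]|->].
  case: (ltngtP t (n * n)) => // [lt|gt].
    by rewrite onth_encode1 ?(ltnW lt) // onth_encode_graph_sep ?(ltnW lt) // ltn_eqF in sept.
  have /nosep : n * n \in iota 0 (size w) by rewrite mem_iota size_encode; lia.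
  by rewrite gt onth_encode1 // onth_encode_graph_sep // eqxx.
split; first by rewrite onth_encode1 // onth_encode_graph_sep.
apply/hasPn => t' _; apply/negP => /andP [lt].
by rewrite onth_encode1 ?(ltnW lt) // onth_encode_graph_sep ?(ltnW lt) // ltn_eqF.
Qed.

Lemma vert_encode (x : nat) : vert w x = (x < n).
Proof.
apply/hasP/idP => [[n' _]|ltx]; first by rewrite firstsep_encode => /andP [lt /eqP e]; nia.
by exists n; rewrite ?ltx ?firstsep_encode ?eqxx // mem_iota size_encode; nia.
Qed.

Lemma count_ltn_and (l L : nat) (P : pred nat) : l <= L ->
  count (fun y => (y < l) && P y) (iota 0 L) = count P (iota 0 l).
Proof.
move=> le; rewrite -(subnKC le) iotaD count_cat add0n.
rewrite [X in _ + X](@eq_in_count _ _ pred0) ?count_pred0 ?addn0.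
  by apply: eq_in_count => y; rewrite mem_iota /= => ->.
by move=> y; rewrite mem_iota /= => /andP [ley _]; rewrite ltnNge ley.
Qed.

Lemma nvert_encode : nvert w = n.
Proof.
rewrite /nvert (@eq_count _ _ (fun y => (y < n) && predT y)).
  by rewrite count_ltn_and ?count_predT ?size_iota // size_encode; nia.
by move=> y; rewrite vert_encode andbT.
Qed.

Lemma size_test_encode :
  (onth w (nvert w * nvert w + (1 + nvert w * nvert w)) == Some ssep) = (n == m).
Proof.
rewrite nvert_encode (_ : _ + _ = n * n + (n * n + 1)); last by lia.
rewrite onth_encode2; case: (leqP (n * n) (m * m)) => le.
  by rewrite onth_encode_graph_sep // !mulnn eqn_exp2r.
rewrite onth_default ?size_encode_graph ?addn1 //.
by apply/esym/eqP => e; rewrite e ltnn in le.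
Qed.

End Encoding.

Lemma adj_encode (n : nat) (G1 G2 : rel 'I_n) (b : bool) (x y : 'I_n) :
  adj (encode_pair G1 G2) b x y = if b then G2 x y else G1 x y.
Proof.
have ltx := ltn_ord x; have lty := ltn_ord y.
rewrite /adj !vert_encode nvert_encode ltx lty /= size_encode.
rewrite !(minn_idPr (_ : _ <= _)); try nia.
have e (G : rel 'I_n) : (onth (encode_graph G) (x * n + y) == Some s1) = G x y.
  by rewrite onth_encode_graph; case: (G x y).
case: b => /=; first by rewrite onth_encode2 e.
by rewrite onth_encode1 ?e //; nia.
Qed.

(** * The pebble game *)

Definition repeb (n k : nat) (u : {ffun 'I_k -> 'I_n}) (i : 'I_k) (y : 'I_n) :
  {ffun 'I_k -> 'I_n} := [ffun j => if j == i then y else u j].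

Definition point (n k : nat) : finType := (bool * {ffun 'I_k -> 'I_n})%type.

(** [pebble_move] is a round of the bijective game: one bijection answers all moves of the pebble.
    Points on the same side are compared too, and this yields colours within one graph. *)
Record pebble_equiv (n k : nat) (G : bool -> rel 'I_n) (E : rel (point n k)) : Prop :=
  PebbleEquiv {
    pebble_refl : reflexive E;
    pebble_sym : symmetric E;
    pebble_trans : transitive E;
    pebble_eq : forall x y, E x y -> forall i j,
      (x.2 i == x.2 j) = (y.2 i == y.2 j);
    pebble_adj : forall x y, E x y -> forall i j,
      G x.1 (x.2 i) (x.2 j) = G y.1 (y.2 i) (y.2 j);
    pebble_move : forall x y, E x y -> forall i, exists2 f : 'I_n -> 'I_n, bijective f &
      forall v, E (x.1, repeb x.2 i v) (y.1, repeb y.2 i (f v)) }.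

(** While the growing set still changes on [X] it gains an element there, and once unchanged it
    stays so. *)
Lemma stable_stage (T : eqType) (X : seq T) (S : nat -> T -> bool) :
  (forall t x, S t x -> S t.+1 x) ->
  (forall t, {in X, S t =1 S t.+1} -> {in X, S t.+1 =1 S t.+2}) ->
  {in X, S (size X) =1 S (size X).+1}.
Proof.
move=> mono ext.
have main t : {in X, S t =1 S t.+1} \/ t <= count (S t) X.
  elim: t => [|t [st|le]]; [by right|by left; apply: ext|].
  case: (boolP (all (fun x => S t x == S t.+1 x) X)) => [/allP e|/allPn [x xX ne]].
    by left; apply: ext => x /e /eqP.
  right; apply: leq_ltn_trans le _; have [Sx S'x] : ~~ S t x /\ S t.+1 x.
    by move: ne (mono t x); case: (S t x); case: (S t.+1 x) => // _ /(_ isT).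
  elim: X xX {ext} => //= y X IH; rewrite inE => /predU1P [<-|yX].
    rewrite (negPf Sx) S'x ltnS; apply: sub_count; exact: mono.
  have := IH yX; have := mono t y; case: (S t y) => [->|_] //.
  by case: (S t.+1 y) => lt; rewrite ?ltnS ?(ltnW lt).
case: (main (size X)) => // le x xX.
have /allP full : all (S (size X)) X by rewrite all_count eqn_leq count_size.
by rewrite (full x xX) mono // full.
Qed.

(** With a representative chosen in every class, equal class sizes become equality of two multisets
    of representatives, and a permutation between them is the bijection. *)
Lemma matching_of_counts (n : nat) (T : finType) (E : rel T) (a b : 'I_n -> T) :
  reflexive E -> symmetric E -> transitive E ->
  (forall x, #|[pred y | E x (a y)]| = #|[pred y | E x (b y)]|) ->
  exists2 f : 'I_n -> 'I_n, bijective f & forall y, E (a y) (b (f y)).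
Proof.
move=> rE sE tE cnt; pose rep x := [pick z | E x z].
have repP x y : (rep x == rep y) = E x y.
  rewrite /rep; apply/eqP/idP => [|Exy].
    by case: pickP => [z Exz|/(_ x)]; rewrite ?rE //; case: pickP => // z' Eyz' [ez];
      apply: (tE z) => //; rewrite sE ez.
  apply: eq_pick => z; apply/idP/idP => [|/(tE _ _ _ Exy) //].
  by apply: tE; rewrite sE.
have cntm (g : 'I_n -> T) v :
    count_mem v [tuple rep (g i) | i < n] = #|[pred y | rep (g y) == v]|.
  by rewrite -sum1_count -sum1_card big_map big_enum_cond; apply: eq_bigl => y.
have /tuple_permP [s es] : perm_eq [tuple rep (b i) | i < n] [tuple rep (a i) | i < n].
  rewrite /perm_eq; apply/allP => v; rewrite mem_cat => /orP vin; apply/eqP; rewrite !cntm.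
  have [x <-] : exists x, rep x = v.
    by case: vin => /mapP [i _ ->]; [exists (b i)|exists (a i)].
  transitivity #|[pred y | E x (b y)]|; first by apply: eq_card => y; rewrite !inE repP sE.
  by rewrite -cnt; apply: eq_card => y; rewrite !inE repP sE.
have sP i : rep (b i) = rep (a (s i)).
  move/(congr1 (fun t => nth None t i)): es.
  by rewrite -!tnth_nth !tnth_mktuple.
exists (s^-1)%g => [|y]; first exact: (Bijective (permKV s) (permK s)).
by rewrite -repP eq_sym sP permKV.
Qed.

Section StageProperties.

Variables (k : nat) (w : seq sym).

Local Notation K := k.+1.
Local Notation st := (stage (wl_step k) w).

Lemma stageS (t : nat) (p q : seq nat) : size p = K ->
  st t.+1 (p ++ q) = [|| st t (p ++ q), atomdiff k w p q |
    has (fun i => has (fun r => cntW w (st t) r p i != cntW w (st t) r q i)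
      (tups K (size w))) (iota 1 k)].
Proof. by move=> szp; rewrite /= /wl_step take_size_cat // drop_size_cat. Qed.

Lemma atomdiffP (p q : seq nat) :
  reflect (forall i j, i \in iota 1 k -> j \in iota 1 k ->
    (nth 0 p i == nth 0 p j) = (nth 0 q i == nth 0 q j) /\
    adj w (nth 0 p 0) (nth 0 p i) (nth 0 p j) = adj w (nth 0 q 0) (nth 0 q i) (nth 0 q j))
  (~~ atomdiff k w p q).
Proof.
apply: (iffP hasPn) => [h i j /h /hasPn h' /h'|h i /h h'].
  by rewrite negb_or !negbK => /andP [/eqP -> /eqP ->].
by apply/hasPn => j /h' [-> ->]; rewrite !eqxx.
Qed.

Lemma stage_refl (t : nat) (p : seq nat) : size p = K -> st t (p ++ p) = false.
Proof.
move=> szp; elim: t => // t IH; rewrite stageS // IH /=.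
apply/negbTE; rewrite negb_or; apply/andP; split; first by apply/atomdiffP.
by apply/hasPn => i _; apply/hasPn => r _; rewrite eqxx.
Qed.

Lemma atomdiff_sym (p q : seq nat) : atomdiff k w p q = atomdiff k w q p.
Proof.
by apply: negb_inj; apply/atomdiffP/atomdiffP => h i j ik jk; have [-> ->] := h i j ik jk.
Qed.

Lemma stage_sym (t : nat) (p q : seq nat) : size p = K -> size q = K ->
  st t (p ++ q) = st t (q ++ p).
Proof.
move=> szp szq; elim: t => // t IH; rewrite !stageS // IH atomdiff_sym.
do 2!congr (_ || _); apply: eq_has => i; apply: eq_has => r.
by rewrite eq_sym.
Qed.

Lemma stage_trans (t : nat) (p q r : seq nat) : size p = K -> size q = K ->
  ~~ st t (p ++ q) -> ~~ st t (q ++ r) -> ~~ st t (p ++ r).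
Proof.
move=> szp szq; elim: t => // t IH; rewrite !stageS // !negb_or.
case/and3P => npq apq cpq /and3P [nqr aqr cqr]; apply/and3P; split; first exact: IH nqr.
  apply/atomdiffP => i j ik jk; have [-> ->] := atomdiffP _ _ apq i j ik jk.
  exact: (atomdiffP _ _ aqr).
apply/hasPn => i ik; apply/hasPn => s sL.
have /hasPn/(_ s sL) := hasPn cpq i ik; have /hasPn/(_ s sL) := hasPn cqr i ik.
by rewrite !negbK => /eqP -> /eqP ->.
Qed.

Lemma stage_stable : {in tups (K + K) (size w),
  st (size w ^ (K + K)) =1 st (size w ^ (K + K)).+1}.
Proof.
rewrite -size_tups; apply: stable_stage => [t x /= -> //|t e xs xsL].
have eS : wl_step k w (st t.+1) xs = wl_step k w (st t) xs.
  by apply: wl_step_ext => // ys /e.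
rewrite -[RHS]/(st t.+1 xs || wl_step k w (st t.+1) xs) eS /=.
by rewrite -orbA orbb.
Qed.

End StageProperties.

Lemma mem_iota1 (k i : nat) : i \in iota 1 k -> exists a : 'I_k, i = a.+1.
Proof. by case: i => [|i]; rewrite mem_iota //= add1n ltnS => lti; exists (Ordinal lti). Qed.

Section Points.

Variables (n k : nat) (G : bool -> rel 'I_n).

Local Notation K := k.+1.
Local Notation w := (encode_pair (G false) (G true)).
Local Notation L := (size w).

Definition point_seq (x : point n k) : seq nat :=
  nat_of_bool x.1 :: [seq nat_of_ord (x.2 i) | i <- enum 'I_k].

Lemma size_point (x : point n k) : size (point_seq x) = K.
Proof. by rewrite /= size_map -cardE card_ord. Qed.

Lemma nth_point (x : point n k) (i : 'I_k) : nth 0 (point_seq x) i.+1 = x.2 i.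
Proof. by rewrite /= (nth_map i) ?nth_ord_enum // -cardE card_ord. Qed.

Lemma point_in (x : point n k) : point_seq x \in tups K L.
Proof.
rewrite mem_tups size_point eqxx; apply/(all_nthP 0) => -[_|i].
  by rewrite /= size_encode; case: (x.1) => /=; lia.
rewrite size_point ltnS => lti; rewrite (nth_point x (Ordinal lti)) /= size_encode.
by apply: leq_trans (ltn_ord _) _; nia.
Qed.

Lemma point_repeb (x : point n k) (i : 'I_k) (y : 'I_n) :
  set_nth 0 (point_seq x) i.+1 y = point_seq (x.1, repeb x.2 i y).
Proof.
apply: (@eq_from_nth _ 0).
  by rewrite size_set_nth !size_point; apply/maxn_idPr; rewrite ltnS.
rewrite size_set_nth size_point => j ltj; rewrite nth_set_nth /=.
case: j ltj => // j; rewrite eqSS => ltj.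
have {}ltj : j < k by move: ltj; rewrite (maxn_idPr _) // ltnS.
rewrite (nth_point x (Ordinal ltj)) (nth_point (_, _) (Ordinal ltj)) /= ffunE -val_eqE /=.
by case: eqP.
Qed.

Lemma cntW_point (R : seq nat -> bool) (r : seq nat) (x : point n k) (i : 'I_k) :
  cntW w R r (point_seq x) i.+1 =
  #|[pred y | ~~ R (r ++ point_seq (x.1, repeb x.2 i y))]|.
Proof.
rewrite /cntW (@eq_count _ _ (fun y => (y < n) &&
    ~~ R (r ++ set_nth 0 (point_seq x) i.+1 y))); last by move=> y; rewrite vert_encode.
rewrite count_ltn_and; last by rewrite size_encode; nia.
rewrite -val_enum_ord count_map -sum1_count -sum1_card big_enum_cond.
by apply: eq_bigl => y; rewrite !inE /= -point_repeb.
Qed.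

Lemma atomdiff_point (x y : point n k) :
  reflect (forall i j, (x.2 i == x.2 j) = (y.2 i == y.2 j) /\
     G x.1 (x.2 i) (x.2 j) = G y.1 (y.2 i) (y.2 j))
    (~~ atomdiff k w (point_seq x) (point_seq y)).
Proof.
have adjE (z : point n k) (i j : 'I_k) : adj w (nth 0 (point_seq z) 0) (nth 0 (point_seq z) i.+1)
    (nth 0 (point_seq z) j.+1) = G z.1 (z.2 i) (z.2 j).
  by rewrite !nth_point adj_encode; case: (z.1).
apply: (iffP (atomdiffP _ _ _ _)) => h.
  move=> i j; have [||] := h i.+1 j.+1; try by rewrite mem_iota /= ltnS ltn_ord.
  by rewrite !nth_point -!adjE !nth_point.
by move=> _ _ /mem_iota1 [i ->] /mem_iota1 [j ->]; rewrite !adjE !nth_point; apply: h.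
Qed.

Definition wl_equiv : rel (point n k) :=
  fun x y => ~~ stage (wl_step k) w (L ^ (K + K)) (point_seq x ++ point_seq y).

Lemma wl_pebble_equiv : pebble_equiv G wl_equiv.
Proof.
have rE : reflexive wl_equiv by move=> x; rewrite /wl_equiv stage_refl ?size_point.
have sE : symmetric wl_equiv by move=> x y; rewrite /wl_equiv stage_sym ?size_point.
have tE : transitive wl_equiv.
  by move=> y x z; rewrite /wl_equiv; apply: stage_trans; rewrite size_point.
have step x y : wl_equiv x y ->
    ~~ atomdiff k w (point_seq x) (point_seq y) /\
    forall i r, r \in tups K L -> cntW w (stage (wl_step k) w (L ^ (K + K))) r (point_seq x) i.+1
      = cntW w (stage (wl_step k) w (L ^ (K + K))) r (point_seq y) i.+1 \/ k <= i.
  rewrite /wl_equiv (stage_stable (k := k)); last by apply: tups_cat (point_in x) (point_in y).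
  rewrite stageS ?size_point // !negb_or => /and3P [_ ad /hasPn h]; split=> // i r rL.
  case: (ltnP i k) => lti; [left|by right].
  have ik : i.+1 \in iota 1 k by rewrite mem_iota.
  by have /hasPn/(_ r rL) := h _ ik; rewrite negbK => /eqP.
split=> // x y xy i.
- by move=> j; have [/atomdiff_point/(_ i j) []] := step x y xy.
- by move=> j; have [/atomdiff_point/(_ i j) []] := step x y xy.
- pose a v : point n k := (x.1, repeb x.2 i v); pose b v : point n k := (y.1, repeb y.2 i v).
  apply: (matching_of_counts (a := a) (b := b) rE sE tE) => z.
  have [_ /(_ i (point_seq z) (point_in z)) []] := step x y xy; last by rewrite leqNgt ltn_ord.
  by rewrite !cntW_point.
Qed.

(** By induction on the stage, a tuple and its image have the same relation to every third tuple;
    [f] itself matches the counts. *)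
Lemma wl_equiv_iso (f : 'I_n -> 'I_n) : bijective f ->
  (forall x y, G false x y = G true (f x) (f y)) ->
  forall u : {ffun 'I_k -> 'I_n}, wl_equiv (false, u) (true, [ffun i => f (u i)]).
Proof.
move=> bf fG u; rewrite /wl_equiv.
suff claim t (v : {ffun 'I_k -> 'I_n}) r : size r = K ->
    stage (wl_step k) w t (r ++ point_seq (false, v)) =
    stage (wl_step k) w t (r ++ point_seq (true, [ffun i => f (v i)])).
  by rewrite -claim ?size_point // stage_refl ?size_point.
move=> szr; elim: t v r szr => // t IH v r szr; rewrite !stageS // IH //.
congr [|| _, _ | _].
  suff e i j : i \in iota 1 k -> j \in iota 1 k ->
      let p := point_seq (false, v) in let q := point_seq (true, [ffun i => f (v i)]) in
      (nth 0 p i == nth 0 p j) = (nth 0 q i == nth 0 q j) /\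
      adj w (nth 0 p 0) (nth 0 p i) (nth 0 p j) = adj w (nth 0 q 0) (nth 0 q i) (nth 0 q j).
    by apply: negb_inj; apply/atomdiffP/atomdiffP => h i j ik jk; have [e1 e2] := e i j ik jk;
      have [-> ->] := h i j ik jk.
  move=> /mem_iota1 [a ->] /mem_iota1 [b ->] p q; rewrite !nth_point !ffunE.
  rewrite (adj_encode _ _ false) (adj_encode _ _ true) -fG; split=> //.
  by rewrite !(inj_eq val_inj) (inj_eq (bij_inj bf)).
apply: eq_in_has => _ /mem_iota1 [i ->]; apply: eq_in_has => s.
rewrite mem_tups => /andP [/eqP szs _]; congr (_ != _).
rewrite !cntW_point /=.
rewrite -[RHS](on_card_preimset (f := f)); last by have [g fK gK] := bf; exists g => y _.
rewrite -!sum1_card; apply: eq_bigl => y; rewrite !inE /= IH //.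
congr (~~ stage _ _ _ (_ ++ point_seq (_, _))); apply/ffunP => j; rewrite !ffunE.
by case: eqP.
Qed.

Lemma wl_acceptE :
  wl_accept k w (stage (wl_step k) w (L ^ (K + K))) =
  [forall u : {ffun 'I_k -> 'I_n}, exists v : {ffun 'I_k -> 'I_n},
    wl_equiv (false, u) (true, v)].
Proof.
rewrite /wl_accept size_test_encode eqxx /=.
have seqP (u : seq nat) : u \in tups k L -> all (vert w) u ->
    exists v : {ffun 'I_k -> 'I_n}, forall b, nat_of_bool b :: u = point_seq (b, v).
  rewrite mem_tups => /andP [/eqP szu _] /(all_nthP 0) vu.
  have ltu (i : 'I_k) : nth 0 u i < n by rewrite -(vert_encode (G false) (G true)) vu ?szu.
  exists [ffun i => Ordinal (ltu i)] => b; apply: (@eq_from_nth _ 0).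
    by rewrite size_point /= szu.
  case=> // i; rewrite /= szu ltnS => lti.
  by have := nth_point (b, [ffun i => Ordinal (ltu i)]) (Ordinal lti); rewrite /= ffunE => ->.
have pointP (v : {ffun 'I_k -> 'I_n}) : [seq nat_of_ord (v i) | i <- enum 'I_k] \in tups k L
    /\ all (vert w) [seq nat_of_ord (v i) | i <- enum 'I_k].
  have := point_in (false, v); rewrite !mem_tups /= eqSS => /and3P [-> _ ->]; split=> //.
  by rewrite all_map; apply/allP => i _ /=; rewrite vert_encode.
apply/negP/forallP => [acc u|acc /hasP [u uL /andP [vu /negP]]].
  apply: contraT => /existsPn nex; case: acc; apply/hasP.
  have [uL vu] := pointP u; exists [seq nat_of_ord (u i) | i <- enum 'I_k] => //.
  rewrite vu; apply/hasPn => v vL; apply/negP => /andP [vv].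
  have [v' ev'] := seqP v vL vv; have := nex v'; rewrite /wl_equiv -(ev' true) => /negbNE.
  by move=> e; rewrite [X in ~~ X]e.
apply; have [u' eu'] := seqP u uL vu; have /existsP [v uv] := acc u'.
have [vL vv] := pointP v; apply/hasP; exists [seq nat_of_ord (v i) | i <- enum 'I_k] => //.
by rewrite vv; move: uv; rewrite /wl_equiv -eu'.
Qed.

End Points.

Theorem wl_poly_time (k : nat) :
  exists (M : TM) (c d : nat), tm_accept M != tm_reject M /\
  forall (n m : nat) (G1 : rel 'I_n) (G2 : rel 'I_m),
    let w := encode_pair G1 G2 in
    exists b : bool,
    [/\ final_state M (c * size w ^ d + c) w = if b then tm_accept M else tm_reject M,
        isomorphic G1 G2 -> b &
        b -> exists (e : m = n) (E : rel (point n k)),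
          let G b := if b then (fun x y => G2 (cast_ord (esym e) x) (cast_ord (esym e) y))
                     else G1 in
          pebble_equiv G E /\ forall u, exists v, E (false, u) (true, v)].
Proof.
have [M [c [d [neq correct]]]] :=
  iteration_poly_time (@cpt_wl_step k) (@wl_step_ext k) (@cpt_wl_accept k).
exists M, c, d; split=> // n m G1 G2 w.
exists (wl_accept k w (stage (wl_step k) w (size w ^ (k.+1 + k.+1)))); split.
- apply: correct => R R' eR; apply: wl_accept_ext eR _.
  by rewrite size_encode; lia.
- case=> f [bf fG]; have e : n = m by have := bij_eq_card bf; rewrite !card_ord.
  subst m; rewrite {}/w.
  have := @wl_acceptE n k (fun b => if b then G2 else G1) => /= ->.
  apply/forallP => u; apply/existsP; exists [ffun i => f (u i)].
  exact: (@wl_equiv_iso n k (fun b => if b then G2 else G1)).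
- move=> acc; have e : m = n.
    by move: acc; rewrite /wl_accept size_test_encode => /andP [/eqP].
  exists e; subst m; exists (wl_equiv (k := k) (fun b => if b then G2 else G1)) => G.
  have eG b : G b =2 if b then G2 else G1.
    by rewrite /G; case: b => // x y; rewrite !cast_ord_id.
  have [rE sE tE eqE adjE mvE] := wl_pebble_equiv k (fun b => if b then G2 else G1).
  split; first by split=> // x y xy i j; rewrite !eG; apply: adjE.
  move: acc; have := @wl_acceptE n k (fun b => if b then G2 else G1) => /= -> /forallP acc u.
  by have /existsP := acc u.
Qed.

(** * From the pebble game to isomorphisms *)

Section Game.

Variables (n k N : nat) (G : bool -> rel 'I_n) (E : rel (point n k)) (d : 'I_n).
Hypotheses (gameE : pebble_equiv G E) (le_Nk : N + N <= k).

Local Notation V := 'I_n.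

Definition pad (a : seq V) : {ffun 'I_k -> V} := [ffun i : 'I_k => nth (head d a) a i].

(* Short pebbled tuples, on a given side; unused pebbles sit on the first vertex. *)
Definition Q (x y : bool * seq V) : bool :=
  [&& size x.2 == size y.2, 0 < size x.2, size x.2 <= N & E (x.1, pad x.2) (y.1, pad y.2)].

Lemma Q_refl (s : bool) (a : seq V) : 0 < size a -> size a <= N -> Q (s, a) (s, a).
Proof. by move=> a_gt0 leN; rewrite /Q eqxx a_gt0 leN (pebble_refl gameE). Qed.

Lemma Q_sym (x y : bool * seq V) : Q x y -> Q y x.
Proof.
by case/and4P => /eqP e gt0 le exy; rewrite /Q -e eqxx gt0 le (pebble_sym gameE).
Qed.

Lemma Q_trans (y x z : bool * seq V) : Q x y -> Q y z -> Q x z.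
Proof.
case/and4P => /eqP e1 gt0 le exy /and4P [/eqP e2 _ _ eyz].
by rewrite /Q e1 e2 eqxx -e2 -e1 gt0 le (pebble_trans gameE exy).
Qed.

Lemma Q_size (s t : bool) (a b : seq V) : Q (s, a) (t, b) -> size a = size b.
Proof. by case/and4P => /eqP. Qed.

Lemma pad_nth (a : seq V) (i : nat) (lti : i < k) : i < size a ->
  pad a (Ordinal lti) = nth d a i.
Proof. by move=> ltia; rewrite ffunE; apply: set_nth_default. Qed.

Lemma Q_atom (s t : bool) (a b : seq V) (i j : nat) : Q (s, a) (t, b) ->
  i < size a -> j < size a ->
  (nth d a i == nth d a j) = (nth d b i == nth d b j) /\
  G s (nth d a i) (nth d a j) = G t (nth d b i) (nth d b j).
Proof.
case/and4P => /eqP /= e gt0 le exy lti ltj.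
have ltik : i < k by lia.
have ltjk : j < k by lia.
have /= := pebble_eq gameE exy (Ordinal ltik) (Ordinal ltjk).
have /= := pebble_adj gameE exy (Ordinal ltik) (Ordinal ltjk).
by rewrite !pad_nth -?e.
Qed.

Lemma pad_rcons (a : seq V) (v : V) (lta : size a < k) : 0 < size a ->
  pad (rcons a v) = repeb (pad a) (Ordinal lta) v.
Proof.
case: a lta => // a0 a lta _; apply/ffunP => i; rewrite !ffunE nth_rcons.
rewrite -[i == _]/(nat_of_ord i == size (a0 :: a)) -[head _ _]/a0 -[head d (a0 :: a)]/a0.
by case: ltngtP => // lt; rewrite nth_default // ltnW.
Qed.

(** The answer to moving pebble [i] onto pebble [j] is forced, because the two pebbles must coincide
    on the other side as well. *)
Lemma E_copy (s t : bool) (u v : {ffun 'I_k -> V}) (i j : 'I_k) :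
  E (s, u) (t, v) -> E (s, repeb u i (u j)) (t, repeb v i (v j)).
Proof.
move=> uv; case: (i =P j) => [->|/eqP nij].
  have same (x : {ffun 'I_k -> V}) : repeb x j (x j) = x.
    by apply/ffunP => l; rewrite ffunE; case: eqP => [->|].
  by rewrite !same.
have [f _ /(_ (u j)) /= e] := pebble_move gameE uv i.
have /= := pebble_eq gameE e i j; rewrite !ffunE eqxx [j == i]eq_sym (negPf nij) eqxx.
by move/esym/eqP => <-.
Qed.

Lemma Q_ext (s t : bool) (a b : seq V) : Q (s, a) (t, b) -> size a < N ->
  exists2 f : V -> V, bijective f & forall v, Q (s, rcons a v) (t, rcons b (f v)).
Proof.
case/and4P => /eqP /= e gt0 _ exy ltN; have ltk : size a < k by lia.
have [f bf fE] := pebble_move gameE exy (Ordinal ltk); exists f => // v.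
rewrite /Q /= !size_rcons e eqxx /= -e ltN (pad_rcons _ ltk) //.
have ltk' : size b < k by rewrite -e.
by rewrite (pad_rcons _ ltk') -?e // (_ : Ordinal ltk' = Ordinal ltk) ?fE //; apply: val_inj.
Qed.

(** The entries of [x] are copied to the front one by one. As [a] is non-empty, each source lies to
    the right of its target and is still intact. *)
Lemma E_drop (s t : bool) (a b x y : seq V) :
  size a = size b -> size x = size y -> 0 < size a -> 0 < size x -> size a + size x <= k ->
  E (s, pad (a ++ x)) (t, pad (b ++ y)) -> E (s, pad x) (t, pad y).
Proof.
move=> eab exy a_gt0 x_gt0 lek; set u := pad (a ++ x); set v := pad (b ++ y) => uv.
pose src (i : nat) := if i < size x then size a + i else size a.
have src_lt i : src i < k by rewrite /src; case: ifP; lia.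
pose upto (m : nat) (z : {ffun 'I_k -> V}) : {ffun 'I_k -> V} :=
  [ffun i : 'I_k => if i < m then z (Ordinal (src_lt i)) else z i].
suff main m : m <= k -> E (s, upto m u) (t, upto m v).
  have fin (c z : seq V) : size c = size a -> size z = size x -> upto k (pad (c ++ z)) = pad z.
    move=> sc sz; apply/ffunP => i; rewrite !ffunE ltn_ord /= /src.
    case: ltnP => lei; rewrite nth_cat sc.
      by rewrite ltnNge leq_addr addKn; apply: set_nth_default; rewrite sz.
    rewrite ltnn subnn nth0 [RHS]nth_default ?sz //.
    by case: z sz => // e; rewrite -e in x_gt0.
  by have := main k (leqnn k); rewrite !fin.
elim: m => [|m IH] ltm.
  have up0 z : upto 0 z = z by apply/ffunP => i; rewrite ffunE.
  by rewrite !up0.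
(* Past the end of [x] its head is needed as padding; by then it stands at position 0. *)
pose rd := if m < size x then size a + m else 0.
have rd_lt : rd < k by rewrite /rd; case: ifP; lia.
have upS z : upto m.+1 z = repeb (upto m z) (Ordinal ltm) (upto m z (Ordinal rd_lt)).
  apply/ffunP => i; rewrite !ffunE -val_eqE /= ltnS leq_eqVlt.
  case: eqP => //= eim; case: (ltnP m (size x)) => lemx.
    have erd : rd = size a + m by rewrite /rd lemx.
    rewrite ifF; last by apply/negbTE; rewrite erd -leqNgt leq_addl.
    by congr (z _); apply: val_inj; rewrite /= /src eim lemx erd.
  have erd : rd = 0 by rewrite /rd ltnNge lemx.
  rewrite ifT; last by rewrite erd; apply: leq_trans lemx.
  by congr (z _); apply: val_inj; rewrite /= /src eim ltnNge lemx erd x_gt0 addn0.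
by rewrite !upS; apply: E_copy; apply: IH; apply: ltnW.
Qed.

Lemma Q_append (s t : bool) (a b : seq V) (idx : seq nat) : Q (s, a) (t, b) ->
  all (gtn (size a)) idx -> size a + size idx <= k ->
  E (s, pad (a ++ [seq nth d a i | i <- idx])) (t, pad (b ++ [seq nth d b i | i <- idx])).
Proof.
case/and4P => /eqP /= e gt0 le exy; elim/last_ind: idx => [|idx i IH]; first by rewrite !cats0.
rewrite all_rcons size_rcons => /andP [/= lti lts] lek.
have {}IH := IH lts (ltnW (leq_trans (_ : _ < _ ) lek)); rewrite addnS in lek IH.
have {}IH := IH (ltnSn _).
rewrite !map_rcons -!rcons_cat.
have szA : size (a ++ [seq nth d a i | i <- idx]) < k by rewrite size_cat size_map.
have szB : size (b ++ [seq nth d b i | i <- idx]) < k by rewrite size_cat size_map -e.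
rewrite (pad_rcons _ szA) ?(pad_rcons _ szB); rewrite ?size_cat -?e; try by lia.
have ltik : i < k by lia.
have nthp (c : seq V) : size c = size a ->
    nth d c i = pad (c ++ [seq nth d c i | i <- idx]) (Ordinal ltik).
  by move=> sc; rewrite pad_nth ?nth_cat ?size_cat sc ?lti //; lia.
rewrite (nthp a erefl) (nthp b (esym e)) (_ : Ordinal szB = Ordinal szA); last first.
  by apply: val_inj; rewrite /= !size_cat !size_map e.
exact: E_copy.
Qed.

(** The selection is appended first and the original dropped afterwards, which is why room for
    [N + N] pebbles is demanded. *)
Lemma Q_sub (s t : bool) (a b : seq V) (idx : seq nat) : Q (s, a) (t, b) ->
  all (gtn (size a)) idx -> 0 < size idx -> size idx <= N ->
  Q (s, [seq nth d a i | i <- idx]) (t, [seq nth d b i | i <- idx]).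
Proof.
move=> qab lts gt0 leN; have /and4P [/eqP /= e a_gt0 aN _] := qab.
rewrite /Q /= !size_map eqxx gt0 leN.
have := Q_append qab lts (leq_trans (leq_add aN leN) le_Nk).
by apply: E_drop; rewrite ?size_map //; lia.
Qed.

Lemma Q_tail (s t : bool) (a b x y : seq V) (idx : seq nat) :
  Q (s, a ++ x) (t, b ++ y) -> size a = size b -> 0 < size a ->
  all (gtn (size x)) idx -> size a + size idx <= N ->
  Q (s, a ++ [seq nth d x i | i <- idx]) (t, b ++ [seq nth d y i | i <- idx]).
Proof.
move=> qab eab gt0 lts leN; pose idx' := iota 0 (size a) ++ [seq size a + i | i <- idx].
have exy : size x = size y by have := Q_size qab; rewrite !size_cat eab => /addnI.
have eidx (c z : seq V) : size c = size a ->
    [seq nth d (c ++ z) i | i <- idx'] = c ++ [seq nth d z i | i <- idx].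
  move=> sc; rewrite map_cat -map_comp -sc; congr (_ ++ _).
    rewrite -[RHS](mkseq_nth d); apply/eq_in_map => i; rewrite mem_iota => /andP [_ lti].
    by rewrite nth_cat lti.
  by apply: eq_map => i /=; rewrite nth_cat ltnNge leq_addr addKn.
have := @Q_sub s t _ _ idx' qab; rewrite (eidx a) // (eidx b) //; apply.
- rewrite all_cat all_map; apply/andP; split; apply/allP => i.
    by rewrite mem_iota size_cat /=; lia.
  by move/(allP lts); rewrite /= size_cat ltn_add2l.
- by rewrite size_cat size_iota; lia.
- by rewrite size_cat size_iota size_map.
Qed.

End Game.

(** * Gluing embeddings of blocks *)

Section Gluing.

Variables (n k N : nat) (G : bool -> rel 'I_n) (E : rel (point n k)) (d : 'I_n).
Hypotheses (gameE : pebble_equiv G E) (le_Nk : N + N <= k).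

Local Notation V := 'I_n.
Local Notation Q := (Q N E d).

Lemma Q_grow (s t : bool) (a b x y : seq V) : Q (s, a ++ x) (t, b ++ y) ->
  size a + size x < N ->
  exists2 f : V -> V, bijective f & forall v, Q (s, a ++ rcons x v) (t, b ++ rcons y (f v)).
Proof.
move=> q lt; have [|f bf fQ] := Q_ext gameE le_Nk q; first by rewrite size_cat.
by exists f => // v; rewrite -!rcons_cat.
Qed.

Lemma Q_grow_inv (s t : bool) (a b x y : seq V) (w : V) : Q (s, a ++ x) (t, b ++ y) ->
  size a + size x < N -> exists v, Q (s, a ++ rcons x v) (t, b ++ rcons y w).
Proof.
move=> q lt; have [f [g fK gK] fQ] := Q_grow q lt.
by exists (g w); rewrite -{2}[w]gK.
Qed.

Lemma Q_grow1 (s t : bool) (a b : seq V) : Q (s, a) (t, b) -> size a < N ->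
  exists2 f : V -> V, bijective f & forall v, Q (s, a ++ [:: v]) (t, b ++ [:: f v]).
Proof.
move=> q lt; have [] := @Q_grow s t a b [::] [::]; rewrite ?cats0 ?addn0 //.
by move=> f bf fQ; exists f.
Qed.

Lemma Q_adj (s t : bool) (a b x y : seq V) (i j : nat) :
  Q (s, a ++ x) (t, b ++ y) -> size a = size b -> i < size x -> j < size x ->
  (nth d x i == nth d x j) = (nth d y i == nth d y j) /\
  G s (nth d x i) (nth d x j) = G t (nth d y i) (nth d y j).
Proof.
move=> q e lti ltj.
have := Q_atom gameE le_Nk q (i := size a + i) (j := size a + j).
by rewrite !size_cat !ltn_add2l => /(_ lti ltj); rewrite !nth_cat e !ltnNge !leq_addr /= !addKn.
Qed.

(* An embedding of the definable set [S] into the other side that preserves adjacency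
   and colours over the pebbles [a]. *)
Definition IdS (a : seq V) (S : pred V) : Prop :=
  forall t b, Q (false, a) (t, b) -> exists g : V -> V,
    [/\ forall v, S v -> Q (false, a ++ [:: v]) (t, b ++ [:: g v]),
        forall v v', S v -> S v' -> (g v == g v') = (v == v')
      & forall v v', S v -> S v' -> G false v v' = G t (g v) (g v')].

Section Glue.

Variables (a : seq V) (S : pred V) (B : rel V).
Hypotheses (a_gt0 : 0 < size a) (le_a : size a + 4 <= N).
Hypothesis S_inv : forall v v', S v -> Q (false, a ++ [:: v]) (false, a ++ [:: v']) -> S v'.
Hypotheses (B_refl : reflexive B) (B_sym : symmetric B) (B_trans : transitive B).
Hypothesis B_sub : forall v w, S v -> B v w -> S w.
Hypothesis B_inv : forall v w v' w', S v -> B v w ->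
  Q (false, a ++ [:: v; w]) (false, a ++ [:: v'; w']) -> B v' w'.
Hypothesis cross : forall v v' w w', S v -> S v' -> S w -> S w' -> ~~ B v v' -> ~~ B w w' ->
  Q (false, a ++ [:: v]) (false, a ++ [:: w]) ->
  Q (false, a ++ [:: v']) (false, a ++ [:: w']) -> G false v v' = G false w w'.
Hypothesis inner : forall v, S v -> IdS (a ++ [:: v]) (B v).

Let QS x y : Q x y -> Q y x. Proof. exact: (Q_sym gameE). Qed.

Let QT y x z : Q x y -> Q y z -> Q x z. Proof. exact: (Q_trans gameE). Qed.

Let tail (s t : bool) (b c x y : seq V) (idx : seq nat) :
  size b = size a -> size c = size a -> Q (s, b ++ x) (t, c ++ y) ->
  all (gtn (size x)) idx -> size idx <= 4 ->
  Q (s, b ++ [seq nth d x i | i <- idx]) (t, c ++ [seq nth d y i | i <- idx]).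
Proof.
move=> sb sc q lts le4; apply: (Q_tail gameE le_Nk q) => //; rewrite ?sb //.
by apply: leq_trans le_a; rewrite leq_add2l.
Qed.

Let lt_size (x : seq V) : size x < 4 -> size a + size x < N.
Proof. by move=> lt; apply: leq_trans le_a; rewrite ltn_add2l. Qed.

Let lt_aN : size a < N.
Proof. by rewrite -[size a]addn0; apply: leq_trans le_a; rewrite ltn_add2l. Qed.

Section Target.

Variables (t : bool) (b : seq V).
Hypothesis qab : Q (false, a) (t, b).

Let szb : size b = size a. Proof. by rewrite (Q_size qab). Qed.

(** [B] is given on the side [false] only. The last clause says that images of vertices of one block
    are related by the transported [B], with a witness [w] on the known side. *)
Definition good (T : {set V}) (g : V -> V) : Prop :=
  [/\ forall v, v \in T -> S v /\ Q (false, a ++ [:: v]) (t, b ++ [:: g v]),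
      forall v w, v \in T -> B v w -> w \in T,
      {in T &, injective g},
      forall v v', v \in T -> v' \in T -> G false v v' = G t (g v) (g v')
    & forall v v', v \in T -> v' \in T -> B v v' ->
        exists2 w, B v w & Q (false, a ++ [:: v; w]) (t, b ++ [:: g v; g v'])].

(** The bijection of the game maps the block of [x] onto all partners of [g x]. The image of the
    block under [g] lies in this set and has the same size. *)
Lemma block_onto (T : {set V}) (g : V -> V) (x y w : V) : good T g -> x \in T -> B x y ->
  Q (false, a ++ [:: x; y]) (t, b ++ [:: g x; w]) -> exists2 z, z \in T & g z = w.
Proof.
case=> gQ gT g_inj _ gB xT Bxy qw; have [Sx qx] := gQ x xT.
have lt1 : size a + size [:: x] < N by apply: lt_size.
have [f [f' fK f'K] fQ] := Q_grow qx lt1.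
have fB z z' w' : B x z -> Q (false, a ++ [:: x; z]) (t, b ++ [:: g x; w']) -> f z' = w' -> B x z'.
  move=> Bxz q e; apply: (B_inv Sx Bxz); apply: QT q _; apply: QS; rewrite -e.
  exact: fQ.
pose X := [set z | B x z].
have subX : g @: X \subset f @: X.
  apply/subsetP => _ /imsetP [z zX ->]; rewrite inE in zX.
  have [z' Bz' qz'] := gB x z xT (gT x z xT zX) zX.
  by apply/imsetP; exists (f' (g z)); rewrite ?inE ?f'K // (fB _ _ _ Bz' qz') ?f'K.
have cardX : #|f @: X| <= #|g @: X|.
  rewrite !card_in_imset //; last exact: (in2W (can_inj fK)).
  by move=> z z'; rewrite !inE => Bz Bz'; apply: g_inj; apply: gT xT _.
have eX : g @: X = f @: X by apply/eqP; rewrite eqEcard subX.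
have : w \in f @: X.
  by apply/imsetP; exists (f' w); rewrite ?inE ?f'K // (fB _ _ _ Bxy qw) ?f'K.
by rewrite -eX => /imsetP [z zX ->]; exists z => //; apply: gT xT _; rewrite inE in zX.
Qed.

Lemma good_extend (T : {set V}) (g : V -> V) (v : V) : good T g -> S v -> v \notin T ->
  exists g', good (T :|: [set u | B v u]) g'.
Proof.
move=> gTg Sv vT; have [gQ gT g_inj gG gB] := gTg.
have [f [f' fK f'K] fQ] := Q_grow1 qab lt_aN.
pose C := [set u | Q (false, a ++ [:: v]) (false, a ++ [:: u])].
have vC : v \in C by rewrite inE (Q_refl d gameE) // size_cat ?addn1.
(* The colour class of [v] and its counterpart have equal size, and [T] does not exhaust the former
   as [v] is outside; so the image misses a vertex of this colour. *)
have [w wT qw] : exists2 w, w \notin g @: T & Q (false, a ++ [:: v]) (t, b ++ [:: w]).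
  case: (pickP [pred u in C | f u \notin g @: T]) => [u /andP [uC uT]|none].
    by exists (f u) => //; rewrite inE in uC; apply: QT uC (fQ u).
  have sub : f @: C \subset g @: (T :&: C).
    apply/subsetP => _ /imsetP [u uC ->]; have := none u; rewrite inE uC /= => /negbFE.
    case/imsetP => x xT e; rewrite e; apply: imset_f; rewrite inE xT inE.
    have [_ qx] := gQ x xT; rewrite inE in uC; apply: QT uC _; apply: QT (fQ u) _.
    by rewrite e; apply: QS.
  have := subset_leq_card sub; rewrite card_imset; last exact: can_inj fK.
  move=> le; have := leq_trans le (leq_imset_card _ _); rewrite leqNgt => /negP [].
  apply: proper_card; apply/properP; split; first exact: subsetIr.
  by exists v => //; rewrite inE (negPf vT).
have [h [hQ h_inj hG]] := inner Sv qw.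
have hQ1 u : B v u -> Q (false, a ++ [:: v; u]) (t, b ++ [:: w; h u]).
  by move=> Bu; have := hQ u Bu; rewrite -!catA.
have hQ2 u : B v u -> Q (false, a ++ [:: u]) (t, b ++ [:: h u]).
  by move=> Bu; apply: (tail (idx := [:: 1]) erefl szb (hQ1 u Bu)).
(* A common value would put [w] into the transported block of [g x], which the image of [T] already
   contains entirely. *)
have disj u x : B v u -> x \in T -> h u != g x.
  move=> Bu xT; apply/eqP => e; have [Sx qx] := gQ x xT.
  have [|x2 qx2] := Q_grow_inv w qx; first exact: lt_size.
  have qv : Q (false, a ++ [:: u; v]) (t, b ++ [:: g x; w]).
    by rewrite -e; apply: (tail (idx := [:: 1; 0]) erefl szb (hQ1 u Bu)).
  have Bx2 : B x x2.
    apply: (@B_inv u v); [exact: B_sub Bu|by rewrite B_sym|].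
    by apply: QT qv _; apply: QS.
  have [z zT ez] := block_onto gTg xT Bx2 qx2.
  by case/negP: wT; rewrite -ez; apply: imset_f.
have closeT u x : B v u -> x \in T -> ~~ B u x /\ ~~ B x u.
  move=> Bu xT; have nBx : ~~ B x v by apply/negP => /(gT x v xT); rewrite (negPf vT).
  by split; apply: contra nBx => Bux; apply: B_trans (_ : B u v); rewrite 1?B_sym // B_sym.
(* The pair of images is pulled back to [u], [x'] on the known side, still in different blocks,
   where [cross] applies. *)
have crossQ u x : B v u -> x \in T ->
    G false u x = G t (h u) (g x) /\ G false x u = G t (g x) (h u).
  move=> Bu xT; have [Sx qx] := gQ x xT; have Su := B_sub Sv Bu.
  have [|x' qx'] := Q_grow_inv (g x) (hQ2 u Bu); first exact: lt_size.
  have qxx' : Q (false, a ++ [:: x]) (false, a ++ [:: x']).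
    by apply: QT qx _; apply: QS; apply: (tail (idx := [:: 1]) erefl szb qx').
  have Sx' := S_inv Sx qxx'.
  have nB : ~~ B u x'.
    apply/negP => Bux'; have [|u2 qu2] := Q_grow_inv (h u) qx; first exact: lt_size.
    have Bu2 : B x u2.
      apply: (@B_inv x' u) => //; first by rewrite B_sym.
      apply: QT _ (QS qu2); exact: (tail (idx := [:: 1; 0]) erefl szb qx').
    have [z zT ez] := block_onto gTg xT Bu2 qu2.
    by have := disj u z Bu zT; rewrite ez eqxx.
  have qu : Q (false, a ++ [:: u]) (false, a ++ [:: u]).
    by apply: (Q_refl d gameE); rewrite size_cat addn1.
  have [nB1 nB2] := closeT u x Bu xT.
  have esz : size a = size b by [].
  rewrite (cross Su Sx Su Sx' nB1 nB qu qxx') (cross Sx Su Sx' Su nB2 _ qxx' qu) 1?B_sym //.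
  have [_ /= ->] := Q_adj (i := 0) (j := 1) qx' esz isT isT.
  by have [_ /= ->] := Q_adj (i := 1) (j := 0) qx' esz isT isT.
pose g' u := if B v u then h u else g u.
have inT u : u \in T -> B v u = false.
  by move=> uT; apply/negbTE/negP => Bu; have [] := closeT u u Bu uT; rewrite B_refl.
exists g'; split.
- move=> u; rewrite !inE /g' => /orP [uT|Bu]; first by rewrite inT //; apply: gQ.
  by rewrite Bu; split; [exact: B_sub Bu|exact: hQ2].
- move=> u u'; rewrite !inE => /orP [uT|Bu] Bu'; first by rewrite (gT _ _ uT Bu').
  by rewrite (B_trans Bu Bu') orbT.
- move=> u u'; rewrite !inE /g' => /orP [uT|Bu] /orP [u'T|Bu'].
  + by rewrite !inT //; apply: g_inj.
  + by rewrite inT // Bu' => e; have := disj u' u Bu' uT; rewrite e eqxx.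
  + by rewrite Bu inT // => e; have := disj u u' Bu u'T; rewrite e eqxx.
  + by rewrite Bu Bu' => /eqP; rewrite h_inj // => /eqP.
- move=> u u'; rewrite !inE /g' => /orP [uT|Bu] /orP [u'T|Bu'].
  + by rewrite !inT //; apply: gG.
  + by rewrite inT // Bu'; have [] := crossQ u' u Bu' uT.
  + by rewrite Bu inT //; have [] := crossQ u u' Bu u'T.
  + by rewrite Bu Bu'; apply: hG.
- move=> u u'; rewrite !inE /g' => /orP [uT|Bu] /orP [u'T|Bu'] Buu'.
  + by rewrite !inT //; apply: gB.
  + by have [_] := closeT u' u Bu' uT; rewrite Buu'.
  + by have [] := closeT u u' Bu u'T; rewrite Buu'.
  + rewrite Bu Bu'; have [|x qx] := Q_grow_inv (h u') (hQ1 u Bu); first exact: lt_size.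
    exists x; last exact: (tail (idx := [:: 1; 2]) erefl szb qx).
    apply: B_trans (_ : B v x); first by rewrite B_sym.
    apply: (B_inv Sv Bu'); apply: QT (hQ1 _ Bu') _; apply: QS.
    exact: (tail (idx := [:: 0; 2]) erefl szb qx).
Qed.

Lemma good_total : exists g, good [set v | S v] g.
Proof.
suff main m (T : {set V}) g : good T g -> #|[set v | S v]| - #|T| <= m ->
    exists g, good [set v | S v] g.
  by apply: (main _ set0 id _ (leqnn _)); split=> // v; rewrite ?inE // => w; rewrite inE.
elim: m T g => [|m IH] T g gTg le.
  have [gQ _ _ _ _] := gTg; have sub : T \subset [set v | S v].
    by apply/subsetP => v /gQ []; rewrite inE.
  have -> : [set v | S v] = T.
    by apply/esym/eqP; rewrite eqEcard sub -subn_eq0 -leqn0.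
  by exists g.
have [gQ _ _ _ _] := gTg.
have sub : T \subset [set v | S v] by apply/subsetP => v /gQ []; rewrite inE.
case: (pickP [pred v | S v & v \notin T]) => [v /andP [Sv vT]|none].
  have [g' gg'] := good_extend gTg Sv vT; apply: IH gg' _.
  have lt : #|T| < #|T :|: [set u | B v u]|.
    apply: proper_card; apply/properP; split; first exact: subsetUl.
    by exists v; rewrite // !inE B_refl orbT.
  lia.
exists g; suff -> : [set v | S v] = T by [].
apply/eqP; rewrite eqEsubset sub andbT; apply/subsetP => v; rewrite inE => Sv.
by have := none v; rewrite /= Sv => /negbFE.
Qed.

End Target.

(** Blocks are mapped one at a time: edges inside a block come from [inner], edges between blocks
    depend on colours only. *)
Lemma glue : IdS a S.
Proof.
move=> t b qab; have [g [gQ _ g_inj gG _]] := good_total qab.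
exists g; split=> [v Sv|v v' Sv Sv'|v v' Sv Sv'].
- by have [|_] := gQ v; rewrite ?inE.
- by apply/eqP/eqP => [/g_inj -> //|-> //]; rewrite inE.
- by apply: gG; rewrite inE.
Qed.

End Glue.
End Gluing.

(** * Biregular relations whose neighbourhoods differ by at most one exchange *)

Section SwapFamilies.

Variable T : finType.

Definition nbin (r : rel T) (D : {set T}) (u : T) : {set T} := [set z in D | r u z].

Definition no_quad (r : rel T) (C D : {set T}) : Prop :=
  forall u u' z z', u \in C -> u' \in C -> z \in D -> z' \in D -> z != z' ->
  r u z -> r u z' -> ~~ r u' z -> ~~ r u' z' -> False.

Definition swap_regular (r : rel T) (C D : {set T}) : Prop :=
  [/\ forall u u', u \in C -> u' \in C -> #|nbin r D u| = #|nbin r D u'|,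
      forall z z', z \in D -> z' \in D ->
        #|nbin (fun z u => r u z) C z| = #|nbin (fun z u => r u z) C z'|,
      no_quad r C D & no_quad (fun z u => r u z) D C].

Lemma card_le1 (A : {set T}) :
  (forall z z', z \in A -> z' \in A -> z != z' -> False) -> #|A| <= 1.
Proof.
move=> h; rewrite leqNgt; apply/negP => /card_gt1P [z [z' [zA z'A /h]]].
by apply.
Qed.

(** If all neighbourhoods contained that of [x], then [y], and by equal degrees [y1], would be
    joined to all of [C]. Where two differ, absence of quads bounds each difference by one, and
    equal degrees make it an exchange. *)
Lemma swap_witness (r : rel T) (C D : {set T}) (x y x1 y1 : T) : swap_regular r C D ->
  x \in C -> y \in D -> x1 \in C -> y1 \in D -> r x y -> ~~ r x1 y1 ->
  exists x2 x3 p q, [/\ x2 \in C, x3 \in C, nbin r D x2 :\: nbin r D x3 = [set p]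
    & nbin r D x3 :\: nbin r D x2 = [set q]].
Proof.
case=> regC regD h1 h2 xC yD x1C y1D rxy nr.
have [x2 x2C [x3 x3C nsub]] : exists2 x2, x2 \in C & exists2 x3, x3 \in C &
    ~~ (nbin r D x2 \subset nbin r D x3).
  case: (pickP [pred u in C | ~~ (nbin r D x \subset nbin r D u)]) => [u /andP [uC]|none].
    by exists x => //; exists u.
  have full : nbin (fun z u => r u z) C y = C.
    apply/setP => u; rewrite inE; case: (boolP (u \in C)) => //= uC.
    have := none u; rewrite /= uC => /negbFE /subsetP /(_ y).
    by rewrite !inE yD rxy => /(_ isT).
  have : nbin (fun z u => r u z) C y1 = C.
    apply/eqP; rewrite eqEcard (regD _ y) // full leqnn andbT.
    by apply/subsetP => u; rewrite inE => /andP [].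
  by move/setP/(_ x1); rewrite inE x1C (negPf nr).
have le1 u u' : u \in C -> u' \in C -> #|nbin r D u :\: nbin r D u'| <= 1.
  move=> uC u'C; apply: card_le1 => z z'; rewrite !inE => /andP [+ /andP [zD rz]].
  rewrite zD /= => nz /andP [+ /andP [z'D rz']]; rewrite z'D /= => nz' neq.
  exact: (h1 u u' z z').
have eqD : #|nbin r D x2 :\: nbin r D x3| = #|nbin r D x3 :\: nbin r D x2|.
  by apply/eqP; rewrite -(eqn_add2l #|nbin r D x2 :&: nbin r D x3|) cardsID
    setIC cardsID (regC x2 x3).
have card1 : #|nbin r D x2 :\: nbin r D x3| = 1.
  by apply/eqP; rewrite eqn_leq le1 // lt0n cards_eq0 setD_eq0.
have /cards1P [p ep] : #|nbin r D x2 :\: nbin r D x3| == 1 by rewrite card1.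
have /cards1P [q eq] : #|nbin r D x3 :\: nbin r D x2| == 1 by rewrite -eqD card1.
by exists x2, x3, p, q.
Qed.

(** Neighbourhoods that differ by an exchange are disjoint singletons or meet in some [k]. In the
    latter case a vertex outside both would form a transposed quad with [k], so only [q] is missed
    by [x2]. *)
Lemma swap_half (r : rel T) (C D : {set T}) (x y x1 y1 : T) : swap_regular r C D ->
  x \in C -> y \in D -> x1 \in C -> y1 \in D -> r x y -> ~~ r x1 y1 ->
  (forall u, u \in C -> #|nbin r D u| = 1) \/ (forall u, u \in C -> #|nbin r D u|.+1 = #|D|).
Proof.
move=> sr xC yD x1C y1D rxy nr; have [regC _ _ h2] := sr.
have [x2 [x3 [p [q [x2C x3C ep eq]]]]] := swap_witness sr xC yD x1C y1D rxy nr.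
have neq : x3 != x2.
  by apply/eqP => e; move: ep; rewrite e setDv => /setP/(_ p); rewrite !inE eqxx.
case: (set_0Vmem (nbin r D x2 :&: nbin r D x3)) => [e0|[k]].
  left=> u uC; rewrite (regC u x2) // -(cardsID (nbin r D x3)) e0 cards0 ep.
  by rewrite cards1.
rewrite !inE => /andP [/andP [kD r2] /andP [_ r3]]; right=> u uC; rewrite (regC u x2) //.
have sub : nbin r D x2 \subset D by apply/subsetP => z; rewrite inE => /andP [].
have <- : #|nbin r D x2| + #|D :\: nbin r D x2| = #|D|.
  by rewrite -[RHS](cardsID (nbin r D x2)) (setIidPr sub).
rewrite (_ : D :\: nbin r D x2 = [set q]) ?cards1 ?addn1 // -eq.
apply/setP => z; rewrite !inE; case: (boolP (z \in D)) => //= zD.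
case: (boolP (r x2 z)) => //= n2; apply/esym/negPn/negP => n3.
exact: (h2 k z x3 x2).
Qed.

Lemma swap_transpose (r : rel T) (C D : {set T}) :
  swap_regular r C D -> swap_regular (fun z u => r u z) D C.
Proof. by case=> h1 h2 h3 h4; split. Qed.

(** Otherwise [p] and [q] miss one vertex of [C] each. A common neighbour contradicts degree one in
    [C]; disjoint neighbourhoods force [C] to have two elements, where missing one and seeing one
    coincide. *)
Lemma swap_mixed (r : rel T) (C D : {set T}) (x y x1 y1 : T) : swap_regular r C D ->
  x \in C -> y \in D -> x1 \in C -> y1 \in D -> r x y -> ~~ r x1 y1 ->
  (forall u, u \in C -> #|nbin r D u| = 1) ->
  forall z, z \in D -> #|nbin (fun z u => r u z) C z| = 1.
Proof.
move=> sr xC yD x1C y1D rxy nr d1; have [_ regD _ _] := sr.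
have [//|e1] := swap_half (swap_transpose sr) yD xC y1D x1C rxy nr.
have [x2 [x3 [p [q [x2C x3C ep eq]]]]] := swap_witness sr xC yD x1C y1D rxy nr.
have : p \in [set p] by rewrite inE.
rewrite -ep !inE => /andP [+ /andP [pD rp]]; rewrite pD /= => np.
have : q \in [set q] by rewrite inE.
rewrite -eq !inE => /andP [+ /andP [qD rq]]; rewrite qD /= => nq.
have neq : p != q by apply: contraNneq np => ->.
case: (set_0Vmem (nbin (fun z u => r u z) C p :&: nbin (fun z u => r u z) C q)) => [e0|[u]].
  have : #|nbin (fun z u => r u z) C p :|: nbin (fun z u => r u z) C q| <= #|C|.
    by apply: subset_leq_card; apply/subsetP => u; rewrite !inE; case: (u \in C).
  rewrite cardsU e0 cards0 subn0 -(e1 q qD) => le.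
  have gt0 : 0 < #|nbin (fun z u => r u z) C q|.
    by apply/card_gt0P; exists x3; rewrite inE x3C.
  by move=> z zD; rewrite (regD z p) //; move: le gt0; rewrite (regD q p) //; clear; lia.
rewrite !inE => /andP [/andP [uC rup] /andP [_ ruq]].
have : 1 < #|nbin r D u| by apply/card_gt1P; exists p, q; rewrite !inE pD qD rup ruq.
by rewrite d1.
Qed.

Lemma nbin_compl (r : rel T) (D : {set T}) (u : T) :
  #|nbin (fun u z => ~~ r u z) D u| + #|nbin r D u| = #|D|.
Proof.
rewrite -[RHS](cardsID (nbin r D u)) addnC; congr (_ + _); apply: eq_card => z; rewrite !inE;
  by case: (z \in D) => //=; case: (r u z).
Qed.

Lemma swap_compl (r : rel T) (C D : {set T}) :
  swap_regular r C D -> swap_regular (fun u z => ~~ r u z) C D.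
Proof.
case=> h1 h2 h3 h4; split.
- by move=> u u' uC u'C; apply/eqP; rewrite -(eqn_add2r #|nbin r D u|) nbin_compl (h1 u u')
    // nbin_compl.
- move=> z z' zD z'D; apply/eqP; rewrite -(eqn_add2r #|nbin (fun z u => r u z) C z|).
  by rewrite (nbin_compl (fun z u => r u z)) (h2 z z') // (nbin_compl (fun z u => r u z)).
- by move=> u u' z z' uC u'C zD z'D neq r1 r2 /negPn r3 /negPn r4; apply: (h3 u' u z z').
- by move=> z z' u u' zD z'D uC u'C neq r1 r2 /negPn r3 /negPn r4; apply: (h4 z' z u u').
Qed.

Lemma swap_matching (r : rel T) (C D : {set T}) (x y x1 y1 : T) : swap_regular r C D ->
  x \in C -> y \in D -> x1 \in C -> y1 \in D -> r x y -> ~~ r x1 y1 ->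
  (#|nbin r D x| = 1 /\ #|nbin (fun z u => r u z) C y| = 1) \/
  (#|nbin (fun u z => ~~ r u z) D x1| = 1 /\ #|nbin (fun z u => ~~ r u z) C y1| = 1).
Proof.
move=> sr xC yD x1C y1D rxy nr.
have [d1|e1] := swap_half sr xC yD x1C y1D rxy nr.
  by left; split; [apply: d1|apply: (swap_mixed sr xC yD x1C y1D rxy nr d1)].
have c1 u : u \in C -> #|nbin (fun u z => ~~ r u z) D u| = 1.
  by move=> uC; have := nbin_compl r D u; rewrite -(e1 u uC); clear; lia.
right; split; first exact: c1.
by apply: (swap_mixed (swap_compl sr) x1C y1D xC yD nr _ c1); rewrite ?negbK.
Qed.

End SwapFamilies.

(** * Interdefinable vertices and sets identified over the pebbles *)

Section Identify.

Variables (n k N : nat) (G : bool -> rel 'I_n) (E : rel (point n k)) (d : 'I_n).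
Hypotheses (gameE : pebble_equiv G E) (le_Nk : N + N <= k).

Local Notation V := 'I_n.
Local Notation Q := (Q N E d).
Local Notation IdS := (IdS N G E d).
Local Notation "v ~[ a ] w" := (Q (false, a ++ v) (false, a ++ w)) (at level 70).

Let QS x y : Q x y -> Q y x. Proof. exact: (Q_sym gameE). Qed.

Let QT y x z : Q x y -> Q y z -> Q x z. Proof. exact: (Q_trans gameE). Qed.

Let QR (a x : seq V) : 0 < size a -> size a + size x <= N -> x ~[a] x.
Proof. by move=> a_gt0 le; apply: (Q_refl d gameE); rewrite size_cat; lia. Qed.

Lemma Q_tail0 (a x y : seq V) (idx : seq nat) :
  x ~[a] y -> 0 < size a -> all (gtn (size x)) idx -> size a + size idx <= N ->
  [seq nth d x i | i <- idx] ~[a] [seq nth d y i | i <- idx].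
Proof. by move=> q gt0 lts le; apply: (Q_tail gameE le_Nk q). Qed.

Lemma card_inv (a x y : seq V) (P P' : pred V) : x ~[a] y -> size a + size x < N ->
  (forall u u', rcons x u ~[a] rcons y u' -> P u = P' u') -> #|P| = #|P'|.
Proof.
move=> q lt eP; have [f bf fQ] := Q_grow gameE le_Nk q lt.
rewrite -(card_image (bij_inj bf) P); apply: eq_card => u'.
have [g fK gK] := bf; apply/imageP/idP => [[u Pu ->]|Pu'].
  by move: Pu; rewrite unfold_in (eP _ _ (fQ u)).
by exists (g u'); rewrite ?gK // unfold_in (eP _ u') // -{2}[u']gK.
Qed.

Lemma IdS_sub (a : seq V) (S S' : pred V) : (forall v, S v -> S' v) -> IdS a S' -> IdS a S.
Proof.
move=> sub id t b q; have [g [gQ g_inj gG]] := id t b q.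
by exists g; split=> [v /sub /gQ //|v v' /sub Sv /sub Sv'|v v' /sub Sv /sub Sv'];
  [apply: g_inj|apply: gG].
Qed.

Lemma singleton_IdS (a : seq V) (v : V) : size a + 1 < N -> IdS (a ++ [:: v]) (pred1 v).
Proof.
set l := a ++ [:: v] => lt t b q; exists (fun=> nth d b (size a)).
have nthv : nth d l (size a) = v by rewrite nth_cat ltnn subnn.
have lts : size a < size l by rewrite size_cat addn1.
have {lt} ltl : size l < N by rewrite size_cat.
clearbody l; split=> [u /eqP ->|u u' /eqP -> /eqP ->|u u' /eqP -> /eqP ->]; rewrite ?eqxx //.
  have [f _ fQ] := Q_grow1 gameE le_Nk q ltl.
  have szs := Q_size q; have q1 := fQ v.
  have lt1 : size a < size (l ++ [:: v]) by rewrite size_cat ltn_addr.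
  have lt2 : size l < size (l ++ [:: v]) by rewrite size_cat addn1.
  have [+ _] := Q_atom gameE le_Nk q1 lt1 lt2.
  rewrite !nth_cat lts nthv ltnn subnn -szs lts ltnn subnn eqxx.
  by move/esym/eqP => ->.
by have [_] := Q_atom gameE le_Nk q lts lts; rewrite nthv.
Qed.

(** Gluing with one-vertex blocks. *)
Lemma eq_IdS (a : seq V) (S : pred V) : 0 < size a -> size a + 4 <= N ->
  (forall v v', S v -> [:: v] ~[a] [:: v'] -> S v') ->
  (forall v v' w w', S v -> S v' -> S w -> S w' -> v != v' -> w != w' ->
    [:: v] ~[a] [:: w] -> [:: v'] ~[a] [:: w'] -> G false v v' = G false w w') ->
  IdS a S.
Proof.
move=> a_gt0 le_a S_inv cross.
apply: (glue gameE le_Nk (B := eq_op) a_gt0 le_a S_inv) => //.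
- by move=> v w u /eqP ->.
- by move=> v w Sv /eqP <-.
- move=> v w v' w' _ /eqP <- q; have [+ _] := Q_adj gameE le_Nk (i := 0) (j := 1) q erefl isT isT.
  by rewrite /= eqxx.
- move=> v _; apply: (@IdS_sub _ _ (pred1 v)); first by move=> w /eqP ->; apply: eqxx.
  by apply: singleton_IdS; apply: leq_trans le_a; rewrite -addnS leq_add2l.
Qed.

(** A combinatorial definable closure: with [v] pebbled as well, [w] is alone in its colour. *)
Definition dcl (a : seq V) (v w : V) : bool :=
  [forall w', ([:: v; w] ~[a] [:: v; w']) ==> (w' == w)].

Definition interdef (a : seq V) : rel V := fun v w => dcl a v w && dcl a w v.

Lemma dclP (a : seq V) (v w w' : V) : dcl a v w -> [:: v; w] ~[a] [:: v; w'] -> w' = w.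
Proof. by move=> /forallP /(_ w') /implyP h /h /eqP. Qed.

Section Interdef.

Variable a : seq V.
Hypotheses (a_gt0 : 0 < size a) (le_a : size a + 5 <= N).

Let le_size (m : nat) : m <= 5 -> size a + m <= N.
Proof. by move=> le; apply: leq_trans le_a; rewrite leq_add2l. Qed.

Let lt_size (x : seq V) : size x < 5 -> size a + size x < N.
Proof. by move=> lt; apply: leq_trans le_a; rewrite ltn_add2l. Qed.

Lemma interdef_refl : reflexive (interdef a).
Proof.
move=> v; rewrite /interdef andbb; apply/forallP => w; apply/implyP => q.
have [+ _] := Q_adj gameE le_Nk (i := 0) (j := 1) q erefl isT isT.
by rewrite /= eqxx eq_sym => /esym.
Qed.

Lemma interdef_sym : symmetric (interdef a).
Proof. by move=> v w; rewrite /interdef andbC. Qed.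

Lemma dcl_trans : transitive (dcl a).
Proof.
move=> w v u dvw dwu; apply/forallP => u'; apply/implyP => q.
have [|w' q'] := Q_grow_inv gameE le_Nk w (QS q); first exact: lt_size.
have {}q' := QS q'.
have e : w' = w.
  apply: (dclP dvw); have := Q_tail0 (idx := [:: 0; 2]) q' a_gt0 isT.
  by apply; apply: le_size.
subst w'; apply/eqP; apply: (dclP dwu).
by have := Q_tail0 (idx := [:: 2; 1]) q' a_gt0 isT; apply; apply: le_size.
Qed.

Lemma interdef_trans : transitive (interdef a).
Proof.
move=> w v u /andP [d1 d2] /andP [d3 d4].
by rewrite /interdef (dcl_trans d1 d3) (dcl_trans d4 d2).
Qed.

Lemma dcl_inv (v w v' w' : V) : dcl a v w -> [:: v; w] ~[a] [:: v'; w'] -> dcl a v' w'.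
Proof.
move=> dvw q; apply/forallP => w2; apply/implyP => q2.
have [|x qx] := Q_grow_inv gameE le_Nk w2 q; first exact: lt_size.
have qvx : [:: v; x] ~[a] [:: v'; w2].
  by have := Q_tail0 (idx := [:: 0; 2]) qx a_gt0 isT; apply; apply: le_size.
have ex : x = w by apply: (dclP dvw); apply: QT (QT q q2) (QS qvx).
have [+ _] := Q_adj gameE le_Nk (i := 2) (j := 1) qx erefl isT isT.
by rewrite /= ex eqxx => /esym.
Qed.

Lemma interdef_inv (v w v' w' : V) :
  interdef a v w -> [:: v; w] ~[a] [:: v'; w'] -> interdef a v' w'.
Proof.
case/andP => d1 d2 q; rewrite /interdef (dcl_inv d1 q) (dcl_inv d2) //.
by have := Q_tail0 (idx := [:: 1; 0]) q a_gt0 isT; apply; apply: le_size.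
Qed.

(** Pebbling [v] fixes every member of its class, so colours alone determine the embedding. *)
Lemma interdef_IdS (v : V) : IdS (a ++ [:: v]) (interdef a v).
Proof.
have uniqw w w' : interdef a v w -> [:: w] ~[a ++ [:: v]] [:: w'] -> w' = w.
  by case/andP => dvw _; rewrite -!catA => /(dclP dvw).
apply: eq_IdS; rewrite ?size_cat /=; try by lia.
  by move=> w w' dvw /(uniqw _ _ dvw) ->.
move=> w w' u u' dw dw' _ _ _ _ q q'.
by rewrite (uniqw _ _ dw q) (uniqw _ _ dw' q').
Qed.

(** The game preserves colours and adjacency, so the only neighbour of [v] within a colour, or the
    only non-neighbour for [b = true], cannot be confused with another vertex. *)
Lemma dcl_of_card1 (v w : V) (r : rel V) : symmetric (G false) ->
  (forall b, r = (fun u z => G false u z (+) b) -> r v w ->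
    #|nbin r [set z | [:: w] ~[a] [:: z]] v| = 1 -> dcl a v w).
Proof.
move=> G_sym b er rvw /eqP/cards1P [z ez]; apply/forallP => w'; apply/implyP => q.
have inz u : r v u -> [:: w] ~[a] [:: u] -> u = z.
  by move=> ru qu; apply/set1P; rewrite -ez !inE qu ru.
have q1 : [:: w] ~[a] [:: w'].
  by have := Q_tail0 (idx := [:: 1]) q a_gt0 isT; apply; apply: le_size.
have rvw' : r v w'.
  rewrite er; have [_ /= <-] := Q_adj gameE le_Nk (i := 0) (j := 1) q erefl isT isT.
  by move: rvw; rewrite er.
rewrite (inz w' rvw' q1) (inz w rvw) //.
by apply: QR => //; apply: le_size.
Qed.

Hypotheses (G_sym : symmetric (G false)).
Variable S : pred V.
Hypothesis S_inv : forall v v', S v -> [:: v] ~[a] [:: v'] -> S v'.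
Hypothesis noquad : forall x x' y y', S x -> S x' -> S y -> S y' ->
  [:: x] ~[a] [:: x'] -> [:: y] ~[a] [:: y'] -> y != y' ->
  G false x y -> G false x y' -> ~~ G false x' y -> ~~ G false x' y' -> False.

(** Between the colour classes of [x] and [y] adjacency is biregular without quads. If not constant,
    it is a matching, and then [x], [y] are interdefinable, or the complement of one, and then [x1],
    [y1] are. *)
Lemma interdef_cross (x y x1 y1 : V) : S x -> S y ->
  ~~ interdef a x y -> ~~ interdef a x1 y1 ->
  [:: x] ~[a] [:: x1] -> [:: y] ~[a] [:: y1] -> G false x y -> G false x1 y1.
Proof.
move=> Sx Sy ni ni1 qx qy Gxy; apply/negPn/negP => nG.
pose C := [set u | [:: x] ~[a] [:: u]]; pose D := [set u | [:: y] ~[a] [:: u]].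
have lt1 : size a + 1 < N by apply: (lt_size (x := [:: x])).
have CS u : u \in C -> S u by rewrite inE => /(S_inv Sx).
have DS u : u \in D -> S u by rewrite inE => /(S_inv Sy).
have CC u u' : u \in C -> u' \in C -> [:: u] ~[a] [:: u'].
  by rewrite !inE => q q'; apply: QT (QS q) q'.
have DD u u' : u \in D -> u' \in D -> [:: u] ~[a] [:: u'].
  by rewrite !inE => q q'; apply: QT (QS q) q'.
have deg z0 u u' : [:: u] ~[a] [:: u'] ->
    #|nbin (G false) [set z | [:: z0] ~[a] [:: z]] u| =
    #|nbin (G false) [set z | [:: z0] ~[a] [:: z]] u'|.
  move=> q; apply: (card_inv q) => // w w' q'.
  rewrite -[LHS]/(w \in nbin _ _ _) -[RHS]/(w' \in nbin _ _ _) !inE.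
  have [_ /= ->] := Q_adj gameE le_Nk (i := 0) (j := 1) q' erefl isT isT.
  have qw : [:: w] ~[a] [:: w'].
    by have := Q_tail0 (idx := [:: 1]) q' a_gt0 isT; apply; apply: le_size.
  by congr (_ && _); apply/idP/idP => qz; [apply: QT qz qw|apply: QT qz (QS qw)].
have eqT (A : {set V}) z : nbin (fun z u => G false u z) A z = nbin (G false) A z.
  by apply/setP => u; rewrite !inE G_sym.
have eqTc (A : {set V}) z :
    nbin (fun z u => ~~ G false u z) A z = nbin (fun u z => G false u z (+) true) A z.
  by apply/setP => u; rewrite !inE G_sym addbT.
have eqc (A : {set V}) z :
    nbin (fun u z => ~~ G false u z) A z = nbin (fun u z => G false u z (+) true) A z.
  by apply/setP => u; rewrite !inE addbT.
have eqf (A : {set V}) z : nbin (G false) A z = nbin (fun u z => G false u z (+) false) A z.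
  by apply/setP => u; rewrite !inE addbF.
have sr : swap_regular (G false) C D.
  split=> [u u' uC u'C|z z' zD z'D|u u' z z' uC u'C zD z'D|z z' u u' zD z'D uC u'C].
  - by apply: deg; apply: CC.
  - by rewrite !eqT; apply: deg; apply: DD.
  - exact: (noquad (CS _ uC) (CS _ u'C) (DS _ zD) (DS _ z'D) (CC _ _ uC u'C) (DD _ _ zD z'D)).
  - rewrite ![G false _ z]G_sym ![G false _ z']G_sym.
    exact: (noquad (DS _ zD) (DS _ z'D) (CS _ uC) (CS _ u'C) (DD _ _ zD z'D) (CC _ _ uC u'C)).
have xC : x \in C by rewrite inE QR // le_size.
have yD : y \in D by rewrite inE QR // le_size.
have x1C : x1 \in C by rewrite inE.
have y1D : y1 \in D by rewrite inE.
have eD : [set z | [:: y1] ~[a] [:: z]] = D.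
  by apply/setP => z; rewrite !inE; apply/idP/idP => q; [apply: QT qy q|apply: QT (QS qy) q].
have eC : [set z | [:: x1] ~[a] [:: z]] = C.
  by apply/setP => z; rewrite !inE; apply/idP/idP => q; [apply: QT qx q|apply: QT (QS qx) q].
have [[c1 c2]|[c1 c2]] := swap_matching sr xC yD x1C y1D Gxy nG.
  case/negP: ni; rewrite /interdef; apply/andP; split.
    by apply: (dcl_of_card1 G_sym (b := false) erefl); rewrite ?addbF // -eqf.
  by apply: (dcl_of_card1 G_sym (b := false) erefl); rewrite ?addbF 1?G_sym // -eqf -eqT.
case/negP: ni1; rewrite /interdef; apply/andP; split.
  by apply: (dcl_of_card1 G_sym (b := true) erefl); rewrite ?addbT // -eqc eD.
by apply: (dcl_of_card1 G_sym (b := true) erefl); rewrite ?addbT 1?G_sym // -eqTc eC.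
Qed.

(** Gluing along classes of interdefinable vertices: different classes see each other by colour
    alone, and inside a class one pebble fixes everything. *)
Lemma quad_IdS : IdS a S.
Proof.
pose B v w := (v == w) || [&& S v, S w & interdef a v w].
have Bi v w : B v w -> interdef a v w.
  by case/orP => [/eqP ->|/and3P [] //]; apply: interdef_refl.
have nBi v w : S v -> S w -> ~~ B v w -> ~~ interdef a v w.
  by move=> Sv Sw; rewrite /B Sv Sw negb_or => /andP [].
apply: (glue gameE le_Nk (B := B) a_gt0 _ S_inv); first exact: le_size.
- by move=> v; rewrite /B eqxx.
- by move=> v w; rewrite /B eq_sym interdef_sym; congr (_ || _); case: (S v); rewrite ?andbF.
- move=> w v u /orP [/eqP -> //|/and3P [Sv Sw ivw]] /orP [/eqP <-|/and3P [_ Su iwu]].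
    by rewrite /B Sv Sw ivw orbT.
  by rewrite /B Sv Su (interdef_trans ivw iwu) orbT.
- by move=> v w Sv /orP [/eqP <-|/and3P []].
- move=> v w v' w' Sv Bvw q; have Sw : S w by case/orP: Bvw => [/eqP <-|/and3P []].
  have q0 : [:: v] ~[a] [:: v'].
    by have := Q_tail0 (idx := [:: 0]) q a_gt0 isT; apply; apply: le_size.
  have q1 : [:: w] ~[a] [:: w'].
    by have := Q_tail0 (idx := [:: 1]) q a_gt0 isT; apply; apply: le_size.
  by rewrite /B (S_inv Sv q0) (S_inv Sw q1) (interdef_inv (Bi _ _ Bvw) q) orbT.
- move=> v v' w w' Sv Sv' Sw Sw' nB nB' q q'; apply/idP/idP.
    by apply: interdef_cross => //; apply: nBi.
  by apply: interdef_cross => //; rewrite ?nBi //; apply: QS.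
- by move=> v _; apply: (@IdS_sub _ _ (interdef a v)) => [w /Bi //|]; apply: interdef_IdS.
Qed.

End Interdef.

Lemma iso_of_IdS (a : seq V) :
  (forall u, exists v, E (false, u) (true, v)) -> 0 < size a -> size a + 1 <= N ->
  IdS a predT -> exists2 f : V -> V, bijective f &
    forall x y, G false x y = G true (f x) (f y).
Proof.
move=> acc a_gt0 le_a id; have [v av] := acc (pad k d a).
pose b := [seq (if insub i is Some j then v j else d) | i <- iota 0 (size a)].
have szb : size b = size a by rewrite size_map size_iota.
have nthb (j : 'I_k) : j < size a -> nth d b j = v j.
  by move=> ltj; rewrite (nth_map 0) ?size_iota // nth_iota // add0n valK.
have k_gt0 : 0 < k by lia.
(* Pebbles beyond [size a] sit on the first vertex of [a], and equality of pebbles transfers this to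
   [v]. *)
have padb : pad k d b = v.
  apply/ffunP => j; rewrite ffunE; case: (ltnP j (size a)) => ltj.
    by rewrite -nthb //; apply: set_nth_default; rewrite szb.
  rewrite nth_default ?szb // -nth0 (nthb (Ordinal k_gt0)) //; apply/eqP.
  rewrite -(pebble_eq gameE av) /= !ffunE nth0 (nth_default _ ltj).
  by case: (a) a_gt0 => //= ?; rewrite eqxx.
have q : Q (false, a) (true, b).
  by apply/and4P; split; rewrite /= ?szb ?padb //; lia.
have [g [_ g_inj gG]] := id true b q; exists g; last by move=> x y; apply: gG.
by apply: injF_bij => x y /eqP; rewrite g_inj // => /eqP.
Qed.

End Identify.

(** * The structure of the graphs *)

Section Graphs.

Variables (V : finType) (G : rel V).

Definition pe (a : seq V) (v v' : V) : bool :=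
  all (fun c => ((c == v) == (c == v')) && (G c v == G c v')) a.

(** All that the structural part needs of colours: they refine the view from the pebbles, and
    degrees into unions of classes are constant on classes. *)
Record equitable (a : seq V) (e : rel V) : Prop := Equitable {
  equitable_refl : reflexive e;
  equitable_sym : symmetric e;
  equitable_trans : transitive e;
  equitable_pe : forall v v', e v v' -> pe a v v';
  equitable_deg : forall (X : {set V}) v v', (forall u u', u \in X -> e u u' -> u' \in X) ->
    e v v' -> #|[set u in X | G v u]| = #|[set u in X | G v' u]| }.

Definition noquad (e : rel V) (S : pred V) : Prop :=
  forall x x' y y', S x -> S x' -> S y -> S y' -> e x x' -> e y y' -> y != y' ->
  G x y -> G x y' -> ~~ G x' y -> ~~ G x' y' -> False.

(* Configurations forced by a violation of [noquad] in an equitable partition. *)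
Definition fullquad (e : rel V) (x x' y y' z z' : V) : Prop :=
  [/\ [/\ e x x', e y y', e y z & e y z'], [/\ y != y' & z != z'],
      [/\ G x y, G x y', ~~ G x z & ~~ G x z'] &
      [/\ G x' z, G x' z', ~~ G x' y & ~~ G x' y']].

Definition rigid (a : seq V) : Prop := forall e, equitable a e -> noquad e predT.

Lemma peP (a : seq V) (v v' c : V) : pe a v v' -> c \in a ->
  (c == v) = (c == v') /\ G c v = G c v'.
Proof. by move=> /allP p /p /andP [/eqP -> /eqP ->]. Qed.

Lemma pe_pebble (a : seq V) (v v' : V) : pe a v v' -> v \in a -> v' = v.
Proof. by move=> p /(peP p) [+ _]; rewrite eqxx => /esym/eqP. Qed.

Lemma pe_sub (a b : seq V) (v v' : V) : {subset a <= b} -> pe b v v' -> pe a v v'.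
Proof. by move=> sub /allP p; apply/allP => c /sub /p. Qed.

(** [x] and [x'] have equally many neighbours in the class of [y], so what [x] has in excess of [x']
    is compensated. *)
Lemma fullquad_of_quad (a : seq V) (e : rel V) (x x' y y' : V) : equitable a e ->
  e x x' -> e y y' -> y != y' -> G x y -> G x y' -> ~~ G x' y -> ~~ G x' y' ->
  exists z z', fullquad e x x' y y' z z'.
Proof.
move=> eqe exx' eyy' neq g1 g2 g3 g4.
pose X := [set u | e y u].
have closedX u u' : u \in X -> e u u' -> u' \in X.
  by rewrite !inE => yu uu'; apply: (equitable_trans eqe) uu'.
pose A := [set u in X | G x u]; pose A' := [set u in X | G x' u].
have eA : #|A| = #|A'| := equitable_deg eqe closedX exx'.
have eD : #|A :\: A'| = #|A' :\: A|.
  by apply/eqP; rewrite -(eqn_add2l #|A :&: A'|) cardsID setIC cardsID eA.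
have : 1 < #|A' :\: A|.
  rewrite -eD; apply/card_gt1P; exists y, y'.
  by rewrite !inE (equitable_refl eqe) eyy' g1 g2 (negPf g3) (negPf g4).
case/card_gt1P => z [z' []]; rewrite !inE => /andP [+ /andP [yz gz]].
rewrite yz /= => ngz /andP [+ /andP [yz' gz']]; rewrite yz' /= => ngz' nz.
by exists z, z'.
Qed.

Hypotheses (G_sym : symmetric G) (G_irr : irreflexive G).

Ltac adj := solve [assumption | rewrite G_sym; assumption].

(* No induced [P2 + P3], with edges [p q], [x y], [y z]. *)
Hypothesis noF2 : forall p q x y z : V, G p q -> G x y -> G y z -> x != z -> ~~ G x z ->
  ~~ G p x -> ~~ G p y -> ~~ G p z -> ~~ G q x -> ~~ G q y -> ~~ G q z -> False.

(* No induced complement of [2P1 + P3]: adjacent [a], [b], both complete to the induced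
   [P1 + P2] on [c], [e f]. *)
Hypothesis noF1 : forall a b c e f : V, G a b -> G a c -> G a e -> G a f ->
  G b c -> G b e -> G b f -> G e f -> ~~ G c e -> ~~ G c f -> False.

Lemma adj_neq (x y : V) : G x y -> x != y.
Proof. by apply: contraTneq => ->; rewrite G_irr. Qed.

Lemma adj_sep (x y z : V) : G x y -> ~~ G x z -> y != z.
Proof. by move=> gxy; apply: contraNneq => <-. Qed.

(** Clusters are disjoint unions of cliques, coclusters are complete multipartite graphs with the
    classes of non-adjacency as parts. *)
Definition cluster (X : pred V) : Prop :=
  forall x y z, X x -> X y -> X z -> G x y -> G y z -> x != z -> G x z.

Definition cocluster (X : pred V) : Prop :=
  forall x y z, X x -> X y -> X z -> ~~ G x y -> ~~ G y z -> ~~ G x z.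

Lemma common_nbrs_cocluster (u v : V) : G u v -> cocluster (fun x => G u x && G v x).
Proof.
move=> guv x y z /andP [ux vx] /andP [uy vy] /andP [uz vz] nxy nyz; apply/negP => gxz.
by apply: (noF1 guv uy ux uz vy vx vz gxz) => //; adj.
Qed.

Lemma common_non_nbrs_cluster (u v : V) : G u v -> cluster (fun x => ~~ G u x && ~~ G v x).
Proof.
move=> guv x y z /andP [ux vx] /andP [uy vy] /andP [uz vz] gxy gyz neq.
by apply/negPn/negP => ngxz; apply: (noF2 guv gxy gyz neq ngxz).
Qed.

Definition resolves (a : seq V) (X : pred V) : Prop :=
  forall v v', X v -> X v' -> pe a v v' -> ~~ G v v'.

(** When classes are independent, the completed quad contains P2 + P3: the edge [x' z] and the path
    [y x y']. *)
Lemma resolves_noquad (a : seq V) (e : rel V) (S : pred V) : equitable a e ->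
  (forall v v', S v -> e v v' -> S v') -> resolves a S -> noquad e S.
Proof.
move=> eqe closedS res x x' y y' Sx Sx' Sy Sy' exx' eyy' neq g1 g2 g3 g4.
have [z [z' [[_ _ ez _] [_ _] [_ _ g5 _] [g6 _ _ _]]]] :=
  fullquad_of_quad eqe exx' eyy' neq g1 g2 g3 g4.
have nadj v v' : S v -> e v v' -> ~~ G v v'.
  by move=> Sv ev; apply: res (equitable_pe eqe ev) => //; apply: closedS ev.
have ezy' : e z y' by apply: (equitable_trans eqe) eyy'; rewrite (equitable_sym eqe).
have Sz : S z by apply: closedS ez.
apply: (@noF2 x' z y x y' g6 _ g2 neq) => //; try adj; try exact: nadj.
- by rewrite G_sym nadj.
- by rewrite G_sym nadj.
Qed.

Lemma resolves_rigid (a : seq V) : resolves a predT -> rigid a.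
Proof. by move=> res e eqe; apply: resolves_noquad eqe _ res. Qed.

(** ** Three independent edges *)

Definition indep_edges (P R : 'I_3 -> V) : Prop :=
  (forall i, G (P i) (R i)) /\
  forall i j, i != j -> [/\ ~~ G (P i) (P j), ~~ G (P i) (R j) & ~~ G (R i) (R j)].

Definition miss (P R : 'I_3 -> V) (v : V) (i : 'I_3) : bool := ~~ G v (P i) && ~~ G v (R i).

Definition hits_all (P R : 'I_3 -> V) (v : V) : bool := [forall i, ~~ miss P R v i].

Lemma third_index (i j : 'I_3) : exists l : 'I_3, l != i /\ l != j.
Proof.
have : 0 < #|~: [set i; j]|.
  by have := cardsC [set i; j]; rewrite cards2 card_ord; case: (i != j); lia.
by case/card_gt0P => l; rewrite !inE negb_or => /andP [? ?]; exists l.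
Qed.

Section IndependentEdges.

Variables P R : 'I_3 -> V.
Hypothesis ie : indep_edges P R.

Local Notation missed := (miss P R).
Local Notation W := (hits_all P R).

Definition on_edge (i : 'I_3) (g : V) : Prop := g = P i \/ g = R i.

Lemma hitP (v : V) (i : 'I_3) : ~~ missed v i -> exists2 g, on_edge i g & G v g.
Proof.
rewrite negb_and !negbK => /orP [h|h]; [exists (P i)|exists (R i)] => //; [by left|by right].
Qed.

Lemma miss_on (v g : V) (i : 'I_3) : missed v i -> on_edge i g -> ~~ G v g.
Proof. by case/andP => m1 m2 [] ->. Qed.

Lemma on_edge_sep (i j : 'I_3) (g h : V) : on_edge i g -> on_edge j h -> i != j -> ~~ G g h.
Proof.
move=> gi hj neq; have [n1 n2 n3] := ie.2 i j neq.
have neq' : j != i by rewrite eq_sym.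
have [_ n2' _] := ie.2 j i neq'.
by case: gi hj => -> [] -> //; rewrite G_sym.
Qed.

Lemma on_edge_hits (i : 'I_3) (g : V) : on_edge i g -> ~~ missed g i.
Proof.
by rewrite /miss; case=> ->; rewrite negb_and !negbK ?(ie.1 i) ?orbT // G_sym (ie.1 i).
Qed.

Lemma on_edge_neq (i j : 'I_3) (g h : V) : on_edge i g -> on_edge j h -> i != j -> g != h.
Proof.
move=> gi hj neq; apply/eqP => e; rewrite {}e in gi.
have [k ki gk] := hitP (on_edge_hits gi).
by have := on_edge_sep hj ki; rewrite eq_sym neq gk => /(_ isT).
Qed.

Lemma on_edge_miss (i j : 'I_3) (g : V) : on_edge i g -> i != j -> missed g j.
Proof.
by move=> gi neq; rewrite /miss !(on_edge_sep gi _ neq) //; [right|left].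
Qed.

(** A vertex missing one edge and hitting two others is the centre of a P3 apart from the missed
    edge. *)
Lemma notW (v : V) : ~~ W v -> exists i, forall j, j != i -> missed v j.
Proof.
move=> /forallPn [i0 /negPn m0].
case: (pickP (fun j => ~~ missed v j)) => [j nj|none]; last first.
  by exists i0 => j _; have := none j => /negbFE.
exists j => l nlj; apply/negPn/negP => nl.
have [g gj vg] := hitP nj; have [h hl vh] := hitP nl.
have neq : j != i0 by apply: contraNneq nj => ->.
have neq' : l != i0 by apply: contraNneq nl => ->.
have njl : j != l by rewrite eq_sym.
have e0 k (b : V) : on_edge k b -> k != i0 -> ~~ G (P i0) b /\ ~~ G (R i0) b.
  move=> bk nk; rewrite ![G _ b]G_sym.
  by rewrite !(on_edge_sep bk _ nk) //; [right|left].
have [a1 a2] := e0 _ _ gj neq; have [a3 a4] := e0 _ _ hl neq'.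
have [b1 b2] : ~~ G (P i0) v /\ ~~ G (R i0) v by rewrite ![G _ v]G_sym; apply/andP.
apply: (@noF2 (P i0) (R i0) g v h (ie.1 i0)) => //; first by rewrite G_sym.
  exact: on_edge_neq gj hl njl.
exact: on_edge_sep gj hl njl.
Qed.

Lemma edge_missed (x y z : V) (i : 'I_3) : missed x i -> missed y i -> missed z i ->
  G x y -> G y z -> x != z -> G x z.
Proof.
move=> /andP [x1 x2] /andP [y1 y2] /andP [z1 z2] gxy gyz neq; apply/negPn/negP => n.
by apply: (noF2 (ie.1 i) gxy gyz neq n); adj.
Qed.

(** A path whose vertices all miss one edge is closed. Such an edge is lacking only if [x], [y], [z]
    hit different edges [i], [j], [l]; then the path [g x y], with [g] on edge [i], misses edge [l]
    and would make [g] adjacent to [y]. *)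
Lemma U_cluster : cluster (fun v => ~~ W v).
Proof.
move=> x y z /notW [i ix] /notW [j jy] /notW [l lz] gxy gyz neq.
apply/negPn/negP => n.
have nomiss k : missed x k -> missed y k -> missed z k -> False.
  by move=> m1 m2 m3; have := edge_missed m1 m2 m3 gxy gyz neq; rewrite (negPf n).
case: (i =P j) => [eij|/eqP nij].
  by have [k [k1 k2]] := third_index i l; apply: (nomiss k); [apply: ix|apply: jy; rewrite -eij|apply: lz].
case: (i =P l) => [eil|/eqP nil].
  by have [k [k1 k2]] := third_index i j; apply: (nomiss k); [apply: ix|apply: jy|apply: lz; rewrite -eil].
case: (j =P l) => [ejl|/eqP njl].
  by have [k [k1 k2]] := third_index i j; apply: (nomiss k); [apply: ix|apply: jy|apply: lz; rewrite -ejl].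
have yi := jy i nij; have zi := lz i nil.
have hx : ~~ missed x i by apply/negP => xi; apply: (nomiss i).
have [g gi xg] := hitP hx.
have xl : missed x l by apply: ix; rewrite eq_sym.
have yl : missed y l by apply: jy; rewrite eq_sym.
have gl := on_edge_miss gi nil.
have ngy : ~~ G g y by rewrite G_sym; apply: miss_on yi gi.
have gx : G g x by rewrite G_sym.
have ngey : g != y by apply: contraTneq yi => <-; apply: on_edge_hits gi.
by have := edge_missed gl xl yl gx gxy ngey; rewrite (negPf ngy).
Qed.

(** [p] and [q] both miss two of the three edges; if [w] missed [p] and [q], its neighbours on those
    two edges would form a P3 around [w], apart from [p q]. *)
Lemma W_hits (w p q : V) : W w -> ~~ W p -> ~~ W q -> G p q -> G w p || G w q.
Proof.
move=> Ww Up Uq gpq; apply/negPn/negP; rewrite negb_or => /andP [np nq].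
have key i j : i != j -> missed p i -> missed q i -> missed p j -> missed q j -> False.
  move=> neq pi qi pj qj.
  have [g gi wg] := hitP (forallP Ww i); have [h hj wh] := hitP (forallP Ww j).
  have gw : G g w by rewrite G_sym.
  apply: (noF2 gpq gw wh); [exact: on_edge_neq gi hj neq|exact: on_edge_sep gi hj neq|..].
  - exact: miss_on pi gi.
  - by rewrite G_sym.
  - exact: miss_on pj hj.
  - exact: miss_on qi gi.
  - by rewrite G_sym.
  - exact: miss_on qj hj.
have one (r s : V) (i j : 'I_3) : G r s -> (forall l, l != i -> missed r l) ->
    (forall l, l != j -> missed s l) -> i != j -> missed r i.
  move=> grs ri sj nij; apply/negPn/negP => hi; have [g gi rg] := hitP hi.
  have [l [li lj]] := third_index i j.
  have gr : G g r by rewrite G_sym.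
  have gl : missed g l by apply: on_edge_miss gi _; rewrite eq_sym.
  have ngs : ~~ G g s by rewrite G_sym; apply: miss_on (sj i nij) gi.
  have ngeq : g != s by apply: contraTneq (sj i nij) => <-; apply: on_edge_hits gi.
  by have := edge_missed gl (ri l li) (sj l lj) gr grs ngeq; rewrite (negPf ngs).
have [i pi] := notW Up; have [j qj] := notW Uq.
have [l [li lj]] := third_index i j.
case: (i =P j) => [eij|/eqP nij].
  have [k [ki kl]] := third_index i l.
  by apply: (key k l); [|apply: pi|apply: qj; rewrite -eij|apply: pi|apply: qj].
have mp : missed p i by apply: one gpq pi qj nij.
by apply: (key i l); rewrite 1?eq_sym //; [apply: qj|apply: pi|apply: qj].
Qed.

(* The common neighbourhood of the adjacent [x0], [x1] contains no [P1 + P2]. *)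
Lemma same_clique (x0 x1 c1 c2 d1 d2 : V) : W x0 -> W x1 -> G x0 x1 ->
  ~~ W c1 -> ~~ W c2 -> ~~ W d1 -> ~~ W d2 -> G c1 c2 -> G d1 d2 ->
  pe [:: x0; x1] c1 c2 -> pe [:: x0; x1] d1 d2 -> (c1 == d1) || G c1 d1.
Proof.
move=> W0 W1 g01 Uc1 Uc2 Ud1 Ud2 gc gd pc pd.
have both x u v : W x -> x \in [:: x0; x1] -> ~~ W u -> ~~ W v -> G u v ->
    pe [:: x0; x1] u v -> G x u /\ G x v.
  move=> Wx xin Uu Uv guv puv; have [_ exy] := peP puv xin.
  by have := W_hits Wx Uu Uv guv; rewrite exy orbb.
have i0 : x0 \in [:: x0; x1] by rewrite inE eqxx.
have i1 : x1 \in [:: x0; x1] by rewrite !inE eqxx orbT.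
have [a1 a2] := both _ _ _ W0 i0 Uc1 Uc2 gc pc; have [a3 a4] := both _ _ _ W1 i1 Uc1 Uc2 gc pc.
have [b1 b2] := both _ _ _ W0 i0 Ud1 Ud2 gd pd; have [b3 b4] := both _ _ _ W1 i1 Ud1 Ud2 gd pd.
apply/negPn/negP; rewrite negb_or => /andP [neq n1].
have n2 : ~~ G c1 d2.
  apply/negP => g2; case/negP: n1; apply: (U_cluster Uc1 Ud2 Ud1 g2 _ neq); adj.
exact: (noF1 g01 a1 b1 b2 a3 b3 b4 gd n1 n2).
Qed.

End IndependentEdges.

Definition beta_at (P R : 'I_3 -> V) : Prop :=
  indep_edges P R /\ forall x y, hits_all P R x -> hits_all P R y -> ~~ G x y.

Definition beta_case : Prop := exists P R, beta_at P R.

(** ** Separating the vertices of a cluster *)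

Definition clique_of (X : pred V) (p : V) : {set V} := [set u | X u && ((u == p) || G p u)].

(** Large cliques cannot be split by boundedly many pebbles. With the bound four no exception
    remains in the absence of a [K5], while otherwise an exceptional clique offers further vertices
    to argue with. *)
Definition separates (a : seq V) (X : pred V) : Prop :=
  forall v v', X v -> X v' -> pe a v v' -> G v v' ->
  (exists d, [/\ d \in a, X d & G d v]) /\ 4 < #|clique_of X v|.

Definition nearly (a ps : seq V) (X : pred V) : Prop :=
  forall v v', X v -> X v' -> pe a v v' -> G v v' ->
  exists p, [/\ p \in ps, X p & (p == v) || G p v].

Lemma clique_of_eq (X : pred V) (p q : V) : cluster X -> X p -> X q ->
  (p == q) || G p q -> clique_of X p = clique_of X q.
Proof.
move=> cX; have sub r s : X r -> X s -> G r s -> clique_of X r \subset clique_of X s.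
  move=> Xr Xs grs; apply/subsetP => u; rewrite !inE => /andP [Xu] /orP [/eqP ->|gru].
    by rewrite Xr G_sym grs orbT.
  rewrite Xu; case: eqP => //= /eqP neq; rewrite eq_sym in neq.
  by apply: (cX s r u) => //; rewrite G_sym.
move=> Xp Xq /orP [/eqP -> //|gpq]; apply/eqP; rewrite eqEsubset sub // sub //.
by rewrite G_sym.
Qed.

(** Four vertices of each listed clique are pebbled: a clique of at most four is then pebbled
    entirely, a larger one receives a pebble. *)
Lemma separates_of_nearly (a ps : seq V) (X : pred V) : cluster X -> nearly a ps X ->
  exists b, size b <= 4 * size ps /\ separates (a ++ b) X.
Proof.
move=> cX near; pose b := flatten [seq take 4 (enum (clique_of X p)) | p <- ps].
exists b; split.
  rewrite /b; elim: (ps) => //= p s IH; rewrite size_cat mulnS leq_add //.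
  by rewrite size_take_min geq_minl.
move=> v v' Xv Xv' pv gvv'.
have suba c : c \in a -> c \in a ++ b by rewrite mem_cat => ->.
have [p [pin Xp pvp]] := near v v' Xv Xv' (pe_sub suba pv) gvv'.
have ecl := clique_of_eq cX Xp Xv pvp.
have inb u : u \in take 4 (enum (clique_of X v)) -> u \in a ++ b.
  move=> uin; rewrite mem_cat; apply/orP; right; apply/flatten_mapP.
  by exists p => //; rewrite ecl.
have vnot : v \notin a ++ b.
  by apply/negP => /(pe_pebble pv) e; rewrite e G_irr in gvv'.
have vcl : v \in clique_of X v by rewrite inE Xv eqxx.
have big : 4 < #|clique_of X v|.
  rewrite ltnNge cardE; apply: contra vnot => le; apply: inb.
  by rewrite take_oversize // mem_enum.
split=> //; case e: (take 4 (enum (clique_of X v))) => [|d s].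
  by move/(congr1 size): e; rewrite size_take_min -cardE (minn_idPl (ltnW big)).
have dt : d \in take 4 (enum (clique_of X v)) by rewrite e mem_head.
exists d; have := mem_take dt; rewrite mem_enum inE => /andP [Xd] /orP [/eqP edv|gd].
  by case/negP: vnot; rewrite -edv; apply: inb.
by split=> //; [apply: inb|rewrite G_sym].
Qed.

(** Edges in different cliques are collected greedily; three are independent, and if the search
    stops earlier the cliques found contain all edges. *)
Lemma cluster_edges (X : pred V) : cluster X ->
  (exists P R, indep_edges P R /\ forall i, X (P i) /\ X (R i)) \/
  exists ps, size ps <= 2 /\ nearly [::] ps X.
Proof.
move=> cX; pose free (ps : seq V) (e : V * V) :=
  [&& X e.1, X e.2, G e.1 e.2 & all (fun p => ~~ ((p == e.1) || G p e.1)) ps].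
have step ps : all X ps -> (exists e, free ps e) \/ nearly [::] ps X.
  move=> /allP Xps; case: (pickP (free ps)) => [e fe|none]; first by left; exists e.
  right=> v v' Xv Xv' _ gvv'; have := none (v, v'); rewrite /free /= Xv Xv' gvv' /=.
  move/negbT; rewrite -has_predC => /hasP [p pin /negbNE h].
  by exists p; split=> //; apply: Xps.
have [[[p1 q1]]|near] := step [::] isT; last by right; exists [::].
case/and4P => /= Xp1 Xq1 g1 _.
have [|[[p2 q2]]|near] := step [:: p1]; [by rewrite /= Xp1| |by right; exists [:: p1]].
case/and4P => /= Xp2 Xq2 g2 /andP [n12 _].
have [|[[p3 q3]]|near] := step [:: p1; p2];
  [by rewrite /= Xp1 Xp2| |by right; exists [:: p1; p2]].
case/and4P => /= Xp3 Xq3 g3 /and3P [n13 n23 _].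
have sep p q p' q' : X p -> X q -> X p' -> X q' -> G p q -> G p' q' ->
    ~~ ((p == p') || G p p') -> [/\ ~~ G p p', ~~ G p q', ~~ G q p' & ~~ G q q'].
  move=> Xp Xq Xp' Xq' g g'; rewrite negb_or => /andP [neq n].
  have n1 : ~~ G p q'.
    by apply/negP => h; case/negP: n; apply: (cX p q' p') => //; rewrite G_sym.
  have n2 : ~~ G q p' by apply/negP => h; case/negP: n; apply: (cX p q p').
  split=> //; apply/negP => h; case/negP: n1; apply: (cX p q q') => //.
  by apply: contraNneq n => ->; rewrite G_sym.
have [a1 a2 a3 a4] := sep _ _ _ _ Xp1 Xq1 Xp2 Xq2 g1 g2 n12.
have [b1 b2 b3 b4] := sep _ _ _ _ Xp1 Xq1 Xp3 Xq3 g1 g3 n13.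
have [c1 c2 c3 c4] := sep _ _ _ _ Xp2 Xq2 Xp3 Xq3 g2 g3 n23.
left; exists (fun i : 'I_3 => nth p1 [:: p1; p2; p3] i), (fun i : 'I_3 => nth p1 [:: q1; q2; q3] i).
split; first split.
- by case=> -[|[|[]]].
- by case=> -[|[|[|//]]] i3; case=> -[|[|[|//]]] j3 //= _; split=> //; adj.
- by case=> -[|[|[|//]]] i3 /=; split.
Qed.

(** If at most two cliques have edges, 8 pebbles suffice. Otherwise [W] is independent or has an
    edge [x0 x1], and pebbling this edge leaves all failures in one clique, for 2 + 4 pebbles. *)
Lemma separate_cluster (X : pred V) : cluster X ->
  beta_case \/ exists a, size a <= 12 /\ separates a X.
Proof.
move=> cX; have [[P [R [ie XPR]]]|[ps [szps near]]] := cluster_edges cX; last first.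
  right; have [b [szb sb]] := separates_of_nearly cX near; exists b; split=> //.
  by apply: leq_trans szb _; apply: (@leq_trans (4 * 2)); rewrite ?leq_mul2l.
case: (pickP (fun e : V * V => [&& hits_all P R e.1, hits_all P R e.2 & G e.1 e.2]))
  => [[x0 x1] /and3P /= [W0 W1 g01]|none]; last first.
  left; exists P, R; split=> // x y Wx Wy; apply/negP => gxy.
  by have := none (x, y); rewrite /= Wx Wy gxy.
(* A vertex of [X] that hits two of the edges would merge two cliques of the cluster. *)
have XU v : X v -> ~~ hits_all P R v.
  move=> Xv; apply/negP => /forallP hv.
  have [g [gi vg]] : exists g, on_edge P R ord0 g /\ G v g.
    by have [g ? ?] := hitP (hv ord0); exists g.
  have [h [hj vh]] : exists h, on_edge P R (lift ord0 ord0) h /\ G v h.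
    by have [h ? ?] := hitP (hv (lift ord0 ord0)); exists h.
  have Xon i u : on_edge P R i u -> X u by have [X1 X2] := XPR i; case=> ->.
  have n := on_edge_sep ie gi hj isT; case/negP: n.
  apply: (cX g v h) => //; [exact: Xon gi|exact: Xon hj|by rewrite G_sym|].
  exact: on_edge_neq ie _ _ _ _ gi hj isT.
pose bad (e : V * V) := [&& X e.1, X e.2, pe [:: x0; x1] e.1 e.2 & G e.1 e.2].
have [ps [szps near]] : exists ps, size ps <= 1 /\ nearly [:: x0; x1] ps X.
  case: (pickP bad) => [[c1 c2] /and4P /= [Xc1 Xc2 pc gc]|nb].
    exists [:: c1]; split=> // v v' Xv Xv' pv gv; exists c1; rewrite inE eqxx; split=> //.
    exact: (same_clique ie W0 W1 g01 (XU _ Xc1) (XU _ Xc2) (XU _ Xv) (XU _ Xv') gc gv pc pv).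
  exists [::]; split=> // v v' Xv Xv' pv gv.
  by have /negP [] := negbT (nb (v, v')); apply/and4P.
right; have [b [szb sb]] := separates_of_nearly cX near; exists ([:: x0; x1] ++ b).
split=> //=; rewrite !ltnS; apply: leq_trans szb _.
by apply: (@leq_trans (4 * 1)); rewrite ?leq_mul2l.
Qed.

(** * Graphs without a clique on five vertices *)

Definition K5_free : Prop := forall k : 'I_5 -> V, ~ (forall i j, i != j -> G (k i) (k j)).

Lemma K5_of_seq (s : seq V) : pairwise G s -> 4 < size s ->
  exists k : 'I_5 -> V, forall i j, i != j -> G (k i) (k j).
Proof.
case: s => // x0 s; set t := x0 :: s => pw lt; exists (fun i : 'I_5 => nth x0 t i).
have lt' (i : 'I_5) : i < size t by apply: leq_trans (ltn_ord i) lt.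
move=> i j neq.
case: (ltngtP i j) => [lij|lji|/val_inj e]; last by rewrite e eqxx in neq.
  by have /(pairwiseP x0) := pw; apply; rewrite ?inE ?lt'.
by rewrite G_sym; have /(pairwiseP x0) := pw; apply; rewrite ?inE ?lt'.
Qed.

Lemma resolve_cluster (X : pred V) : K5_free -> cluster X ->
  beta_case \/ exists a, size a <= 12 /\ resolves a X.
Proof.
move=> k5 cX; have [beta|[a [sza sep]]] := separate_cluster cX; [by left|right].
exists a; split=> // v v' Xv Xv' pv; apply/negP => gv.
have [_ big] := sep v v' Xv Xv' pv gv.
have [||k gk] := @K5_of_seq (enum (clique_of X v)); last exact: (k5 k gk).
  apply/(pairwiseP v) => i j; rewrite !inE => lti ltj ltij.
  have [Xi ci] : X (nth v (enum (clique_of X v)) i) /\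
      ((nth v (enum (clique_of X v)) i == v) || G v (nth v (enum (clique_of X v)) i)).
    by have := mem_nth v lti; rewrite mem_enum inE => /andP.
  have [Xj cj] : X (nth v (enum (clique_of X v)) j) /\
      ((nth v (enum (clique_of X v)) j == v) || G v (nth v (enum (clique_of X v)) j)).
    by have := mem_nth v ltj; rewrite mem_enum inE => /andP.
  have neq : nth v (enum (clique_of X v)) i != nth v (enum (clique_of X v)) j.
    by rewrite nth_uniq ?enum_uniq // neq_ltn ltij.
  case/orP: ci => [/eqP ei|gi]; case/orP: cj => [/eqP ej|gj].
  - by rewrite ei ej eqxx in neq.
  - by rewrite ei.
  - by rewrite ej G_sym.
  - by apply: (cX _ v) => //; rewrite G_sym.
by rewrite -cardE.
Qed.

Lemma max_clique (X : pred V) (m : nat) :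
  (forall a, pairwise G a -> all X a -> size a <= m) ->
  exists a, [/\ pairwise G a, all X a & forall v, X v -> exists2 c, c \in a & ~~ G c v].
Proof.
move=> bound; suff main j : (exists a, [/\ pairwise G a, all X a &
      forall v, X v -> exists2 c, c \in a & ~~ G c v]) \/
    (exists a, [/\ pairwise G a, all X a & size a = j]).
  have [//|[a [pw Xa sza]]] := main m.+1.
  by have := bound a pw Xa; rewrite sza ltnn.
elim: j => [|j [?|[a [pw Xa sza]]]]; [by right; exists [::]|by left|].
case: (pickP (fun v => X v && all (fun c => G c v) a)) => [v /andP [Xv gv]|none].
  right; exists (v :: a); rewrite /= Xv Xa sza pw andbT; split=> //.
  by apply/allP => c ca; rewrite G_sym; apply: (allP gv).
left; exists a; split=> // v Xv; have := none v; rewrite Xv /= => /negbT.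
by rewrite -has_predC => /hasP [c ca nc]; exists c.
Qed.

(** A maximal clique meets every part, so missing the same pebble of it means lying in the same
    part. *)
Lemma resolve_cocluster (X : pred V) : K5_free -> cocluster X ->
  exists a, size a <= 4 /\ resolves a X.
Proof.
move=> k5 cX; have bound a : pairwise G a -> all X a -> size a <= 4.
  by move=> pw _; rewrite leqNgt; apply/negP => /(K5_of_seq pw) [k] /k5.
have [a [pw Xa mx]] := max_clique bound; exists a; split; first exact: bound.
move=> v v' Xv Xv' pv; have [c ca nc] := mx v Xv.
have [_ e] := peP pv ca; apply: (cX v c v') => //; first exact: (allP Xa).
  by rewrite G_sym.
by rewrite -e.
Qed.

(** An edge [x y] in the set splits the neighbourhood of [u] into common neighbours with [x], common
    neighbours with [y], and vertices missing both: 2 + 4 + 4 + 12 pebbles. *)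
Lemma resolve_private (u v : V) : K5_free -> G u v ->
  beta_case \/ exists a, size a <= 22 /\ resolves a (fun x => G u x && ~~ G v x).
Proof.
move=> k5 guv; pose A x := G u x && ~~ G v x.
case: (pickP (fun e : V * V => [&& A e.1, A e.2 & G e.1 e.2]))
    => [[x y] /and3P /= [Ax Ay gxy]|none]; last first.
  right; exists [::]; split=> // x y Ax Ay _; apply/negP => gxy.
  by have /negP [] := negbT (none (x, y)); apply/and3P.
have [ux _] := andP Ax; have [uy _] := andP Ay.
have [beta|[a3 [sz3 r3]]] := resolve_cluster k5 (common_non_nbrs_cluster gxy); first by left.
have [a1 [sz1 r1]] := resolve_cocluster k5 (common_nbrs_cocluster ux).
have [a2 [sz2 r2]] := resolve_cocluster k5 (common_nbrs_cocluster uy).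
right; exists ([:: x; y] ++ a1 ++ a2 ++ a3); rewrite !size_cat; split.
  by apply: (@leq_trans (2 + (4 + (4 + 12)))); rewrite // leq_add2l !leq_add.
move=> w w' /andP [uw _] /andP [uw' _] pw.
have [_ ex] : (x == w) = (x == w') /\ G x w = G x w' by apply: peP pw _; rewrite inE eqxx.
have [_ ey] : (y == w) = (y == w') /\ G y w = G y w'.
  by apply: peP pw _; rewrite !inE eqxx orbT.
have s1 : {subset a1 <= [:: x; y] ++ a1 ++ a2 ++ a3} by move=> c; rewrite !mem_cat => ->; rewrite orbT.
have s2 : {subset a2 <= [:: x; y] ++ a1 ++ a2 ++ a3} by move=> c; rewrite !mem_cat => ->; rewrite !orbT.
have s3 : {subset a3 <= [:: x; y] ++ a1 ++ a2 ++ a3} by move=> c; rewrite !mem_cat => ->; rewrite !orbT.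
case gxw: (G x w); first by apply: r1 (pe_sub s1 pw); rewrite ?uw ?uw' -?ex ?gxw.
case gyw: (G y w); first by apply: r2 (pe_sub s2 pw); rewrite ?uw ?uw' -?ey ?gyw.
by apply: r3 (pe_sub s3 pw); rewrite -?ex -?ey gxw gyw.
Qed.

(** An edge [u v] splits the graph into a cocluster, a cluster and two private neighbourhoods. *)
Lemma K5_free_case : K5_free -> 0 < #|V| ->
  beta_case \/ exists a, [/\ 0 < size a, size a <= 62 & rigid a].
Proof.
move=> k5 /card_gt0P [v0 _].
case: (pickP (fun e : V * V => G e.1 e.2)) => [[u v] /= guv|none]; last first.
  right; exists [:: v0]; split=> //; apply: resolves_rigid => x y _ _ _.
  by apply/negP => gxy; have := none (x, y); rewrite /= gxy.
have gvu : G v u by rewrite G_sym.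
have [beta|[a2 [sz2 r2]]] := resolve_cluster k5 (common_non_nbrs_cluster guv); first by left.
have [beta|[a3 [sz3 r3]]] := resolve_private k5 guv; first by left.
have [beta|[a4 [sz4 r4]]] := resolve_private k5 gvu; first by left.
have [a1 [sz1 r1]] := resolve_cocluster k5 (common_nbrs_cocluster guv).
right; exists ([:: u; v] ++ a1 ++ a2 ++ a3 ++ a4); rewrite !size_cat; split=> //.
  by apply: (@leq_trans (2 + (4 + (12 + (22 + 22))))); rewrite // leq_add2l !leq_add.
set a := _ ++ _; apply: resolves_rigid => w w' _ _ pw.
have [_ eu] : (u == w) = (u == w') /\ G u w = G u w' by apply: peP pw _; rewrite inE eqxx.
have [_ ev] : (v == w) = (v == w') /\ G v w = G v w'.
  by apply: peP pw _; rewrite !inE eqxx orbT.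
have s1 : {subset a1 <= a} by move=> c; rewrite !mem_cat => ->; rewrite !orbT.
have s2 : {subset a2 <= a} by move=> c; rewrite !mem_cat => ->; rewrite !orbT.
have s3 : {subset a3 <= a} by move=> c; rewrite !mem_cat => ->; rewrite !orbT.
have s4 : {subset a4 <= a} by move=> c; rewrite !mem_cat => ->; rewrite !orbT.
case guw: (G u w); case gvw: (G v w).
- by apply: r1 (pe_sub s1 pw); rewrite -?eu -?ev guw gvw.
- by apply: r3 (pe_sub s3 pw); rewrite -?eu -?ev guw gvw.
- by apply: r4 (pe_sub s4 pw); rewrite -?eu -?ev guw gvw.
- by apply: r2 (pe_sub s2 pw); rewrite -?eu -?ev guw gvw.
Qed.
(** ** Graphs with a clique on five vertices *)

Lemma pick4 (A B C D : {set 'I_5}) : #|A| <= 1 -> #|B| <= 1 -> #|C| <= 1 -> #|D| <= 1 ->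
  exists i, [/\ i \notin A, i \notin B, i \notin C & i \notin D].
Proof.
move=> a b c e; have : 0 < #|~: (A :|: B :|: C :|: D)|.
  have u1 := (leq_card_setU (A :|: B :|: C) D).1; have u2 := (leq_card_setU (A :|: B) C).1.
  have u3 := (leq_card_setU A B).1; have := cardsC (A :|: B :|: C :|: D).
  by rewrite card_ord; lia.
case/card_gt0P => i; rewrite !inE !negb_or => /andP [/andP [/andP [? ?] ?] ?].
by exists i.
Qed.

Lemma pick3 (A B C : {set 'I_5}) : #|A| <= 1 -> #|B| <= 1 -> #|C| <= 1 ->
  exists i j, [/\ i != j, i \notin A :|: B :|: C & j \notin A :|: B :|: C].
Proof.
move=> a b c; have : 1 < #|~: (A :|: B :|: C)|.
  have u2 := (leq_card_setU (A :|: B) C).1; have u3 := (leq_card_setU A B).1.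
  by have := cardsC (A :|: B :|: C); rewrite card_ord; lia.
by case/card_gt1P => i [j []]; rewrite !in_setC => iA jA neq; exists i, j.
Qed.

Section FiveClique.

Variable k : 'I_5 -> V.
Hypothesis k_clique : forall i j, i != j -> G (k i) (k j).

Definition khits (v : V) : {set 'I_5} := [set i | G v (k i)].
Definition kmiss (v : V) : {set 'I_5} := [set i | ~~ G v (k i)].

(** Members of the clique see only four of its vertices, hence the threshold. *)
Definition inM (v : V) : bool := 4 <= #|khits v|.

Lemma inM_k (i : 'I_5) : inM (k i).
Proof.
rewrite /inM; apply: (@leq_trans #|[set~ i]|); first by rewrite cardsC1 card_ord.
by apply: subset_leq_card; apply/subsetP => l; rewrite !inE => li; apply: k_clique; rewrite eq_sym.
Qed.

Lemma inM_miss (v : V) : inM v -> #|kmiss v| <= 1.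
Proof.
rewrite /inM => le; have := cardsC (khits v); rewrite card_ord.
have -> : ~: khits v = kmiss v by apply/setP => i; rewrite !inE.
by lia.
Qed.

(** Two neighbours and two non-neighbours of [v] in the clique form with [v] the complement of 2P1 +
    P3. *)
Lemma notM_hits (v : V) : ~~ inM v -> #|khits v| <= 1.
Proof.
rewrite /inM -ltnNge ltnS => le3; rewrite leqNgt; apply/negP => /card_gt1P [i [j []]].
rewrite !inE => vi vj nij; have : 1 < #|kmiss v|.
  have := cardsC (khits v); rewrite card_ord.
  have -> : ~: khits v = kmiss v by apply/setP => l; rewrite !inE.
  by lia.
case/card_gt1P => l [l' []]; rewrite !inE => vl vl' nll'.
have sep a b : G v (k a) -> ~~ G v (k b) -> G (k a) (k b).
  by move=> ga gb; apply: k_clique; apply: contraNneq gb => <-.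
by apply: (noF1 (k_clique nij) _ (sep i l vi vl) (sep i l' vi vl') _ (sep j l vj vl)
  (sep j l' vj vl') (k_clique nll') vl vl'); rewrite G_sym.
Qed.

Lemma M_cocluster : cocluster inM.
Proof.
move=> x y z Mx My Mz nxy nyz; apply/negP => gxz.
have [i [j [nij]]] := pick3 (inM_miss Mx) (inM_miss My) (inM_miss Mz).
rewrite !inE !negb_or !negbK => /andP [/andP [xi yi] zi] /andP [/andP [xj yj] zj].
by apply: (noF1 (k_clique nij) (c := y) (e := x) (f := z)) => //; adj.
Qed.

Lemma R_cluster : cluster (fun v => ~~ inM v).
Proof.
move=> x y z Rx Ry Rz gxy gyz neq; apply/negPn/negP => n.
have [i [j [nij]]] := pick3 (notM_hits Rx) (notM_hits Ry) (notM_hits Rz).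
rewrite !inE !negb_or => /andP [/andP [xi yi] zi] /andP [/andP [xj yj] zj].
by apply: (noF2 (k_clique nij) gxy gyz neq n); adj.
Qed.

(** Otherwise the adjacent [m], [m'] are complete to [r] and to an edge of the clique that [r]
    misses. *)
Lemma R_touch (r m m' : V) : ~~ inM r -> inM m -> inM m' -> G r m -> G r m' -> ~~ G m m'.
Proof.
move=> Rr Mm Mm' gm gm'; apply/negP => g.
have [i [j [nij]]] := pick3 (notM_hits Rr) (inM_miss Mm) (inM_miss Mm').
rewrite !inE !negb_or !negbK => /andP [/andP [ri mi] mi'] /andP [/andP [rj mj] mj'].
by apply: (noF1 g (c := r) (e := k i) (f := k j) _ mi mj _ mi' mj' (k_clique nij)); adj.
Qed.

(** A clique vertex away from [d], [d'] is the centre of a path from [m] to [m']. So an edge outside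
    [M] touches every part with two vertices, and by [R_touch] at most two such parts exist. *)
Lemma R_edge_part (d d' m m' : V) : ~~ inM d -> ~~ inM d' -> G d d' -> inM m -> inM m' ->
  m != m' -> ~~ G m m' -> [|| G d m, G d m', G d' m | G d' m'].
Proof.
move=> Rd Rd' g Mm Mm' neq n; apply/negPn/negP; rewrite !negb_or => /and4P [n1 n2 n3 n4].
have [i [j [nij]]] := pick3 (notM_hits Rd) (notM_hits Rd') (inM_miss Mm).
rewrite !inE !negb_or !negbK => /andP [/andP [di di'] mi] _.
have mi' : G m' (k i).
  by apply/negPn/negP => ni; have := M_cocluster Mm Mm' (inM_k i) n ni; rewrite mi.
have im' : G (k i) m' by rewrite G_sym.
exact: (noF2 g mi im' neq n).
Qed.

(** Otherwise [r], [m] and a clique vertex form a path apart from the edge [d d']. *)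
Lemma R_hit (d d' r m : V) : ~~ inM d -> ~~ inM d' -> G d d' -> ~~ inM r -> inM m ->
  ~~ G d r -> ~~ G d' r -> G r m -> G d m || G d' m.
Proof.
move=> Rd Rd' g Rr Mm n1 n2 grm; apply/negPn/negP; rewrite negb_or => /andP [n3 n4].
have [i []] := pick4 (notM_hits Rd) (notM_hits Rd') (inM_miss Mm) (notM_hits Rr).
rewrite !inE !negbK => di di' mi ri.
by apply: (noF2 g grm mi) => //; apply: contraNneq Rr => ->; apply: inM_k.
Qed.

Section RestEdge.

Variables (u v m1 m2 : V) (b : seq V).
Hypotheses (Ru : ~~ inM u) (Rv : ~~ inM v) (guv : G u v).
Hypothesis m1P : forall m, inM m -> G u m -> inM m1 && G u m1.
Hypothesis m2P : forall m, inM m -> G v m -> inM m2 && G v m2.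
Hypothesis sepb : separates b (fun x => ~~ inM x).

(** [m1] and [m2] represent the parts touched by [u] and [v], so every part with two vertices
    contains a pebble. *)
Definition rest_pebbles : seq V := codom k ++ [:: u; v; m1; m2] ++ b.

Local Notation a := rest_pebbles.

Lemma inM_pe (x x' : V) : pe a x x' -> inM x = inM x'.
Proof.
move=> px; rewrite /inM; congr (4 <= #|pred_of_set _|); apply/setP => i; rewrite !inE.
have kin : k i \in a by rewrite mem_cat codom_f.
by rewrite ![G _ (k i)]G_sym; have [_] := peP px kin.
Qed.

Lemma mem_rest (c : V) : c \in [:: u; v; m1; m2] -> c \in a.
Proof. by move=> cin; rewrite !mem_cat cin orbT. Qed.

Lemma part_pebble (y y' : V) : inM y -> inM y' -> y != y' -> ~~ G y y' ->
  exists c, [/\ c \in a, inM c & ~~ G c y].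
Proof.
move=> My My' neq n.
have found x c m : ~~ inM x -> c \in [:: u; v; m1; m2] ->
    (forall m, inM m -> G x m -> inM c && G x c) -> inM m -> G x m -> ~~ G m y || (m == y) ->
    exists c, [/\ c \in a, inM c & ~~ G c y].
  move=> Rx cin cP Mm gxm nmy; have /andP [Mc gxc] := cP m Mm gxm.
  exists c; split=> //; first exact: mem_rest.
  have ncm := R_touch Rx Mc Mm gxc gxm.
  by case/orP: nmy => [nmy|/eqP <- //]; apply: M_cocluster ncm nmy.
have i1 : m1 \in [:: u; v; m1; m2] by rewrite !inE eqxx !orbT.
have i2 : m2 \in [:: u; v; m1; m2] by rewrite !inE eqxx !orbT.
have n' : ~~ G y' y by rewrite G_sym.
case/or4P: (R_edge_part Ru Rv guv My My' neq n) => g.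
- by apply: (found u m1 y); rewrite ?eqxx ?orbT.
- by apply: (found u m1 y'); rewrite ?n'.
- by apply: (found v m2 y); rewrite ?eqxx ?orbT.
- by apply: (found v m2 y'); rewrite ?n'.
Qed.

Lemma same_part (y y' w : V) : inM y -> inM y' -> y != y' -> ~~ G y y' -> pe a y w -> ~~ G y w.
Proof.
move=> My My' neq n pw; have [c [ca Mc nc]] := part_pebble My My' neq n.
have [_ e] := peP pw ca; apply: (@M_cocluster y c w) => //; last by rewrite -e.
  by rewrite -(inM_pe pw).
by rewrite G_sym.
Qed.

Lemma pe_sep (x x' : V) : pe a x x' -> ~~ inM x -> G x x' ->
  (exists d, [/\ d \in a, ~~ inM d & G d x]) /\ 4 < #|clique_of (fun x => ~~ inM x) x|.
Proof.
move=> px Rx g; have sub : {subset b <= a} by move=> c cb; rewrite !mem_cat cb !orbT.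
have Rx' : ~~ inM x' by rewrite -(inM_pe px).
have [[d [db Rd gd]] big] := sepb Rx Rx' (pe_sub sub px) g.
by split=> //; exists d; split=> //; apply: sub.
Qed.

(** A pebble in the clique of [x] is seen by the whole class of [x], which puts the class into one
    clique. *)
Lemma class_clique (x w w' : V) : pe a x w -> pe a x w' -> w != w' -> ~~ inM x ->
  (exists x', pe a x x' /\ G x x') -> G w w'.
Proof.
move=> pw pw' neq Rx [x' [px' g]]; have [[d [da Rd gd]] _] := pe_sep px' Rx g.
have [_ e] := peP pw da; have [_ e'] := peP pw' da.
apply: (R_cluster (y := d)) => //; rewrite -?(inM_pe pw) -?(inM_pe pw') //.
  by rewrite G_sym -e.
by rewrite -e'.
Qed.

Section Quad.

Variables (e : rel V) (x x' y y' z z' : V).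
Hypotheses (eqe : equitable a e) (full : fullquad e x x' y y' z z').

Let exx' : pe a x x'. Proof. by case: full => -[/(equitable_pe eqe)]. Qed.
Let eyy' : pe a y y'. Proof. by case: full => -[_ /(equitable_pe eqe)]. Qed.
Let eyz : pe a y z. Proof. by case: full => -[_ _ /(equitable_pe eqe)]. Qed.
Let eyz' : pe a y z'. Proof. by case: full => -[_ _ _ /(equitable_pe eqe)]. Qed.
Let ey'z : pe a y' z.
Proof.
case: full => -[_ h1 h2 _] _ _ _; apply: (equitable_pe eqe).
by apply: (equitable_trans eqe) h2; rewrite (equitable_sym eqe).
Qed.
Let neqy : y != y'. Proof. by case: full => _ []. Qed.
Let neqz : z != z'. Proof. by case: full => _ []. Qed.
Let gxy : G x y. Proof. by case: full => _ _ []. Qed.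
Let gxy' : G x y'. Proof. by case: full => _ _ []. Qed.
Let nxz : ~~ G x z. Proof. by case: full => _ _ []. Qed.
Let nxz' : ~~ G x z'. Proof. by case: full => _ _ []. Qed.
Let gx'z : G x' z. Proof. by case: full => _ _ _ []. Qed.
Let gx'z' : G x' z'. Proof. by case: full => _ _ _ []. Qed.
Let nx'y : ~~ G x' y. Proof. by case: full => _ _ _ []. Qed.
Let nx'y' : ~~ G x' y'. Proof. by case: full => _ _ _ []. Qed.

Let neqyz : y != z. Proof. exact: adj_sep gxy nxz. Qed.
Let neqyz' : y != z'. Proof. exact: adj_sep gxy nxz'. Qed.
Let neqy'z : y' != z. Proof. exact: adj_sep gxy' nxz. Qed.
Let neqy'z' : y' != z'. Proof. exact: adj_sep gxy' nxz'. Qed.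

(** [y], [y'] lie in one part, which holds a pebble [c] and also contains [x']. So [c] misses [x']
    and, by equal view, [x]; yet [x] sees [y]. *)
Lemma quad_MM : inM x -> inM y -> False.
Proof.
move=> Mx My; have Mx' : inM x' by rewrite -(inM_pe exx').
have My' : inM y' by rewrite -(inM_pe eyy').
have nyx' : ~~ G y x' by rewrite G_sym.
have nyy' : ~~ G y y' by apply: (M_cocluster My Mx' My').
have [c [ca Mc ncy]] := part_pebble My My' neqy nyy'.
have ncx' : ~~ G c x' by apply: (M_cocluster Mc My Mx').
have ncx : ~~ G c x by have [_ ->] := peP exx' ca.
have nxc : ~~ G x c by rewrite G_sym.
by have := M_cocluster Mx Mc My nxc ncy; rewrite gxy.
Qed.

(** [y], [y'] lie in the clique of [x], which therefore holds a pebble; [x'] sees it too, joins the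
    clique and would see [y]. *)
Lemma quad_RR : ~~ inM x -> ~~ inM y -> False.
Proof.
move=> Rx Ry; have Ry' : ~~ inM y' by rewrite -(inM_pe eyy').
have Rx' : ~~ inM x' by rewrite -(inM_pe exx').
have gyy' : G y y' by apply: (R_cluster (y := x)) => //; rewrite G_sym.
have [[d [da Rd gdy]] _] := pe_sep eyy' Ry gyy'.
have [e1 e2] := peP exx' da.
case: (d =P x) => [edx|/eqP ndx].
  by move: e1 nx'y; rewrite -edx eqxx => /esym/eqP <-; rewrite gdy.
have gdx : G d x by apply: (R_cluster (y := y)) => //; rewrite G_sym.
have gx'd : G x' d by rewrite G_sym -e2.
have [ey|neq] := eqVneq x' y; first by move: nx'y'; rewrite ey gyy'.
by have := R_cluster Rx' Rd Ry gx'd gdy neq; rewrite (negPf nx'y).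
Qed.

(** [y], [y'], [z], [z'] lie in one part. If [x], [x'] are adjacent, their clique is large and
    supplies [d2], [d3]; both are forced to see some [t] among [y], [y'] and some [t'] among [z],
    [z'], and then [d2], [d3], [t'], [x], [t] is forbidden. *)
Lemma quad_RM : ~~ inM x -> inM y -> False.
Proof.
move=> Rx My; have Rx' : ~~ inM x' by rewrite -(inM_pe exx').
have My' : inM y' by rewrite -(inM_pe eyy').
have Mz : inM z by rewrite -(inM_pe eyz).
have Mz' : inM z' by rewrite -(inM_pe eyz').
have nyy' := R_touch Rx My My' gxy gxy'; have nzz' := R_touch Rx' Mz Mz' gx'z gx'z'.
have nyz := same_part My My' neqy nyy' eyz; have nyz' := same_part My My' neqy nyy' eyz'.
have ny'z : ~~ G y' z by apply: (@M_cocluster y' y z); rewrite // G_sym.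
have ny'z' : ~~ G y' z' by apply: (@M_cocluster y' y z'); rewrite // G_sym.
have gyx : G y x by rewrite G_sym.
case: (boolP (G x x')) => [gxx'|nxx']; last first.
  by apply: (@noF2 x' z y x y') => //; rewrite G_sym.
have [_ big] := pe_sep exx' Rx gxx'.
have [d2 [d3 [n23 [Rd2 Rd3] [g2 g3] [h2 h3]]]] : exists d2 d3, [/\ d2 != d3,
    ~~ inM d2 /\ ~~ inM d3, G x d2 /\ G x d3 & G x' d2 /\ G x' d3].
  have : 1 < #|clique_of (fun x => ~~ inM x) x :\: [set x; x']|.
    have le2 : #|clique_of (fun x => ~~ inM x) x :&: [set x; x']| <= 2.
      by apply: leq_trans (subset_leq_card (subsetIr _ _)) _; rewrite cards2; case: (x != x').
    rewrite ltnNge; apply: contraL big => le1; rewrite -leqNgt -(cardsID [set x; x']).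
    by apply: leq_trans (leq_add le2 le1) _.
  case/card_gt1P => d2 [d3 []]; rewrite !inE !negb_or.
  move=> /andP [/andP [a1 a2] /andP [Rd2 cd2]] /andP [/andP [b1 b2] /andP [Rd3 cd3]] neq.
  have g2 : G x d2 by move: cd2; rewrite (negPf a1).
  have g3 : G x d3 by move: cd3; rewrite (negPf b1).
  have gx'x : G x' x by rewrite G_sym.
  exists d2, d3; split=> //; split.
    by apply: (R_cluster Rx' Rx Rd2 gx'x g2); rewrite eq_sym.
  by apply: (R_cluster Rx' Rx Rd3 gx'x g3); rewrite eq_sym.
have gd23 : G d2 d3 by apply: (R_cluster (y := x)) => //; rewrite G_sym.
have main t t' : ~~ G t t' -> G x t -> ~~ G x' t -> G x' t' -> ~~ G x t' ->
    G d2 t -> G d2 t' -> False.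
  move=> ntt' xt nx't x't' nxt' d2t d2t'.
  have d3t : G d3 t.
    apply/negPn/negP => n; apply: (@noF1 x d2 t x' d3) => //; try adj.
  have d3t' : G d3 t'.
    apply/negPn/negP => n; apply: (@noF1 x' d2 t' x d3) => //; try adj.
  by apply: (@noF1 d2 d3 t' x t) => //; adj.
have or2 w w' t : inM w -> inM w' -> w != w' -> ~~ G w w' -> ~~ inM t -> G t d2 ->
    ~~ G t w -> ~~ G t w' -> G d2 w \/ G d2 w'.
  move=> Mw Mw' nww' nw Rt gt n1 n2.
  by case/or4P: (R_edge_part Rt Rd2 gt Mw Mw' nww' nw) => h;
    [rewrite h in n1|rewrite h in n2|left|right].
have [hy|hy] := or2 y y' x' My My' neqy nyy' Rx' h2 nx'y nx'y';
  have [hz|hz] := or2 z z' x Mz Mz' neqz nzz' Rx g2 nxz nxz'.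
- by apply: (main y z).
- by apply: (main y z').
- by apply: (main y' z).
- by apply: (main y' z').
Qed.

(** An edge at [y] in its class makes the class a clique, and [y], [y'], [x], [z], [z'] is
    forbidden. If [y], [y'], [z] are independent and [x], [x'] adjacent, then [u] or [v] must see
    [x] and, by equal view, [x'], against [R_touch]. *)
Lemma quad_MR : inM x -> ~~ inM y -> False.
Proof.
move=> Mx Ry; have Mx' : inM x' by rewrite -(inM_pe exx').
have Ry' : ~~ inM y' by rewrite -(inM_pe eyy').
have Rz : ~~ inM z by rewrite -(inM_pe eyz).
have gyx : G y x by rewrite G_sym.
case: (pickP (fun y2 => pe a y y2 && G y y2)) => [y2 /andP [py2 gy2]|nadj].
  have adjc w w' : pe a y w -> pe a y w' -> w != w' -> G w w'.
    by move=> pw pw' neq; apply: (class_clique pw pw' neq Ry); exists y2.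
  have py : pe a y y by apply: (equitable_pe eqe); apply: (equitable_refl eqe).
  have [h1 h2 h3] : [/\ G y y', G y z & G y z'] by split; apply: adjc.
  have [h4 h5 h6] : [/\ G y' z, G y' z' & G z z'] by split; apply: adjc.
  by apply: (@noF1 y y' x z z') => //; adj.
have nyy' : ~~ G y y' by have := nadj y'; rewrite eyy' => /= ->.
have nyz : ~~ G y z by have := nadj z; rewrite eyz => /= ->.
have ny'z : ~~ G y' z.
  apply/negP => g'.
  have py'y : pe a y' y.
    by case: full => -[_ h _ _] _ _ _; apply: (equitable_pe eqe); rewrite (equitable_sym eqe).
  have py'y' : pe a y' y' by apply: (equitable_pe eqe); apply: (equitable_refl eqe).
  have neqy' : y' != y by rewrite eq_sym.
  have := class_clique py'y' py'y neqy' Ry'; rewrite G_sym (negPf nyy') => contra.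
  by apply: notF; apply: contra; exists z; rewrite ey'z.
case: (boolP (G x x')) => [gxx'|nxx']; last first.
  by apply: (@noF2 x' z y x y') => //; rewrite G_sym.
have ua : u \in a by apply: mem_rest; rewrite inE eqxx.
have va : v \in a by apply: mem_rest; rewrite !inE eqxx orbT.
have nuy : ~~ G u y.
  apply/negP => guy; have [_ e1] := peP eyy' ua.
  case/negP: nyy'; apply: (R_cluster (y := u)) => //; first by rewrite G_sym.
  by rewrite -e1.
have nuy0 : u != y by apply: contraNneq neqy => euy; rewrite (pe_pebble eyy') // -euy.
have nvy : ~~ G v y by apply: contra nuy => gvy; apply: (R_cluster (y := v)).
have [_ eu] := peP exx' ua; have [_ ev] := peP exx' va.
case/orP: (R_hit Ru Rv guv Ry Mx nuy nvy gyx) => h.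
  by have := R_touch Ru Mx Mx' h; rewrite -eu h gxx' => /(_ isT).
by have := R_touch Rv Mx Mx' h; rewrite -ev h gxx' => /(_ isT).
Qed.

End Quad.

Lemma rest_rigid : rigid a.
Proof.
move=> e eqe x x' y y' _ _ _ _ exx' eyy' neq g1 g2 g3 g4.
have [z [z' full]] := fullquad_of_quad eqe exx' eyy' neq g1 g2 g3 g4.
case: (boolP (inM x)) => Mx; case: (boolP (inM y)) => My.
- exact: quad_MM eqe full Mx My.
- exact: quad_MR eqe full Mx My.
- exact: quad_RM eqe full Mx My.
- exact: quad_RR eqe full Mx My.
Qed.

End RestEdge.

Lemma rest_edge_rigid (u v : V) : ~~ inM u -> ~~ inM v -> G u v ->
  beta_case \/ exists a, [/\ 0 < size a, size a <= 62 & rigid a].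
Proof.
move=> Ru Rv guv; have [beta|[b [szb sepb]]] := separate_cluster R_cluster; [by left|right].
have rep x : exists m, forall m', inM m' -> G x m' -> inM m && G x m.
  case: (pickP (fun m => inM m && G x m)) => [m mP|none]; first by exists m.
  by exists x => m Mm gm; have := none m; rewrite Mm gm.
have [m1 m1P] := rep u; have [m2 m2P] := rep v.
exists (rest_pebbles u v m1 m2 b); split.
- by rewrite size_cat size_codom card_ord.
- rewrite !size_cat size_codom card_ord.
  by apply: (@leq_trans (5 + (4 + 12))) => //; rewrite !leq_add2l.
- exact: rest_rigid.
Qed.

End FiveClique.

(** ** Complete multipartite graphs with pendant vertices *)

Record multipartite (a : seq V) (M : pred V) : Prop := Multipartite {
  multipartite_pe : forall v v', pe a v v' -> M v = M v';
  multipartite_cocluster : cocluster M;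
  multipartite_touch : forall r m m', ~~ M r -> M m -> M m' -> G r m -> G r m' -> ~~ G m m';
  multipartite_rest : forall u v, ~~ M u -> ~~ M v -> ~~ G u v }.

Definition multipartite_case : Prop :=
  exists a M, [/\ 0 < size a, size a <= 62 & multipartite a M].

Lemma five_clique_case (k : 'I_5 -> V) : (forall i j, i != j -> G (k i) (k j)) ->
  [\/ beta_case, multipartite_case | exists a, [/\ 0 < size a, size a <= 62 & rigid a]].
Proof.
move=> kK; case: (pickP (fun e => [&& ~~ inM k e.1, ~~ inM k e.2 & G e.1 e.2])).
  case=> u v /= /and3P [Ru Rv guv].
  by have [|] := rest_edge_rigid kK Ru Rv guv; [constructor 1|constructor 3].
move=> none; constructor 2; exists (codom k), (inM k); rewrite size_codom card_ord; split=> //.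
split.
- move=> x x' px; rewrite /inM; congr (4 <= #|pred_of_set _|); apply/setP => i; rewrite !inE.
  by rewrite ![G _ (k i)]G_sym; have [_] := peP px (codom_f k i).
- exact: M_cocluster.
- exact: R_touch.
- by move=> u v Ru Rv; have := none (u, v); rewrite /= Ru Rv /= => ->.
Qed.

Section Multipartite.

Variables (a : seq V) (M : pred V).
Hypothesis mM : multipartite a M.

(* [m] lies in the part of [v], or in the part touched by [v]. *)
Definition anchored (v m : V) : bool :=
  M m && (if M v then ~~ G v m else [exists m', [&& M m', G v m' & ~~ G m' m]]).

(** A part with the outside vertices touching it; an outside vertex touching nothing is a block of
    its own. *)
Definition block : rel V := fun v w => (v == w) || [exists m, anchored v m && anchored w m].

Lemma anchored_part (v m m' : V) : anchored v m -> anchored v m' -> ~~ G m m'.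
Proof.
have coM := multipartite_cocluster mM.
case/andP => Mm + /andP [Mm']; case: ifP => [Mv vm vm'|/negbT Rv].
  by apply: (coM m v m') => //; rewrite G_sym.
case/existsP => x /and3P [Mx gx xm] /existsP [y /and3P [My gy ym']].
apply: (coM m x m') => //; first by rewrite G_sym.
by apply: (coM x y m') => //; apply: (multipartite_touch mM) gx gy.
Qed.

Lemma anchored_cong (v m m' : V) : M m' -> anchored v m -> ~~ G m m' -> anchored v m'.
Proof.
have coM := multipartite_cocluster mM.
rewrite /anchored => Mm' /andP [Mm vm] mm'; rewrite Mm' /=; case: ifP vm => [Mv vm|_].
  exact: (coM v m m').
case/existsP => x /and3P [Mx gx xm]; apply/existsP; exists x; rewrite Mx gx.
exact: (coM x m m').
Qed.

Lemma block_refl : reflexive block. Proof. by move=> v; rewrite /block eqxx. Qed.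

Lemma block_sym : symmetric block.
Proof.
by move=> v w; rewrite /block eq_sym; congr (_ || _); apply: eq_existsb => m; rewrite andbC.
Qed.

Lemma block_trans : transitive block.
Proof.
move=> w v u /orP [/eqP -> //|/existsP [m /andP [vm wm]]].
case/orP => [/eqP <-|/existsP [m' /andP [wm' um']]]; rewrite /block.
  by apply/orP; right; apply/existsP; exists m; rewrite vm.
apply/orP; right; apply/existsP; exists m'; rewrite um' andbT.
by apply: anchored_cong vm (anchored_part wm wm'); case/andP: wm'.
Qed.

Lemma block_M (v w : V) : M v -> M w -> block v w = ~~ G v w.
Proof.
move=> Mv Mw; apply/idP/idP.
  case/orP => [/eqP ->|/existsP [m /andP [/andP [Mm +] /andP [_]]]]; first by rewrite G_irr.
  rewrite Mv Mw => vm wm; apply: (multipartite_cocluster mM (y := m)) => //.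
  by rewrite G_sym.
move=> n; apply/orP; right; apply/existsP; exists v.
by rewrite /anchored Mv Mw G_irr G_sym.
Qed.

Lemma block_MR (v w : V) : M v -> ~~ M w -> G v w -> block v w.
Proof.
move=> Mv Rw g; apply/orP; right; apply/existsP; exists v.
rewrite /anchored Mv (negPf Rw) G_irr /=; apply/existsP; exists v.
by rewrite Mv G_irr G_sym g.
Qed.

(** Edges at outside vertices stay inside blocks, and different parts are completely joined. *)
Lemma block_cross (v w : V) : ~~ block v w -> G v w = M v && M w.
Proof.
case: (boolP (M v)) (boolP (M w)) => [Mv|Rv] [Mw|Rw] nb.
- by apply/negPn; rewrite -block_M.
- by apply: contraNF nb; apply: block_MR.
- by apply: contraNF nb; rewrite G_sym block_sym; apply: block_MR.
- exact/negbTE/(multipartite_rest mM).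
Qed.

Lemma block_resolves (b : seq V) (v : V) : {subset a <= b} -> resolves b (block v).
Proof.
move=> sub u u' vu vu' /(pe_sub sub) p; have e := multipartite_pe mM p.
have b' : block u u' by apply: block_trans vu'; rewrite block_sym.
case: (boolP (M u)) => Mu; first by rewrite -block_M -?e.
by apply: (multipartite_rest mM); rewrite -?e.
Qed.

End Multipartite.

(** ** An independent set attached to a cluster *)

Section Beta.

Variables P R : 'I_3 -> V.
Hypothesis beta : beta_at P R.

Local Notation W := (hits_all P R).
Local Notation U := (fun v => ~~ W v).
Local Notation cl := (clique_of U).

Let W_indep (x y : V) : W x -> W y -> ~~ G x y. Proof. exact: beta.2. Qed.
Let clU : cluster U := U_cluster beta.1.
Let Whits (w p q : V) : W w -> ~~ W p -> ~~ W q -> G p q -> G w p || G w q.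
Proof. exact: W_hits beta.1 w p q. Qed.

Definition homogeneous (d : V) : bool :=
  [forall w, forall w', W w && W w' ==> (G w d == G w' d)].

(** Cliques of this kind may be large and numerous and are matched as blocks; the others turn out to
    have at most three vertices. *)
Definition uniform (u : V) : bool := ~~ W u && [forall (d | d \in cl u), homogeneous d].

Lemma mem_cl (u v : V) : (v \in cl u) = ~~ W v && ((v == u) || G u v).
Proof. by rewrite inE. Qed.

Lemma cl_refl (u : V) : ~~ W u -> u \in cl u.
Proof. by move=> Uu; rewrite mem_cl Uu eqxx. Qed.

Lemma cl_eq (u v : V) : ~~ W u -> v \in cl u -> cl v = cl u.
Proof.
rewrite mem_cl => Uu /andP [Uv uv]; apply: clique_of_eq => //.
by rewrite G_sym.
Qed.

Lemma cl_adj (u v w : V) : ~~ W u -> v \in cl u -> w \in cl u -> v != w -> G v w.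
Proof.
move=> Uu vu; rewrite -(cl_eq Uu vu) mem_cl eq_sym => /andP [_ /orP [/eqP ->|//]].
by rewrite eqxx.
Qed.

Lemma uniform_homogeneous (u : V) : uniform u -> homogeneous u.
Proof. by case/andP => Uu /'forall_implyP; apply; apply: cl_refl. Qed.

Lemma uniform_adj (u v : V) : uniform u -> ~~ W v -> G u v -> uniform v.
Proof.
case/andP => Uu hu Uv guv; rewrite /uniform Uv (cl_eq Uu) //.
by rewrite mem_cl Uv guv orbT.
Qed.

Lemma homogeneousPn (d : V) : ~~ homogeneous d ->
  exists w w', [/\ W w, W w', ~~ G w d & G w' d].
Proof.
case/forallPn => w /forallPn [w']; rewrite negb_imply => /andP [/andP [Ww Ww']].
by case gd: (G w d); case gd': (G w' d) => // _; [exists w', w|exists w, w']; rewrite gd gd'.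
Qed.

Lemma not_uniform (u : V) : ~~ W u -> ~~ uniform u ->
  exists d w w', [/\ d \in cl u, W w, W w', ~~ G w d & G w' d].
Proof.
move=> Uu; rewrite /uniform Uu /= => /forallPn [d]; rewrite negb_imply => /andP [du].
by case/homogeneousPn => w [w' [Ww Ww' nd gd]]; exists d, w, w'.
Qed.

(** As [w] misses [d3] it hits [d1] and [d2]; if [w'] hit all three, [d1] and [d2] would be complete
    to [w] and the edge [d3 w']. *)
Lemma triangle_miss (d1 d2 d3 w w' : V) : ~~ W d1 -> ~~ W d2 -> ~~ W d3 ->
  G d1 d2 -> G d1 d3 -> G d2 d3 -> W w -> W w' -> ~~ G w d3 ->
  [|| ~~ G w' d1, ~~ G w' d2 | ~~ G w' d3].
Proof.
move=> U1 U2 U3 g12 g13 g23 Ww Ww' n3; rewrite -!negb_and; apply/negP => /and3P [h1 h2 h3].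
have w1 : G w d1 by have := Whits Ww U1 U3 g13; rewrite (negPf n3) orbF.
have w2 : G w d2 by have := Whits Ww U2 U3 g23; rewrite (negPf n3) orbF.
by apply: (@noF1 d1 d2 w d3 w') => //; try adj; apply: W_indep.
Qed.

(** In a clique of four, [w'] misses at most one vertex, so it hits all of some triangle through
    [d], which [w] misses. *)
Lemma not_uniform_small (u : V) : ~~ W u -> ~~ uniform u -> #|cl u| <= 3.
Proof.
move=> Uu nu; have [d [w [w' [du Ww Ww' nd gd]]]] := not_uniform Uu nu.
have Ucl v : v \in cl u -> ~~ W v by rewrite mem_cl => /andP [].
rewrite leqNgt; apply/negP => big.
have third (s : seq V) : size s <= 3 -> exists2 v, v \in cl u & v \notin s.
  move=> szs; have : 0 < #|cl u :\: [set v in s]|.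
    rewrite cardsD subn_gt0; apply: leq_ltn_trans big; apply: leq_trans szs.
    apply: leq_trans (subset_leq_card (subsetIr _ _)) _; rewrite cardsE; exact: card_size.
  by case/card_gt0P => v; rewrite !inE => /andP [vs /andP [Uv uv]]; exists v; rewrite ?mem_cl ?Uv.
have adjcl v v' : v \in cl u -> v' \in cl u -> v != v' -> G v v' by apply: cl_adj.
have [p pu] := third [:: d] isT; rewrite inE => npd.
have [d' [d'u nd']] : exists d', d' \in cl u /\ ~~ G w' d'.
  have [q qu] := third [:: d; p] isT; rewrite !inE negb_or => /andP [nqd nqp].
  have [g1 g2 g3] : [/\ G p q, G p d & G q d] by split; apply: adjcl; rewrite // eq_sym.
  have := triangle_miss (Ucl p pu) (Ucl q qu) (Ucl d du) g1 g2 g3 Ww Ww' nd.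
  rewrite gd orbF => /orP [h|h].
    by exists p.
  by exists q.
have [q qu] := third [:: d; d'] isT; rewrite !inE negb_or => /andP [nqd nqd'].
have [r ru] := third [:: d; d'; q] isT; rewrite !inE !negb_or => /and3P [nrd nrd' nrq].
have hit v : v \in cl u -> v != d' -> G w' v.
  by move=> vu nv; have := Whits Ww' (Ucl v vu) (Ucl d' d'u) (adjcl _ _ vu d'u nv);
    rewrite (negPf nd') orbF.
have [g1 g2 g3] : [/\ G q r, G q d & G r d] by split; apply: adjcl; rewrite // eq_sym.
have := triangle_miss (Ucl q qu) (Ucl r ru) (Ucl d du) g1 g2 g3 Ww Ww' nd.
by rewrite gd !hit.
Qed.

Section Base.

Variable w0 : V.
Hypotheses (W0 : W w0) (w0_min : forall w, W w ->
  #|[set u | ~~ W u && G w0 u]| <= #|[set u | ~~ W u && G w u]|).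

(** By minimality of [w0], [w] hits two vertices [p], [p'] that [w0] misses. The edge [w0 q] and the
    path [p w p'] must not be P2 + P3, so [q] sees [p] or [p']. *)
Lemma swap_missed (w q q' : V) : W w -> ~~ W q -> ~~ W q' -> q != q' -> ~~ G q q' ->
  ~~ G w q -> ~~ G w q' -> G w0 q -> G w0 q' ->
  exists2 p, ~~ W p & ~~ G w0 p && G p q.
Proof.
move=> Ww Uq Uq' nqq' n nq nq' hq hq'.
pose A0 := [set u | ~~ W u && G w0 u]; pose A := [set u | ~~ W u && G w u].
have gt1 : 1 < #|A0 :\: A|.
  apply/card_gt1P; exists q, q'; rewrite !inE Uq Uq' hq hq' (negPf nq) (negPf nq').
  by split.
have : 1 < #|A :\: A0|.
  apply: leq_trans gt1 _; rewrite -(leq_add2l #|A0 :&: A|) cardsID setIC cardsID.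
  exact: w0_min.
case/card_gt1P => p [p' []]; rewrite !inE => /andP [+ /andP [Up wp]].
rewrite Up /= => n0p /andP [+ /andP [Up' wp']]; rewrite Up' /= => n0p' npp'.
have npp : ~~ G p p'.
  by apply/negP => g; have := Whits W0 Up Up' g; rewrite (negPf n0p) (negPf n0p').
have gpw : G p w by rewrite G_sym.
case: (boolP (G p q)) => gpq; first by exists p; rewrite ?n0p.
case: (boolP (G p' q)) => gp'q; first by exists p'; rewrite ?n0p'.
exfalso; apply: (@noF2 w0 q p w p') => //; try adj; exact: W_indep.
Qed.

Definition missers (u : V) : {set V} := [set w | W w && ~~ G w u].

(** By its size the clique is a triangle. Violations of [noquad] lead to such triangles or to
    [heavy] cliques, and both kinds are few enough to be pebbled entirely. *)
Definition marked (x : V) : bool := [&& ~~ W x, #|cl x| <= 3, ~~ G w0 x &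
  [exists y in cl x, exists y' in cl x, [&& y != x, y' != x, y != y',
     0 < #|missers y| & 0 < #|missers y'|]]].

Definition heavy (y : V) : bool := [&& ~~ W y, #|cl y| <= 3, 1 < #|missers y| &
  [forall (d | d \in cl y), G w0 d]].

Lemma marked_nadj (x x' : V) : marked x -> marked x' -> x != x' -> ~~ G x x'.
Proof.
case/and4P => Ux _ nx _ /and4P [Ux' _ nx' _] _; apply/negP => g.
by have := Whits W0 Ux Ux' g; rewrite (negPf nx) (negPf nx').
Qed.

Lemma marked_others (x t : V) : marked x -> W t -> G t x ->
  exists2 y, ~~ W y & [&& G x y, G w0 y & ~~ G t y].
Proof.
case/and4P => Ux _ n0 /'exists_andP [y [yx /'exists_andP [y' [y'x]]]].
case/and5P => nyx ny'x nyy' gt0 gt0' Wt gtx.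
have Uy : ~~ W y by move: yx; rewrite mem_cl => /andP [].
have Uy' : ~~ W y' by move: y'x; rewrite mem_cl => /andP [].
have gxy : G x y by apply: (cl_adj Ux) => //; [apply: cl_refl|rewrite eq_sym].
have gxy' : G x y' by apply: (cl_adj Ux) => //; [apply: cl_refl|rewrite eq_sym].
have gyy' : G y y' by apply: (cl_adj Ux).
have h0 : G w0 y by have := Whits W0 Ux Uy gxy; rewrite (negPf n0).
have h0' : G w0 y' by have := Whits W0 Ux Uy' gxy'; rewrite (negPf n0).
have [gyx gy'x] : G y x /\ G y' x by split; rewrite G_sym.
have := triangle_miss Uy Uy' Ux gyy' gyx gy'x W0 Wt n0; rewrite gtx orbF => /orP [n|n].
  by exists y; rewrite ?gxy ?h0.
by exists y'; rewrite ?gxy' ?h0'.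
Qed.

Definition touching (x : V) : {set V} := [set w | W w && G w x].

(** Missers of [y] and of [y'] hit [x], and they differ because nobody in [W] misses both ends of
    [y y']. *)
Lemma touching_gt1 (x : V) : marked x -> 1 < #|touching x|.
Proof.
case/and4P => Ux _ n0 /'exists_andP [y [yx /'exists_andP [y' [y'x]]]].
case/and5P => nyx ny'x nyy' /card_gt0P [s] + /card_gt0P [s'].
rewrite !inE => /andP [Ws ns] /andP [Ws' ns'].
have Uy : ~~ W y by move: yx; rewrite mem_cl => /andP [].
have Uy' : ~~ W y' by move: y'x; rewrite mem_cl => /andP [].
have gxy : G x y by apply: (cl_adj Ux) => //; [apply: cl_refl|rewrite eq_sym].
have gxy' : G x y' by apply: (cl_adj Ux) => //; [apply: cl_refl|rewrite eq_sym].
have gyy' : G y y' by apply: (cl_adj Ux).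
have hs : G s x by have := Whits Ws Ux Uy gxy; rewrite (negPf ns) orbF.
have hs' : G s' x by have := Whits Ws' Ux Uy' gxy'; rewrite (negPf ns') orbF.
apply/card_gt1P; exists s, s'; rewrite !inE Ws Ws' hs hs'; split=> //.
by apply: contraNneq ns' => <-; have := Whits Ws Uy Uy' gyy'; rewrite (negPf ns).
Qed.

(** If [s] sees only [x] and two vertices [t], [t'] see only [x'], then [s x] and [t x' t'] are P2 +
    P3. *)
Lemma touching_diff (x x' : V) : marked x -> marked x' -> x != x' ->
  0 < #|touching x :\: touching x'| -> #|touching x' :\: touching x| <= 1.
Proof.
move=> mx mx' neq /card_gt0P [s]; rewrite !inE => /andP [+ /andP [Ws gs]]; rewrite Ws /= => ns.
rewrite leqNgt; apply/negP => /card_gt1P [t [t' []]]; rewrite !inE.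
move=> /andP [+ /andP [Wt gt]] /andP [+ /andP [Wt' gt']]; rewrite Wt Wt' /= => nt nt' ntt'.
have nxx' := marked_nadj mx mx' neq.
have gx't' : G x' t' by rewrite G_sym.
by apply: (@noF2 s x t x' t') => //; try adj; apply: W_indep.
Qed.

Lemma touching_meet (x x' : V) : marked x -> marked x' -> x != x' ->
  exists t, [/\ W t, G t x & G t x'].
Proof.
move=> mx mx' neq.
have : 0 < #|touching x :&: touching x'|.
  rewrite lt0n; apply/negP => /eqP dis.
  have e1 := cardsID (touching x') (touching x); have e2 := cardsID (touching x) (touching x').
  rewrite setIC dis in e2; rewrite dis in e1; rewrite !add0n in e1 e2.
  have := touching_diff mx mx' neq; rewrite e1 e2 (ltnW (touching_gt1 mx)) => /(_ isT).
  by rewrite leqNgt touching_gt1.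
by case/card_gt0P => t; rewrite !inE => /andP [/andP [Wt g] /andP [_ g']]; exists t.
Qed.

(** If [t] sees all three, it misses some [y] in the clique of [x''] that [w0] sees; then [w0 y] and
    [x t x'] are P2 + P3. *)
Lemma touching3 (x x' x'' t : V) : marked x -> marked x' -> marked x'' ->
  x != x' -> x != x'' -> x' != x'' -> W t -> G t x -> G t x' -> ~~ G t x''.
Proof.
move=> m m' m'' n1 n2 n3 Wt g g'; apply/negP => g''.
have [y Uy /and3P [gy hy ny]] := marked_others m'' Wt g''.
have far z : marked z -> z != x'' -> ~~ G y z.
  move=> mz nz; apply/negP => gyz; case/negP: (marked_nadj mz m'' nz).
  case/and4P: (mz) => Uz _ _ _; case/and4P: (m'') => Ux'' _ _ _.
  by apply: (clU Uz Uy Ux'') => //; rewrite G_sym.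
have gxt : G x t by rewrite G_sym.
have n0 z : marked z -> ~~ G w0 z by case/and4P.
apply: (@noF2 w0 y x t x' hy gxt g' n1) => //; try exact: far; try exact: n0.
- exact: marked_nadj.
- exact: W_indep.
- by rewrite G_sym.
Qed.

(** Given four, vertices touching [x1], [x3] and [x1], [x4] are two that touch [x1] but not [x2],
    while one touching [x2], [x3] does not touch [x1]; this contradicts [touching_diff]. *)
Lemma marked_few : #|[set x | marked x]| <= 3.
Proof.
rewrite leqNgt; apply/negP; rewrite cardE.
have : all marked (enum [set x | marked x]) by apply/allP => x; rewrite mem_enum inE.
case: (enum _) (enum_uniq (mem [set x | marked x])) => [|x1 [|x2 [|x3 [|x4 s]]]] //= + + _.
move=> + /and5P [m1 m2 m3 m4 _]; rewrite !inE !negb_or -!andbA.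
case/and5P => n12 n13 n14 _ /and5P [n23 n24 _ n34 _].
have [t [Wt t1 t3]] := touching_meet m1 m3 n13.
have [s' [Ws s1 s4]] := touching_meet m1 m4 n14.
have [r [Wr r2 r3]] := touching_meet m2 m3 n23.
have n21 : x2 != x1 by rewrite eq_sym.
have nt2 : ~~ G t x2 by apply: (@touching3 x1 x3 x2); rewrite // eq_sym.
have nt4 : ~~ G t x4 by apply: (@touching3 x1 x3 x4).
have ns2 : ~~ G s' x2 by apply: (@touching3 x1 x4 x2); rewrite // eq_sym.
have nr1 : ~~ G r x1 by apply: (@touching3 x2 x3 x1); rewrite // eq_sym.
have : #|touching x1 :\: touching x2| <= 1.
  apply: touching_diff => //; apply/card_gt0P; exists r.
  by rewrite !inE Wr r2 nr1.
rewrite leqNgt => /negP; apply; apply/card_gt1P; exists t, s'.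
rewrite !inE Wt Ws t1 s1 nt2 ns2; split=> //.
by apply: contraNneq nt4 => ->.
Qed.

(** In different cliques no vertex of [W] misses both [x] and [y], as [swap_missed] would yield a
    vertex in the clique of [x] missed by [w0]. Two missers of [x] and one of [y] then give P2 +
    P3. *)
Lemma heavy_adj (x y : V) : heavy x -> heavy y -> y \in cl x.
Proof.
case/and4P => Ux _ gt1 /'forall_implyP fx /and4P [Uy _ gt1' /'forall_implyP fy].
rewrite mem_cl Uy; apply/negPn/negP; rewrite negb_or eq_sym => /andP [neq n].
have hx := fx x (cl_refl Ux); have hy := fy y (cl_refl Uy).
have disj w : W w -> ~~ G w x -> G w y.
  move=> Ww nx; apply/negPn/negP => ny.
  have [p Up /andP [np gpx]] := swap_missed Ww Ux Uy neq n nx ny hx hy.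
  by case/negP: np; apply: fx; rewrite mem_cl Up G_sym gpx orbT.
case/card_gt1P: gt1 => s [s' []]; rewrite !inE => /andP [Ws ns] /andP [Ws' ns'] nss'.
case/card_gt1P: gt1' => t [_ [+ _ _]]; rewrite inE => /andP [Wt nt].
have gtx : G t x.
  by apply/negPn/negP => /(disj t Wt); rewrite (negPf nt).
have gys' : G y s' by rewrite G_sym disj.
apply: (@noF2 t x s y s') => //; try adj; try exact: W_indep; exact: disj.
Qed.

(** 13 = 1 + 9 + 3: [w0], at most three marked cliques of at most three vertices each, and one
    clique containing all heavy vertices. *)
Lemma beta_pebbles : exists b, [/\ size b <= 13, w0 \in b,
  forall x d, marked x -> d \in cl x -> d \in b & forall x d, heavy x -> d \in cl x -> d \in b].
Proof.
pose b1 := flatten [seq enum (cl x) | x <- enum [set x | marked x]].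
have sz1 : size b1 <= 9.
  rewrite size_flatten /shape -map_comp sumnE big_map.
  rewrite big_enum /=; apply: (@leq_trans (\sum_(x in [set x | marked x]) 3)).
    apply: leq_sum => x; rewrite inE => /and4P [_ le3 _ _]; by rewrite /= -cardE.
  by rewrite sum_nat_const (leq_mul2r 3 _ 3) marked_few orbT.
have in1 x d : marked x -> d \in cl x -> d \in b1.
  move=> mx dx; apply/flatten_mapP; exists x; first by rewrite mem_enum inE.
  by rewrite mem_enum.
have [b2 sz2 in2] : exists2 b2 : seq V, size b2 <= 3 & forall x d, heavy x -> d \in cl x -> d \in b2.
  case: (pickP heavy) => [x hx|none]; last by exists [::] => // x d; rewrite none.
  exists (enum (cl x)); first by rewrite -cardE; case/and4P: hx.
  move=> y d hy; rewrite mem_enum => dy; have [Ux _ _ _] := and4P hx.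
  by rewrite -(cl_eq Ux (heavy_adj hx hy)).
exists (w0 :: b1 ++ b2); split.
- by rewrite /= size_cat; apply: (leq_add sz1 sz2).
- by rewrite inE eqxx.
- by move=> x d mx dx; rewrite inE mem_cat (in1 x) ?orbT.
- by move=> x d hx dx; rewrite inE mem_cat (in2 x) ?orbT.
Qed.

Variables (b a : seq V) (e : rel V).
Hypotheses (w0_b : w0 \in b) (marked_b : forall x d, marked x -> d \in cl x -> d \in b).
Hypothesis heavy_b : forall x d, heavy x -> d \in cl x -> d \in b.
Hypotheses (sub_a : {subset b <= a}) (W_pe : forall v v', pe a v v' -> W v = W v').
Hypothesis eqe : equitable a e.

Let e_W (v v' : V) : e v v' -> W v = W v'. Proof. by move/(equitable_pe eqe)/W_pe. Qed.
Let e_w0 (v v' : V) : e v v' -> G w0 v = G w0 v'.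
Proof. by move/(equitable_pe eqe)/peP => /(_ _ (sub_a w0_b)) []. Qed.
Let e_b (v v' : V) : e v v' -> v \in b -> v' = v.
Proof. by move/(equitable_pe eqe) => p vb; apply: pe_pebble p (sub_a vb). Qed.

Lemma missers_gt0 (v v' : V) : e v v' -> 0 < #|missers v| -> 0 < #|missers v'|.
Proof.
move=> ev; have closedW u u' : u \in [set w | W w] -> e u u' -> u' \in [set w | W w].
  by rewrite !inE => + /e_W <-.
have split_W x : #|[set u in [set w | W w] | G x u]| + #|missers x| = #|[set w | W w]|.
  rewrite -[RHS](cardsID [set u | G x u]); congr (_ + _); apply: eq_card => u.
    by rewrite !inE.
  by rewrite !inE G_sym andbC.
have := split_W v; rewrite (equitable_deg eqe closedW ev) -(split_W v') => /eqP.
by rewrite eqn_add2l => /eqP ->.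
Qed.

(** A violation contains P2 + P3 or puts a vertex whose class has two elements into a marked or
    heavy clique; but there it is pebbled and alone in its class. *)
Lemma uniform_noquad : noquad e (fun v => ~~ uniform v).
Proof.
move=> x x' y y' nx nx' ny ny' exx' eyy' neq gxy gxy' nx'y nx'y'.
have [z [z' [[_ _ eyz eyz'] [_ nzz'] [_ _ nxz nxz'] [gx'z gx'z' _ _]]]] :=
  fullquad_of_quad eqe exx' eyy' neq gxy gxy' nx'y nx'y'.
have Wx' := e_W exx'; have Wy' := e_W eyy'; have Wz := e_W eyz; have Wz' := e_W eyz'.
have neqx : x != x' by apply: contraNneq nx'y => <-.
case: (boolP (W x)) => Wx; case: (boolP (W y)) => Wy.
- by have := W_indep Wx Wy; rewrite gxy.
- rewrite Wx in Wx'; rewrite (negPf Wy) in Wy' Wz Wz'; symmetry in Wx', Wy', Wz, Wz'.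
  have [Uy' Uz Uz'] : [/\ ~~ W y', ~~ W z & ~~ W z'] by rewrite Wy' Wz Wz'.
  have nyy' : ~~ G y y'.
    by apply/negP => g; have := Whits Wx' Wy Uy' g; rewrite (negPf nx'y) (negPf nx'y').
  have nzz : ~~ G z z'.
    by apply/negP => g; have := Whits Wx Uz Uz' g; rewrite (negPf nxz) (negPf nxz').
  (* The exchange yields [p] in the clique of the adjacent [t], [s], and [p], [t], [s] is a marked
     triangle. *)
  have main t t' s : ~~ W t -> ~~ W t' -> ~~ W s -> t != t' -> ~~ G t t' ->
      ~~ G x' t -> ~~ G x' t' -> ~~ G x s -> e t s -> e t t' -> G t s -> False.
    move=> Ut Ut' Us ntt' n nt nt' ns ets ett' gts.
    have h0 : G w0 t by have := Whits W0 Ut Us gts; rewrite -(e_w0 ets) orbb.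
    have h0' : G w0 t' by rewrite -(e_w0 ett').
    have [p Up /andP [np gpt]] := swap_missed Wx' Ut Ut' ntt' n nt nt' h0 h0'.
    have nps : p != s by apply: contraNneq np => ->; rewrite -(e_w0 ets).
    have mp : marked p.
      have tp : t \in cl p by rewrite mem_cl Ut gpt orbT.
      have sp : s \in cl p by rewrite -(cl_eq Up tp) mem_cl Us gts orbT.
      have npt : t != p by apply: contraTneq gpt => ->; rewrite G_irr.
      rewrite /marked Up np /=; apply/andP; split.
        rewrite -(cl_eq Up tp); apply: not_uniform_small => //.
        apply: contra nt => /uniform_homogeneous /forallP /(_ x') /forallP /(_ w0).
        by rewrite Wx' W0 h0 => /eqP ->.
      apply/'exists_andP; exists t; split=> //; apply/'exists_andP; exists s; split=> //.
      rewrite npt [s == p]eq_sym nps (adj_neq gts) /=; apply/andP; split.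
        by apply/card_gt0P; exists x'; rewrite inE Wx' nt.
      by apply/card_gt0P; exists x; rewrite inE Wx ns.
    have tb : t \in b by apply: (marked_b mp); rewrite mem_cl Ut gpt orbT.
    by rewrite (e_b ett' tb) eqxx in ntt'.
  have eyx t : e y t -> e t y by rewrite (equitable_sym eqe).
  have gyx : G y x by rewrite G_sym.
  have [gyz|nyz] := boolP (G y z); first exact: (main y y' z).
  have [gy'z|ny'z] := boolP (G y' z).
    apply: (main y' y z) => //; rewrite 1?eq_sym 1?G_sym //.
      exact: (equitable_trans eqe) (eyx _ eyy') eyz.
    exact: eyx.
  by apply: (@noF2 x' z y x y') => //; try adj; apply: W_indep.
- rewrite (negPf Wx) in Wx'; rewrite Wy in Wy' Wz Wz'; symmetry in Wx', Wy', Wz, Wz'.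
  have Ux' : ~~ W x' by rewrite Wx'.
  have gyx : G y x by rewrite G_sym.
  case: (boolP (G x x')) => gxx'; last first.
    by apply: (@noF2 x' z y x y') => //; try adj; apply: W_indep.
  have h0 : G w0 x by have := Whits W0 Wx Ux' gxx'; rewrite -(e_w0 exx') orbb.
  have h0' : G w0 x' by rewrite -(e_w0 exx').
  have missx : 1 < #|missers x|.
    apply/card_gt1P; exists z, z'; rewrite !inE Wz Wz' ![G _ x]G_sym nxz nxz'.
    by split.
  have missx' : 0 < #|missers x'|.
    by apply/card_gt0P; exists y; rewrite inE Wy G_sym nx'y.
  have small := not_uniform_small Wx nx.
  have xx : x \in cl x := cl_refl Wx.
  (* Either [w0] sees the whole clique and [x] is heavy, or it misses some [c], which is then marked
     with [x], [x'] as the other two vertices. *)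
  have xb : x \in b.
    case: (boolP [forall (d | d \in cl x), G w0 d]) => [full|/forallPn [c]].
      by apply: (@heavy_b x) => //; rewrite /heavy Wx small missx full.
    rewrite negb_imply => /andP [cx n0c].
    have Uc : ~~ W c by move: cx; rewrite mem_cl => /andP [].
    have ecl := cl_eq Wx cx.
    apply: (@marked_b c); last by rewrite ecl.
    rewrite /marked Uc n0c ecl small /=; apply/'exists_andP; exists x; split=> //.
    apply/'exists_andP; exists x'; rewrite mem_cl Ux' gxx' orbT neqx missx' (ltnW missx).
    split=> //; rewrite andbT; apply/andP; split; first by apply: contraNneq n0c => <-.
    by rewrite andbT; apply: contraNneq n0c => <-.
  by rewrite (e_b exx' xb) eqxx in neqx.
- rewrite (negPf Wx) in Wx'; rewrite (negPf Wy) in Wy' Wz Wz'; symmetry in Wx', Wy', Wz, Wz'.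
  have Uy' : ~~ W y' by rewrite Wy'.
  have small := not_uniform_small Wx nx.
  have gyx : G y x by rewrite G_sym.
  have gy'x : G y' x by rewrite G_sym.
  have gyy' : G y y' by apply: (clU Wy Wx Uy').
  have h0 : G w0 y by have := Whits W0 Wy Uy' gyy'; rewrite -(e_w0 eyy') orbb.
  have h0' : G w0 y' by rewrite -(e_w0 eyy').
  have xcl : x \in cl x := cl_refl Wx.
  have ycl : y \in cl x by rewrite mem_cl Wy gxy orbT.
  have y'cl : y' \in cl x by rewrite mem_cl Uy' gxy' orbT.
  have nyx : y != x by apply: adj_neq.
  have ny'x : y' != x by apply: adj_neq.
  (* With at most three vertices the clique is this triangle, and since it is not uniform every
     vertex of [W] misses one of the three. *)
  have clE : cl x = [set x; y; y'].
    apply/esym/eqP; rewrite eqEcard; apply/andP; split.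
      by apply/subsetP => d; rewrite !inE => /orP [/orP [/eqP ->|/eqP ->]|/eqP ->];
        rewrite -?mem_cl -?in_set // -mem_cl.
    apply: leq_trans small _; rewrite setUC cardsU1 cards2 !inE.
    by rewrite [x == y]eq_sym (negPf ny'x) [y' == y]eq_sym (negPf neq) nyx.
  have [d [w [w' [dx Ww Ww' nwd gw'd]]]] := not_uniform Wx nx.
  have miss3 v : W v -> [|| ~~ G v y, ~~ G v y' | ~~ G v x].
    move=> Wv; move: dx nwd; rewrite clE !inE => /orP [/orP [/eqP ->|/eqP ->]|/eqP ->] nwd.
    + exact: triangle_miss Ww Wv nwd.
    + have := triangle_miss Uy' Wx Wy gy'x _ gxy Ww Wv nwd; rewrite G_sym gyy' => /(_ isT).
      by case/or3P => ->; rewrite ?orbT.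
    + have := triangle_miss Wy Wx Uy' gyx gyy' gxy' Ww Wv nwd.
      by case/or3P => ->; rewrite ?orbT.
  have n0x : ~~ G w0 x by have := miss3 w0 W0; rewrite h0 h0'.
  have missy : 0 < #|missers y|.
    have eyy : e y' y by rewrite (equitable_sym eqe).
    have inm v t : W v -> ~~ G v t -> 0 < #|missers t|.
      by move=> Wv nv; apply/card_gt0P; exists v; rewrite inE Wv.
    case/or3P: (miss3 w' Ww') => n'.
    + exact: inm n'.
    + exact: missers_gt0 eyy (inm _ _ Ww' n').
    + move: dx gw'd nwd; rewrite clE !inE => /orP [/orP [/eqP ->|/eqP ->]|/eqP ->].
      * by rewrite (negPf n').
      * by move=> _; apply: inm.
      * by move=> _ nd; apply: missers_gt0 eyy (inm _ _ Ww nd).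
  have missy' := missers_gt0 eyy' missy.
  have mx : marked x.
    rewrite /marked Wx small n0x /=; apply/'exists_andP; exists y; split=> //.
    by apply/'exists_andP; exists y'; rewrite y'cl nyx ny'x neq missy missy'.
  by rewrite (e_b exx' (marked_b mx xcl)) eqxx in neqx.
Qed.

End Base.

End Beta.

Lemma W_pe (P R : 'I_3 -> V) (a : seq V) (v v' : V) :
  {subset codom P ++ codom R <= a} -> pe a v v' -> hits_all P R v = hits_all P R v'.
Proof.
move=> sub p; apply: eq_forallb => i; rewrite /miss ![G _ (P i)]G_sym ![G _ (R i)]G_sym.
have Pa : P i \in a by apply: sub; rewrite mem_cat codom_f.
have Ra : R i \in a by apply: sub; rewrite mem_cat (codom_f R) orbT.
by have [_ ->] := peP p Pa; have [_ ->] := peP p Ra.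
Qed.

Record cluster_bipartition (a : seq V) (P R : 'I_3 -> V) : Prop := ClusterBipartition {
  bipartition_beta : beta_at P R;
  bipartition_sub : {subset codom P ++ codom R <= a};
  bipartition_noquad : forall e, equitable a e -> noquad e (fun v => ~~ uniform P R v) }.

Lemma cluster_bipartition_exists (P R : 'I_3 -> V) : beta_at P R ->
  exists a, [/\ 0 < size a, size a <= 62 & cluster_bipartition a P R].
Proof.
move=> beta; have szPR : size (codom P ++ codom R) = 6.
  by rewrite size_cat !size_codom card_ord.
case: (pickP (hits_all P R)) => [w W_w|noW]; last first.
  exists (codom P ++ codom R); rewrite szPR; split=> //; split=> // e eqe x x' y y' nx.
  case/negP: nx; rewrite /uniform noW; apply/'forall_implyP => d _.
  by apply/forallP => u; apply/forallP => u'; rewrite noW.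
pose deg w := #|[set u | ~~ hits_all P R u && G w u]|.
have [w0 W0 w0_min] := arg_minnP deg W_w.
have [b [szb w0b mb hb]] := beta_pebbles beta W0 w0_min.
pose a := (codom P ++ codom R) ++ b; exists a.
have sub1 : {subset codom P ++ codom R <= a} by move=> v vin; rewrite mem_cat vin.
have sub2 : {subset b <= a} by move=> v vin; rewrite mem_cat vin orbT.
rewrite size_cat szPR; split=> //; first exact: leq_trans (leq_add (leqnn 6) szb) _.
split=> // e eqe.
exact: (uniform_noquad beta W0 w0_min w0b mb hb sub2 (fun v v' => W_pe sub1) eqe).
Qed.

Lemma graph_trichotomy : 0 < #|V| -> exists a, [/\ 0 < size a, size a <= 62 &
  [\/ rigid a, exists M, multipartite a M | exists P R, cluster_bipartition a P R]].
Proof.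
move=> V_gt0.
have fromBeta : beta_case -> exists a, [/\ 0 < size a, size a <= 62 &
  [\/ rigid a, exists M, multipartite a M | exists P R, cluster_bipartition a P R]].
  case=> P [R /cluster_bipartition_exists [a [sa1 sa2 bip]]]; exists a; split=> //.
  by constructor 3; exists P, R.
have fromRigid : (exists a, [/\ 0 < size a, size a <= 62 & rigid a]) ->
    exists a, [/\ 0 < size a, size a <= 62 &
  [\/ rigid a, exists M, multipartite a M | exists P R, cluster_bipartition a P R]].
  by case=> a [sa1 sa2 ra]; exists a; split=> //; constructor 1.
case: (pickP (fun k : {ffun 'I_5 -> V} => [forall i, forall j, (i != j) ==> G (k i) (k j)])).
  move=> k kK; have {}kK i j : i != j -> G (k i) (k j).
    by move/forallP: kK => /(_ i) /forallP /(_ j) /implyP.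
  have [||] := five_clique_case kK.
  - exact: fromBeta.
  - by case=> a [M [sa1 sa2 mM]]; exists a; split=> //; constructor 2; exists M.
  - exact: fromRigid.
move=> noK; have k5 : K5_free.
  move=> k kK; have /negP := noK [ffun i => k i]; apply; apply/forallP => i; apply/forallP => j.
  by apply/implyP => /kK; rewrite !ffunE.
by case: (K5_free_case k5 V_gt0).
Qed.
End Graphs.

(** * Identification of the graphs of the class *)

Section Identification.

Variables (n k N : nat) (G : bool -> rel 'I_n) (E : rel (point n k)) (d : 'I_n).
Hypotheses (gameE : pebble_equiv G E) (le_Nk : N + N <= k) (le_N : 70 <= N).

Local Notation V := 'I_n.
Local Notation Q := (Q N E d).
Local Notation IdS := (IdS N G E d).
Local Notation "v ~[ a ] w" := (Q (false, a ++ v) (false, a ++ w)) (at level 70).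
Local Notation colour a := (fun v v' => [:: v] ~[a] [:: v']).

Let QS x y : Q x y -> Q y x. Proof. exact: (Q_sym gameE). Qed.

Let QT y x z : Q x y -> Q y z -> Q x z. Proof. exact: (Q_trans gameE). Qed.

(** The bijection of the game preserves colour and adjacency at once, hence the degrees into unions
    of classes. *)
Lemma colour_equitable (a : seq V) : 0 < size a -> size a + 2 <= N ->
  equitable (G false) a (colour a).
Proof.
move=> a_gt0 le_a; have lt1 (v : V) : size a + size [:: v] < N by rewrite -addnS.
have tail v w v' w' (idx : seq nat) : [:: v; w] ~[a] [:: v'; w'] -> all (gtn 2) idx ->
    size idx <= 2 ->
    [seq nth d [:: v; w] i | i <- idx] ~[a] [seq nth d [:: v'; w'] i | i <- idx].
  move=> q lts le; apply: (Q_tail0 gameE le_Nk q a_gt0 lts).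
  by apply: leq_trans le_a; rewrite leq_add2l.
split.
- by move=> v; apply: (Q_refl d gameE); rewrite size_cat ?ltn_addr // ltnW.
- by move=> v v'; apply/idP/idP; apply: QS.
- by move=> v v' v''; apply: QT.
- move=> v v' q; apply/allP => c ca; set i := index c a.
  have lti : i < size a by rewrite index_mem.
  have [e1 e2] : i < size (a ++ [:: v]) /\ size a < size (a ++ [:: v]).
    by rewrite size_cat addn1 ltnSn ltnS ltnW.
  have := Q_atom gameE le_Nk q e1 e2.
  by rewrite !nth_cat lti ltnn subnn /= nth_index // => -[-> ->]; rewrite !eqxx.
- move=> X v v' closedX q.
  have card (w : V) : #|[set u in X | G false w u]| = #|[pred u | (u \in X) && G false w u]|.
    by apply: eq_card => u; rewrite !inE.
  rewrite !card; apply: (card_inv gameE le_Nk q (lt1 v)) => u u' q' /=.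
  have [_ /= ->] := Q_adj gameE le_Nk (i := 0) (j := 1) q' erefl isT isT.
  have qu : [:: u] ~[a] [:: u'] := tail _ _ _ _ [:: 1] q' isT isT.
  congr (_ && _); apply/idP/idP => uX; first exact: closedX uX qu.
  by apply: closedX uX _; apply: QS.
Qed.

Hypotheses (G_sym : symmetric (G false)) (G_irr : irreflexive (G false)).
Hypothesis noF2 : forall p q x y z : V, G false p q -> G false x y -> G false y z ->
  x != z -> ~~ G false x z -> ~~ G false p x -> ~~ G false p y -> ~~ G false p z ->
  ~~ G false q x -> ~~ G false q y -> ~~ G false q z -> False.
Hypothesis noF1 : forall a b c e f : V, G false a b -> G false a c -> G false a e ->
  G false a f -> G false b c -> G false b e -> G false b f -> G false e f ->
  ~~ G false c e -> ~~ G false c f -> False.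

Section Pebbles.

Variable a : seq V.
Hypotheses (a_gt0 : 0 < size a) (le_a : size a <= 62).

Let a_le (m : nat) : m <= 8 -> size a + m <= N.
Proof. by move=> le; apply: leq_trans le_N; apply: (leq_add le_a le). Qed.

Let eq_a : equitable (G false) a (colour a).
Proof. by apply: colour_equitable => //; apply: a_le. Qed.

Let tail (x y : seq V) (idx : seq nat) : x ~[a] y -> all (gtn (size x)) idx ->
  size idx <= 8 -> [seq nth d x i | i <- idx] ~[a] [seq nth d y i | i <- idx].
Proof. by move=> q lts le; apply: (Q_tail0 gameE le_Nk q a_gt0 lts); apply: a_le. Qed.

Let atom (x y : seq V) (i j : nat) : x ~[a] y -> i < size x -> j < size x ->
  (nth d x i == nth d x j) = (nth d y i == nth d y j) /\
  G false (nth d x i) (nth d x j) = G false (nth d y i) (nth d y j).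
Proof. by move=> q; apply: (Q_adj gameE le_Nk q erefl). Qed.

Let grow (x y : seq V) (w : V) : x ~[a] y -> size x < 8 ->
  exists w', rcons x w ~[a] rcons y w'.
Proof.
move=> q lt; have [|f _ fQ] := Q_grow gameE le_Nk q; last by exists (f w).
by rewrite -addnS; apply: a_le.
Qed.

Let pe_colour (v v' : V) : [:: v] ~[a] [:: v'] -> pe (G false) a v v'.
Proof. exact: (equitable_pe eq_a). Qed.

Lemma rigid_IdS : rigid (G false) a -> IdS a predT.
Proof.
move=> ra; apply: (quad_IdS gameE le_Nk a_gt0 _ G_sym) => //; first exact: a_le.
by move=> x x' y y' _ _ _ _; apply: (ra _ eq_a).
Qed.

Section Multipartite.

Variable M : pred V.
Hypothesis mM : multipartite (G false) a M.

Local Notation B := (block (G false) M).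

Lemma anchored_inv (v m v' m' : V) : anchored (G false) M v m ->
  [:: v; m] ~[a] [:: v'; m'] -> anchored (G false) M v' m'.
Proof.
case/andP => Mm vm q.
have ev := multipartite_pe mM (pe_colour (tail (idx := [:: 0]) q isT isT)).
have em := multipartite_pe mM (pe_colour (tail (idx := [:: 1]) q isT isT)).
rewrite /= in ev em; rewrite /anchored -ev -em Mm; case: ifP vm => _.
  by have [_ /= ->] := atom (i := 0) (j := 1) q isT isT.
case/existsP => x /and3P [Mx gx nx]; have [y q'] := grow x q isT.
have [_ /= e1] := atom (i := 0) (j := 2) q' isT isT.
have [_ /= e2] := atom (i := 2) (j := 1) q' isT isT.
have ex := multipartite_pe mM (pe_colour (tail (idx := [:: 2]) q' isT isT)).
by apply/existsP; exists y; rewrite /= in ex; rewrite -ex -e1 -e2 Mx gx nx.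
Qed.

Lemma block_inv (v w v' w' : V) : B v w -> [:: v; w] ~[a] [:: v'; w'] -> B v' w'.
Proof.
move=> /orP [/eqP ->|/existsP [m /andP [vm wm]]] q.
  have [+ _] := atom (i := 0) (j := 1) q isT isT.
  by rewrite /= eqxx => /esym/eqP ->; apply: block_refl.
have [m' q'] := grow m q isT; apply/orP; right; apply/existsP; exists m'.
rewrite (anchored_inv vm (tail (idx := [:: 0; 2]) q' isT isT)).
exact: (anchored_inv wm (tail (idx := [:: 1; 2]) q' isT isT)).
Qed.

(** Between blocks the colours decide through [M]. Inside a block the classes are independent, which
    excludes quads. *)
Lemma multipartite_IdS : IdS a predT.
Proof.
apply: (glue gameE le_Nk (B := B) a_gt0) => //; first exact: a_le.
- exact: block_refl.
- exact: block_sym.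
- exact: (block_trans G_sym mM).
- by move=> v w v' w' _; apply: block_inv.
- move=> v v' w w' _ _ _ _ nb nb' q q'.
  rewrite (block_cross G_sym G_irr mM nb) (block_cross G_sym G_irr mM nb').
  by rewrite (multipartite_pe mM (pe_colour q)) (multipartite_pe mM (pe_colour q')).
move=> v _; have sza : size (a ++ [:: v]) = size a + 1 by rewrite size_cat.
have inv w w' : B v w -> [:: w] ~[a ++ [:: v]] [:: w'] -> B v w'.
  by move=> vw; rewrite -!catA; apply: block_inv.
have sub : {subset a <= a ++ [:: v]} by move=> c ca; rewrite mem_cat ca.
have eq_av : equitable (G false) (a ++ [:: v]) (colour (a ++ [:: v])).
  by apply: colour_equitable; rewrite sza ?addn1 // -addn1 -addnA; apply: a_le.
apply: (quad_IdS gameE le_Nk _ _ G_sym) => //.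
- by rewrite sza addn1.
- by rewrite sza -addnA; apply: a_le.
have := resolves_noquad G_sym noF2 eq_av inv (block_resolves G_sym G_irr mM (v := v) sub).
exact.
Qed.

End Multipartite.

Section Bipartition.

Variables P R : 'I_3 -> V.
Hypothesis bip : cluster_bipartition (G false) a P R.

Local Notation W := (hits_all (G false) P R).
Local Notation unif := (uniform (G false) P R).

Let W_colour (v v' : V) : [:: v] ~[a] [:: v'] -> W v = W v'.
Proof. by move=> q; apply: (W_pe G_sym (bipartition_sub bip)); apply: pe_colour. Qed.

(** A failure of uniformity is witnessed by three vertices, for which the game finds counterparts at
    any vertex of the same colour. *)
Lemma uniform_inv (v v' : V) : [:: v] ~[a] [:: v'] -> unif v' -> unif v.
Proof.
move=> q uv'; have [Uv' /'forall_implyP hom] := andP uv'.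
have Uv : ~~ W v by rewrite (W_colour q).
apply/negPn/negP => /(not_uniform Uv) [c [w [w' [+ Ww Ww' nw gw']]]].
rewrite inE => /andP [Uc vc]; have [c' q1] := grow c q isT.
have [w1 q2] := grow w q1 isT; have [w1' q3] := grow w' q2 isT; rewrite /= in q3.
have Uc' : ~~ W c' by rewrite -(W_colour (tail (idx := [:: 1]) q3 isT isT)).
have Ww1 : W w1 by rewrite -(W_colour (tail (idx := [:: 2]) q3 isT isT)).
have Ww1' : W w1' by rewrite -(W_colour (tail (idx := [:: 3]) q3 isT isT)).
have [e1 e2] := atom (i := 1) (j := 0) q3 isT isT; rewrite /= in e1 e2.
have [_ e3] := atom (i := 2) (j := 1) q3 isT isT; rewrite /= in e3.
have [_ e4] := atom (i := 3) (j := 1) q3 isT isT; rewrite /= in e4.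
have cin : c' \in clique_of (G false) (fun u => ~~ W u) v'.
  by rewrite inE Uc' -e1 G_sym -e2 G_sym.
have /forallP /(_ w1) /forallP /(_ w1') := hom c' cin.
by rewrite Ww1 Ww1' -e3 -e4 gw' (negPf nw).
Qed.

Lemma uniform_colour (v v' : V) : [:: v] ~[a] [:: v'] -> unif v = unif v'.
Proof. by move=> q; apply/idP/idP; apply: uniform_inv => //; apply: QS. Qed.

Lemma cohit_colour (v v' : V) : [:: v] ~[a] [:: v'] ->
  [exists w, W w && G false w v] -> [exists w, W w && G false w v'].
Proof.
move=> q /existsP [w /andP [Ww gw]]; have [w' q'] := grow w q isT.
apply/existsP; exists w'; have [_ /= <-] := atom (i := 1) (j := 0) q' isT isT.
by rewrite gw -(W_colour (tail (idx := [:: 1]) q' isT isT)) Ww.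
Qed.

Lemma uniform_hit (v w : V) : unif v -> W w -> G false w v = [exists w, W w && G false w v].
Proof.
move=> uv Ww; apply/idP/existsP => [gw|[w' /andP [Ww' gw']]]; first by exists w; rewrite Ww.
have /forallP /(_ w) /forallP /(_ w') := uniform_homogeneous uv.
by rewrite Ww Ww' => /eqP ->.
Qed.

Let inter : rel V := interdef N E d a.

(** Uniform cliques become blocks whatever their size. All other vertices, those of [W] included,
    are covered by [bipartition_noquad] and grouped by interdefinability. *)
Definition piece : rel V := fun v w =>
  (v == w) || [&& unif v, unif w & G false v w] || [&& ~~ unif v, ~~ unif w & inter v w].

Let le5 : size a + 5 <= N. Proof. exact: a_le. Qed.

Lemma piece_trans : transitive piece.
Proof.
move=> w v u pvw pwu; have [e|nvw] := eqVneq v w; first by rewrite e.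
have [e|nwu] := eqVneq w u; first by rewrite -e.
have [->|nvu] := eqVneq v u; first by rewrite /piece eqxx.
move: pvw pwu; rewrite /piece (negPf nvw) (negPf nwu) (negPf nvu) /=.
case: (boolP (unif v)) => uv; case: (boolP (unif w)) => uw; case: (boolP (unif u)) => uu //=;
  rewrite ?orbF //.
- have [[Uv _] [Uw _]] := (andP uv, andP uw); have [Uu _] := andP uu.
  by move=> g1 g2; apply: (U_cluster G_sym noF2 (bipartition_beta bip).1 Uv Uw Uu g1 g2 nvu).
- exact: (interdef_trans gameE le_Nk a_gt0 le5).
Qed.

(** A uniform vertex sees all of [W] or nothing of it, and outside [W] only its own clique, so its
    edges to other blocks depend on colours. Between the remaining vertices [interdef_cross]
    applies. *)
Lemma bipartition_IdS : IdS a predT.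
Proof.
have cU := U_cluster G_sym noF2 (bipartition_beta bip).1.
have nquad := bipartition_noquad bip eq_a.
apply: (glue gameE le_Nk (B := piece) a_gt0) => //; first exact: a_le.
- by move=> v; rewrite /piece eqxx.
- move=> v w; rewrite /piece eq_sym G_sym [inter _ _]interdef_sym.
  by congr (_ || _ || _); rewrite andbCA.
- exact: piece_trans.
- move=> v w v' w' _ + q; have [e1 e2] := atom (i := 0) (j := 1) q isT isT.
  rewrite /= in e1 e2; have u1 := uniform_colour (tail (idx := [:: 0]) q isT isT).
  have u2 := uniform_colour (tail (idx := [:: 1]) q isT isT); rewrite /= in u1 u2.
  rewrite /piece -e1 -e2 -u1 -u2; case/orP => [->//|/and3P [-> -> /=]].
  by move=> vw; rewrite /inter (interdef_inv gameE le_Nk a_gt0 le5 vw q) orbT.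
- have half v v' w w' : [:: v] ~[a] [:: w] -> [:: v'] ~[a] [:: w'] -> unif v ->
      ~~ piece v v' -> ~~ piece w w' -> G false v v' = G false w w'.
    move=> q q' uv; rewrite /piece !negb_or => /andP [/andP [nvv nG] _] /andP [/andP [nww nG'] _].
    have uw : unif w by rewrite -(uniform_colour q).
    case: (boolP (W v')) => Wv'; last first.
      have none x x' : unif x -> ~~ W x' -> ~~ [&& unif x, unif x' & G false x x'] -> G false x x' = false.
        move=> ux Ux' nx; apply: contraNF nx => g; rewrite ux g andbT.
        exact: (uniform_adj G_sym noF2 (bipartition_beta bip) ux Ux' g).
      have Ww' : ~~ W w' by rewrite -(W_colour q').
      by rewrite (none v v' uv Wv' nG) (none w w' uw Ww' nG').
    have Ww' : W w' by rewrite -(W_colour q').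
    rewrite G_sym [RHS]G_sym (uniform_hit uv Wv') (uniform_hit uw Ww').
    by apply/idP/idP; apply: cohit_colour => //; apply: QS.
  move=> v v' w w' _ _ _ _ nb nb' q q'.
  have sympiece x y : piece x y = piece y x.
    rewrite /piece eq_sym G_sym [inter _ _]interdef_sym.
    by congr (_ || _ || _); rewrite andbCA.
  case: (boolP (unif v)) => uv; first exact: half.
  case: (boolP (unif v')) => uv'.
    by rewrite G_sym [RHS]G_sym; apply: half => //; rewrite sympiece.
  have [uw uw'] : ~~ unif w /\ ~~ unif w' by rewrite -(uniform_colour q) -(uniform_colour q').
  move: nb nb'; rewrite /piece !negb_or uv uv' uw uw' /= => /andP [_ ni] /andP [_ ni'].
  have sinv x x' : ~~ unif x -> [:: x] ~[a] [:: x'] -> ~~ unif x'.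
    by move=> + /uniform_colour <-.
  apply/idP/idP.
    by apply: (interdef_cross gameE le_Nk a_gt0 le5 G_sym sinv nquad).
  by apply: (interdef_cross gameE le_Nk a_gt0 le5 G_sym sinv nquad) => //; apply: QS.
move=> v _; case: (boolP (unif v)) => uv; last first.
  apply: (@IdS_sub _ _ _ _ _ _ _ _ (inter v)).
    move=> w /orP [/orP [/eqP <-|]|/and3P [] //]; last by rewrite (negPf uv).
    exact: (interdef_refl d gameE le_Nk a v).
  exact: (interdef_IdS gameE le_Nk a_gt0 le5).
have sza : size (a ++ [:: v]) = size a + 1 by rewrite size_cat.
have pieceE w : piece v w = (v == w) || (unif w && G false v w).
  by rewrite /piece uv orbF.
have inv w w' : piece v w -> [:: w] ~[a ++ [:: v]] [:: w'] -> piece v w'.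
  rewrite -!catA !pieceE => pw q; have [e1 e2] := atom (i := 0) (j := 1) q isT isT.
  have := uniform_colour (tail (idx := [:: 1]) q isT isT); rewrite /= in e1 e2 *.
  by rewrite -e1 -e2 => <-.
have complete w w' : piece v w -> piece v w' -> w != w' -> G false w w'.
  have Uof x : piece v x -> ~~ W x.
    by rewrite pieceE => /orP [/eqP <-|/andP [/andP []]] //; case/andP: uv.
  move=> pw pw' neq; have [Uv Uw Uw'] : [/\ ~~ W v, ~~ W w & ~~ W w'].
    by split; apply: Uof => //; rewrite pieceE eqxx.
  move: pw pw' neq; rewrite !pieceE.
  case/orP => [/eqP <-|/andP [_ g]] /orP [/eqP <-|/andP [_ g']] neq //.
  - by rewrite eqxx in neq.
  - by rewrite G_sym.
  - by apply: (cU w v w') => //; rewrite G_sym.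
apply: (eq_IdS gameE le_Nk) => //.
- by rewrite sza addn1.
- by rewrite sza -addnA; apply: a_le.
- by move=> w w' u u' pw pw' pu pu' n1 n2 _ _; rewrite !complete.
Qed.

End Bipartition.

End Pebbles.

Lemma graph_IdS : 0 < n -> exists a, [/\ 0 < size a, size a + 1 <= N & IdS a predT].
Proof.
move=> n_gt0; have V_gt0 : 0 < #|V| by rewrite card_ord.
have [a [sa1 sa2 cases]] := graph_trichotomy G_sym G_irr noF2 noF1 V_gt0.
exists a; split=> //; first by apply: leq_trans le_N; rewrite addn1 ltnS; apply: leq_trans sa2 _.
case: cases => [ra|[M mM]|[P [R bip]]].
- exact: rigid_IdS.
- exact: (multipartite_IdS sa1 sa2 mM).
- exact: (bipartition_IdS sa1 sa2 bip).
Qed.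

End Identification.

(** * The forbidden induced subgraphs as vertex configurations *)

Section Forbidden.

Variables (V : finType) (G : rel V).
Hypotheses (G_sym : symmetric G) (G_irr : irreflexive G).

Lemma induced_of_seq (H : rel 'I_5) (x0 : V) (s : seq V) : size s = 5 -> uniq s ->
  (forall i j : 'I_5, H i j = G (nth x0 s i) (nth x0 s j)) -> induced_sub H G.
Proof.
move=> sz us HG; exists (fun i : 'I_5 => nth x0 s i); split=> // i j /eqP.
by rewrite nth_uniq ?sz // => /eqP/val_inj.
Qed.

Ltac adj := solve [assumption | rewrite G_sym; assumption].

Lemma free_P2_P3 : H_free gP2_P3 G -> forall p q x y z : V, G p q -> G x y -> G y z ->
  x != z -> ~~ G x z -> ~~ G p x -> ~~ G p y -> ~~ G p z -> ~~ G q x -> ~~ G q y ->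
  ~~ G q z -> False.
Proof.
move=> free p q x y z gpq gxy gyz nxz ngxz px py pz qx qy qz; apply: free.
have gqp : G q p by rewrite G_sym.
apply: (@induced_of_seq _ p [:: p; q; x; y; z]) => //.
  rewrite /= !inE !negb_or (adj_neq G_irr gpq) (adj_neq G_irr gxy) (adj_neq G_irr gyz) nxz.
  rewrite (adj_sep gqp qx) (adj_sep gqp qy) (adj_sep gqp qz).
  by rewrite (adj_sep gpq px) (adj_sep gpq py) (adj_sep gpq pz).
case=> [[|[|[|[|[|i]]]]] lti] // [[|[|[|[|[|j]]]]] ltj] //; rewrite /gP2_P3 /= ?G_irr //;
  symmetry; first [adj | apply/negbTE; adj].
Qed.

Lemma free_co_2P1_P3 : H_free co_2P1_P3 G -> forall a b c e f : V, G a b -> G a c -> G a e ->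
  G a f -> G b c -> G b e -> G b f -> G e f -> ~~ G c e -> ~~ G c f -> False.
Proof.
move=> free a b c e f ab ac ae af bc be bf ef nce ncf; apply: free.
have gfe : G f e by rewrite G_sym.
have nec : ~~ G e c by rewrite G_sym.
have nfc : ~~ G f c by rewrite G_sym.
(* This order puts [c], the vertex missing [e] and [f], at index 3, the centre of the path in the
   complement. *)
apply: (@induced_of_seq _ a [:: a; b; e; c; f]) => //.
  rewrite /= !inE !negb_or (adj_neq G_irr ab) (adj_neq G_irr ac) (adj_neq G_irr ae).
  rewrite (adj_neq G_irr af) (adj_neq G_irr bc) (adj_neq G_irr be) (adj_neq G_irr bf).
  by rewrite (adj_neq G_irr ef) (adj_sep gfe nfc) eq_sym (adj_sep ef nec).
case=> [[|[|[|[|[|i]]]]] lti] // [[|[|[|[|[|j]]]]] ltj] //;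
  rewrite /co_2P1_P3 /compl_graph /g2P1_P3 -val_eqE /= ?G_irr //;
  symmetry; first [adj | apply/negbTE; adj].
Qed.

End Forbidden.

Theorem theorem4 :
  GI_poly_time_on (fun n (G : rel 'I_n) =>
    H_free co_2P1_P3 G /\ H_free gP2_P3 G).
Proof.
(* [N] and [k] are kept abstract so that no unary numeral of this size gets unfolded. *)
have [N le_N] : exists N, 70 <= N by exists 70.
have [k le_Nk] : exists k, N + N <= k by exists (N + N).
have [M [c [r [acc_rej wl]]]] := wl_poly_time k.
exists M, c, r; split=> // n m G1 G2 [sym1 irr1] _ [F1 F2] _ /=.
have [b [-> iso_b b_iso]] := wl n m G1 G2; split=> [/iso_b -> //|nonIso].
case: ifP => // bT; case: nonIso; have [e [E [gameE acc]]] := b_iso bT.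
(* The empty graph has no vertex to serve as the default [d] and is treated apart. *)
case: n G1 sym1 irr1 F1 F2 {wl iso_b b_iso} e E gameE acc => [|n] G1 sym1 irr1 F1 F2 e E gameE acc.
  exists (cast_ord (esym e)); split; last by case.
  by exists (cast_ord e) => x; rewrite ?cast_ordK ?cast_ordKV.
have [a [a_gt0 le_a ida]] := graph_IdS ord0 gameE le_Nk le_N sym1 irr1
  (free_P2_P3 sym1 irr1 F2) (free_co_2P1_P3 sym1 irr1 F1) (ltn0Sn n).
have [f f_bij fG] := iso_of_IdS gameE le_Nk acc a_gt0 le_a ida.
exists (cast_ord (esym e) \o f); split; last by move=> x y; rewrite -(fG x y).
by apply: bij_comp f_bij; exists (cast_ord e) => x; rewrite ?cast_ordK ?cast_ordKV.
Qed.
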